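(* Suppose the smoothness assumption stated in the context holds and $\lambda=\lambda_n>0$ satisfies $\sqrt{n}\lambda=o(1)$, $n^{-1}\lambda^{-1/m}(-\log\lambda)^{2|S_{\sup}|-2}=o(1)$ and $\sqrt{n}\alpha_n=o(1)$ as $n\to\infty$, where $$\alpha_n=\beta_n\Big(n^{-1/2}\lambda^{-1/(4m)}(-\log\lambda)^{(|S_{\sup}|-1)/2}+\lambda^{1/2}J^{1/2}(f^\ast)\Big),$$ $$\beta_n=n^{-1/2}\lambda^{-1/(2m)}\lambda^{-1/(4m-2\tau-2)}\lambda^{1/(8m^2-4m\tau-4m)}(-\log\lambda)^{(|S_{\sup}|-1)(1-1/(4m-2\tau-2))}\Big(\log\big(\lambda^{1/(4m)-1/2}(-\log\lambda)^{(1-|S_{\sup}|)/2}\big)\Big)^{1/2}(\log n)^{1/2},$$ with $\tau=0$ if $|S_{\sup}|=1$ and $\tau$ a fixed value in $(0,2m-2)$ if $|S_{\sup}|>1$. Then for each $S\in\mathbb{S}\setminus\{\emptyset\}$, $$\|\hat f_S-f^\ast_S\|_{S,\lambda}=\mathcal{O}_{\mathbb{P}}\Big(n^{-1/2}\lambda^{-1/(4m)}(-\log\lambda)^{(|S|-1)/2}+\lambda^{1/2}J_S^{1/2}(f^\ast_S)\Big),$$ and for the intercept, $|\hat f_\emptyset-f^\ast_\emptyset|=\|\hat f_\emptyset-f^\ast_\emptyset\|_{\emptyset,\lambda}=\mathcal{O}_{\mathbb{P}}(n^{-1/2})$.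
   Context: Fix integers $d\ge1$ and $m\ge2$. For $j=1,\dots,d$, let $\mathcal{H}_{[j]}$ be the Sobolev space of $f\in\mathcal{L}_2[0,1]$ with $f,\dots,f^{(m-1)}$ absolutely continuous and $f^{(m)}\in\mathcal{L}_2[0,1]$. Let $\mathcal{H}_{\{j\}}=\{f\in\mathcal{H}_{[j]}:\int_0^1 f=0\}$ with inner product $\langle f,g\rangle_{\{j\}}=\sum_{l=1}^{m-1}\big(\int_0^1 f^{(l)}\big)\big(\int_0^1 g^{(l)}\big)+\int_0^1 f^{(m)}g^{(m)}$. For nonempty $S\subseteq\{1,\dots,d\}$, $\mathcal{H}_S=\otimes_{j\in S}\mathcal{H}_{\{j\}}$ (Hilbert tensor product; functions of $x_S=(x_{[j]})_{j\in S}\in[0,1]^{|S|}$) with the tensor-product inner product $\langle\cdot,\cdot\rangle_S$; $\mathcal{H}_\emptyset$ is the space of constants. Let $\mathbb{S}$ be a collection of subsets of $\{1,\dots,d\}$ with $\emptyset\in\mathbb{S}$, and $\mathcal{H}=\oplus_{S\in\mathbb{S}}\mathcal{H}_S$; each $f\in\mathcal{H}$ is uniquely $f=\sum_{S\in\mathbb{S}}f_S$ with $f_S\in\mathcal{H}_S$. Let $S_{\sup}$ be an element of $\mathbb{S}$ of maximal cardinality. Define $V_S(f_S,g_S)=\int_{[0,1]^{|S|}}f_Sg_S\,dx_S$ ($V_\emptyset(a,b)=ab$), $J_\emptyset=0$, $J_S(f_S,g_S)=\langle f_S,g_S\rangle_S$ for $S\ne\emptyset$, $J(f,g)=\sum_{S\in\mathbb{S}}J_S(f_S,g_S)$,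 $J(f)=J(f,f)$, $J_S(f_S)=J_S(f_S,f_S)$. For $\lambda>0$, $\|\cdot\|_{S,\lambda}$ is the norm of the inner product $V_S+\lambda J_S$ on $\mathcal{H}_S$. Data: $X$ has independent Uniform$[0,1]$ coordinates, $Y=f^\ast(X)+\epsilon$ with $f^\ast=\sum_{S\in\mathbb{S}}f^\ast_S\in\mathcal{H}$, $f^\ast_S\in\mathcal{H}_S$, $\epsilon$ independent of $X$, $\mathbb{E}\epsilon=0$, $\mathrm{Var}(\epsilon)=\sigma^2$, $\mathbb{E}\epsilon^4<\infty$; $(X_i,Y_i,\epsilon_i)$, $i=1,\dots,n$, are i.i.d. copies. Smoothness assumption: for each $S\in\mathbb{S}\setminus\{\emptyset\}$, $J_S(f^\ast_S)\le\mathcal{C}_{J,S}$ for a constant $\mathcal{C}_{J,S}\in(0,\infty)$. The estimator is $\hat f=\arg\min_{f\in\mathcal{H}}\frac1{2n}\sum_{i=1}^n(Y_i-f(X_i))^2+\frac\lambda2J(f)$, decomposed as $\hat f=\sum_{S\in\mathbb{S}}\hat f_S$ with $\hat f_S\in\mathcal{H}_S$. The tuning parameter $\lambda=\lambda_n$ depends on $n$. *)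

(* Defs.v *)
From HB Require Import structures.
From mathcomp Require Import all_boot all_order all_algebra.
From mathcomp Require Import all_classical all_reals all_analysis.
Set Implicit Arguments. Unset Strict Implicit. Unset Printing Implicit Defensive.
Import Order.TTheory GRing.Theory Num.Theory.
Import numFieldNormedType.Exports.
Local Open Scope classical_set_scope.
Local Open Scope ring_scope.

Definition int01 {R : realType} (f : R -> R) : R :=
  \int[(@lebesgue_measure R)]_(t in `[0%R, 1%R]) f t.
Definition int0x {R : realType} (x : R) (f : R -> R) : R :=
  \int[(@lebesgue_measure R)]_(t in `[0%R, x]) f t.

(* D is a chain of derivatives of f = D 0 : D 0, ..., D (m-1) are absolutely
   continuous on [0,1] with (a.e.) derivatives D 1, ..., D m (i.e. each is the
   indefinite integral of the next, which is Lebesgue integrable), and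
   D m is square integrable on [0,1]. *)
Definition sob_chain {R : realType} (m : nat) (f : R -> R) (D : nat -> R -> R) :=
  D 0%N = f /\
  (forall k, (1 <= k <= m)%N ->
     (@lebesgue_measure R).-integrable `[0%R, 1%R] (fun t => (D k t)%:E)) /\
  (forall k, (k < m)%N -> forall x, 0 <= x <= 1 ->
     D k x = D k 0 + int0x x (D k.+1)) /\
  (@lebesgue_measure R).-integrable `[0%R, 1%R] (fun t => ((D m t) ^+ 2)%:E).

Definition Sob1 {R : realType} (m : nat) (f : R -> R) :=
  exists D, sob_chain m f D.

Definition Sob0 {R : realType} (m : nat) (f : R -> R) :=
  Sob1 m f /\ int01 f = 0.

(* a chosen chain of derivatives (unique a.e.) *)
Definition sobD {R : realType} (m : nat) (f : R -> R) : nat -> R -> R :=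
  match pselect (Sob1 m f) with
  | left H => proj1_sig (cid H)
  | right _ => fun k => if k is 0%N then f else fun _ => 0
  end.

Definition ip1 {R : realType} (m : nat) (f g : R -> R) : R :=
  \sum_(1 <= l < m) int01 (sobD m f l) * int01 (sobD m g l)
  + int01 (fun t => sobD m f m t * sobD m g m t).

Definition l2ip {R : realType} (f g : R -> R) : R := int01 (fun t => f t * g t).

(* points of [0,1]^d are x : 'I_d -> R; functions of x_S are functions of x
   that only depend on the coordinates in S. *)
Definition cube {R : realType} (d : nat) (x : 'I_d -> R) := forall j, 0 <= x j <= 1.

(* an elementary tensor (x_S |-> prod_{j in S} a_j(x_j)) is given by a family a *)
Definition valid_fam {R : realType} (m d : nat) (S : {set 'I_d}) (a : 'I_d -> R -> R) :=
  forall j, j \in S -> Sob0 m (a j).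

Definition elt {R : realType} (d : nat) (S : {set 'I_d}) (a : 'I_d -> R -> R)
  (x : 'I_d -> R) : R := \prod_(j in S) a j (x j).

(* finite sums of elementary tensors (the algebraic tensor product) *)
Definition evalrep {R : realType} (d : nat) (S : {set 'I_d})
  (r : seq ('I_d -> R -> R)) (x : 'I_d -> R) : R :=
  \sum_(a <- r) elt S a x.

Definition Jrep {R : realType} (m d : nat) (S : {set 'I_d})
  (r r' : seq ('I_d -> R -> R)) : R :=
  \sum_(a <- r) \sum_(b <- r') \prod_(j in S) ip1 m (a j) (b j).

(* L2([0,1]^|S|) inner product V_S on the algebraic tensor product *)
Definition Vrep {R : realType} (d : nat) (S : {set 'I_d})
  (r r' : seq ('I_d -> R -> R)) : R :=
  \sum_(a <- r) \sum_(b <- r') \prod_(j in S) l2ip (a j) (b j).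

Definition Jdist {R : realType} (m d : nat) (S : {set 'I_d})
  (r r' : seq ('I_d -> R -> R)) : R :=
  Jrep m S r r - 2 * Jrep m S r r' + Jrep m S r' r'.

(* g is a <.,.>_S-Cauchy sequence in the algebraic tensor product converging
   (pointwise on the cube) to f; H_S (Hilbert tensor product, an RKHS) is the
   set of such limits. *)
Definition approx {R : realType} (m d : nat) (S : {set 'I_d})
  (f : ('I_d -> R) -> R) (g : nat -> seq ('I_d -> R -> R)) :=
  (forall k, all (fun a => `[< valid_fam m S a >]) (g k)) /\
  (forall e : R, 0 < e -> exists N : nat, forall k l : nat,
      (N <= k)%N -> (N <= l)%N -> Jdist m S (g k) (g l) <= e) /\
  (forall x, cube x -> (fun k => evalrep S (g k) x) @ \oo --> f x).

Definition HS {R : realType} (m d : nat) (S : {set 'I_d}) (f : ('I_d -> R) -> R) :=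
  if S == finset.set0 then exists c : R, forall x, f x = c
  else exists g, approx m S f g.

Definition approx_seq {R : realType} (m d : nat) (S : {set 'I_d})
  (f : ('I_d -> R) -> R) : nat -> seq ('I_d -> R -> R) :=
  match pselect (exists g, approx m S f g) with
  | left H => proj1_sig (cid H)
  | right _ => fun _ => [::]
  end.

Definition origin {R : realType} (d : nat) : 'I_d -> R := fun _ => 0.

(* J_S(f_S) = <f_S,f_S>_S, J_emptyset = 0 (independent of the chosen
   approximating sequence) *)
Definition JS {R : realType} (m d : nat) (S : {set 'I_d}) (f : ('I_d -> R) -> R) : R :=
  if S == finset.set0 then 0
  else limn (fun k => Jrep m S (approx_seq m S f k) (approx_seq m S f k)).

(* V_S(f_S,f_S) = int_{[0,1]^|S|} f_S^2 ; V_emptyset(a,a) = a^2 *)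
Definition VS {R : realType} (m d : nat) (S : {set 'I_d}) (f : ('I_d -> R) -> R) : R :=
  if S == finset.set0 then (f (@origin R d)) ^+ 2
  else limn (fun k => Vrep S (approx_seq m S f k) (approx_seq m S f k)).

Definition normS {R : realType} (m d : nat) (S : {set 'I_d}) (lam : R)
  (f : ('I_d -> R) -> R) : R := Num.sqrt (VS m S f + lam * JS m S f).

(* an element of H is given by its components F S, S in SS *)
Definition Hfam {R : realType} (m d : nat) (SS : {set {set 'I_d}})
  (F : {set 'I_d} -> ('I_d -> R) -> R) := forall S, S \in SS -> HS m S (F S).

Definition evalH {R : realType} (d : nat) (SS : {set {set 'I_d}})
  (F : {set 'I_d} -> ('I_d -> R) -> R) (x : 'I_d -> R) : R :=
  \sum_(S in SS) F S x.

Definition Jtot {R : realType} (m d : nat) (SS : {set {set 'I_d}})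
  (F : {set 'I_d} -> ('I_d -> R) -> R) : R := \sum_(S in SS) JS m S (F S).

Definition ssup (d : nat) (SS : {set {set 'I_d}}) : nat := \max_(S in SS) #|S|.

Definition plsobj {R : realType} (m d : nat) (SS : {set {set 'I_d}})
  (Xs : nat -> 'I_d -> R) (Ys : nat -> R) (n : nat) (lam : R)
  (F : {set 'I_d} -> ('I_d -> R) -> R) : R :=
  (2 * n%:R)^-1 * \sum_(i < n) (Ys i - evalH SS F (Xs i)) ^+ 2
  + lam / 2 * Jtot m SS F.

Definition mutual_indep {R : realType} {d0 : measure_display} {T : measurableType d0}
  (P : probability T R) {I : eqType} (Z : I -> T -> R) :=
  forall (s : seq I) (B : I -> set R), uniq s -> (forall i, measurable (B i)) ->
    P (\big[setI/setT]_(i <- s) (Z i @^-1` B i)) =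
    (\prod_(i <- s) P (Z i @^-1` B i))%E.

(* Z_n = O_P(r_n) (with outer probability, to avoid measurability issues) *)
Definition OP {R : realType} {d0 : measure_display} {T : measurableType d0}
  (P : probability T R) (Z : nat -> T -> R) (r : nat -> R) :=
  forall e : R, 0 < e -> exists M : R, 0 < M /\ exists N : nat, forall n, (N <= n)%N ->
    exists A : set T, measurable A /\
      [set w | M * r n < `|Z n w|] `<=` A /\ (P A <= e%:E)%E.

(* mR = m, s = |S_sup| (resp. |S|), nR = n, l = lambda_n *)
Definition rateS {R : realType} (mR s nR l JSf : R) : R :=
  nR `^ (- (1/2)) * l `^ (- (1 / (4 * mR))) * (- ln l) `^ ((s - 1) / 2)
  + l `^ (1/2) * JSf `^ (1/2).

Definition rate_beta {R : realType} (mR s tau nR l : R) : R :=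
  nR `^ (- (1/2)) * l `^ (- (1 / (2 * mR)))
  * l `^ (- (1 / (4 * mR - 2 * tau - 2)))
  * l `^ (1 / (8 * mR ^+ 2 - 4 * mR * tau - 4 * mR))
  * (- ln l) `^ ((s - 1) * (1 - 1 / (4 * mR - 2 * tau - 2)))
  * (ln (l `^ (1 / (4 * mR) - 1/2) * (- ln l) `^ ((1 - s) / 2))) `^ (1/2)
  * (ln nR) `^ (1/2).

Definition rate_alpha {R : realType} (mR s tau nR l Jf : R) : R :=
  rate_beta mR s tau nR l * rateS mR s nR l Jf.

(* Main.v *)
Require Import Defs.
From HB Require Import structures.
From mathcomp Require Import all_boot all_order all_algebra.
From mathcomp Require Import all_classical all_reals all_analysis.
From mathcomp Require Import measurable_realfun ring lra.
Set Implicit Arguments. Unset Strict Implicit. Unset Printing Implicit Defensive.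
Import Order.TTheory GRing.Theory Num.Theory.
Import numFieldNormedType.Exports.
Local Open Scope classical_set_scope.
Local Open Scope ring_scope.

(** Perturbing only the component S of the estimator gives, for the errors h_S,
    the score equation
      V(h_S) + lam J(h_S) = 1/n sum eps_i h_S(X_i) - lam <f*_S, h_S>
         - sum_S' (1/n sum h_S(X_i) h_S'(X_i) - E h_S h_S').
    Expanding H_S in tensor products of a piecewise polynomial frame, with
    weights equivalent to the norm V + lam J, the noise functional and the
    bilinear deviations have squared norms at most of order kappa_S / n and
    kappa_S kappa_S' / n off events of small probability, where
    kappa_S = lam^(-1/2m) (- ln lam)^(|S|-1) bounds the reproducing kernel.
    This linear system of inequalities in the norms of the h_S closes because
    n^(-1/2) max kappa_S -> 0. *)

(** The estimator is an arbitrary function of the sample, so the random bounds must hold for all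
    elements of the model space at once. Duality achieves this: coefficients and data are paired by
    a weighted Cauchy-Schwarz inequality, and the only random quantity left is a weighted sum of
    squares, whose mean follows from independence and a pointwise kernel bound. Only half of a frame
    property enters: pointwise reconstruction, and domination of the weighted coefficients by the
    norm. A dyadic construction proves both by induction on the level, where an eigenbasis of V
    against J would call for spectral asymptotics. The rate of a component must show its own |S| and
    its own penalty, not those of S_sup. The interaction of S with S' has size sqrt(kappa_S kappa_S'
    / n), so it already contains the noise rate of S; the remaining factor sqrt(kappa_S') times the
    error of S' is bounded once lam kappa is. Since lam kappa = (sqrt n lam) (n^(-1/2) kappa), this
    is where the first two rate conditions meet; for |S_sup| > 0 the second one says kappa^2 / n ->
    0 at |S| = |S_sup|. *)

Lemma quad_disc (R : realFieldType) (a b c : R) : 0 <= c ->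
  (forall t, 0 <= a + 2 * t * b + t ^+ 2 * c) -> b ^+ 2 <= a * c.
Proof.
rewrite le_eqVlt => /predU1P[<- h|cp h].
  have [->|b0] := eqVneq b 0; first by rewrite mulr0 expr0n.
  (* For [c = 0] the expression is affine in [t], and this [t] gives it the value -1. *)
  have := h (- (a + 1) / (2 * b)).
  rewrite mulr0 addr0 (_ : _ + _ = -1); first by rewrite oppr_ge0 leNgt ltr01.
  by field.
have := h (- b / c); rewrite (_ : _ + _ = (a * c - b ^+ 2) / c); last first.
  by field; rewrite gt_eqF.
by rewrite pmulr_lge0 ?invr_gt0 // subr_ge0.
Qed.

(** * Square integrable functions *)

Section SquareIntegrable.
Context d (T : measurableType d) (R : realType) (mu : {measure set T -> \bar R}).
Variable D : set T.
Hypotheses (mD : measurable D) (muD : mu D = 1%E).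
Implicit Types f g h : T -> R.

(** Two instances share this theory: Lebesgue measure on [0,1], and a probability measure on its
    whole space. Total mass one makes square integrable functions integrable. *)
Definition intg f := mu.-integrable D (EFin \o f).
Definition I f := \int[mu]_(x in D) f x.
Definition sq f := measurable_fun D f /\ intg (fun x => f x ^+ 2).

Lemma intg_meas f : intg f -> measurable_fun D f.
Proof. by move=> /measurable_int /measurable_EFinP. Qed.

Lemma eq_I f g : (forall x, D x -> f x = g x) -> I f = I g.
Proof. by move=> fg; apply: eq_Rintegral => x /[!inE] /fg. Qed.

Lemma eq_intg f g : (forall x, D x -> f x = g x) -> intg f -> intg g.
Proof. by move=> fg; apply: eq_integrable => // x /[!inE] /fg /= ->. Qed.

Lemma le_intg f g : measurable_fun D f -> (forall x, D x -> `|f x| <= g x) ->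
  intg g -> intg f.
Proof.
move=> mf fg; apply: le_integrable => //; first exact/measurable_EFinP.
by move=> x Dx /=; rewrite lee_fin (le_trans (fg _ Dx)) // ler_norm.
Qed.

Lemma intg_cst c : intg (fun=> c).
Proof.
apply: measurable_bounded_integrable => //; first by rewrite muD ltry.
by exists `|c|; split; rewrite ?num_real // => M /ltW cM x _.
Qed.

Lemma intgD f g : intg f -> intg g -> intg (fun x => f x + g x).
Proof. by move=> hf hg; have := integrableD mD hf hg; exact: eq_integrable. Qed.

Lemma intgZ c f : intg f -> intg (fun x => c * f x).
Proof. by move=> hf; have := integrableZl mD c hf; exact: eq_integrable. Qed.

Lemma intgN f : intg f -> intg (fun x => - f x).
Proof. by move=> hf; have := integrableN hf; exact: eq_integrable. Qed.

Lemma intgB f g : intg f -> intg g -> intg (fun x => f x - g x).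
Proof. by move=> hf hg; apply: intgD => //; apply: intgN. Qed.

Lemma intg_norm f : intg f -> intg (fun x => `|f x|).
Proof. exact: integrable_norm. Qed.

Lemma intg_sum (J : Type) (s : seq J) (F : J -> T -> R) :
  (forall j, intg (F j)) -> intg (fun x => \sum_(j <- s) F j x).
Proof.
move=> hF; elim: s => [|j s IH].
  by apply: eq_intg (intg_cst 0) => x _; rewrite big_nil.
by apply: eq_intg (intgD (hF j) IH) => x _; rewrite big_cons.
Qed.

Lemma I_cst c : I (fun=> c) = c.
Proof. by rewrite /I Rintegral_cst // muD mulr1. Qed.

Lemma I_ge0 f : (forall x, D x -> 0 <= f x) -> 0 <= I f.
Proof. exact: Rintegral_ge0. Qed.

Lemma I_D f g : intg f -> intg g -> I (fun x => f x + g x) = I f + I g.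
Proof. exact: RintegralD. Qed.

Lemma I_Z c f : intg f -> I (fun x => c * f x) = c * I f.
Proof. exact: RintegralZl. Qed.

Lemma I_B f g : intg f -> intg g -> I (fun x => f x - g x) = I f - I g.
Proof. exact: RintegralB. Qed.

Lemma I_sum (J : Type) (s : seq J) (F : J -> T -> R) :
  (forall j, intg (F j)) ->
  I (fun x => \sum_(j <- s) F j x) = \sum_(j <- s) I (F j).
Proof.
move=> hF; elim: s => [|j s IH].
  by rewrite big_nil -[RHS](I_cst 0); apply: eq_I => x _; rewrite big_nil.
rewrite big_cons -IH -I_D //; last exact: intg_sum.
by apply: eq_I => x _; rewrite big_cons.
Qed.

Lemma le_I f g : intg f -> intg g -> (forall x, D x -> f x <= g x) -> I f <= I g.
Proof. exact: le_Rintegral. Qed.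

Lemma le_norm_I f : intg f -> `|I f| <= I (fun x => `|f x|).
Proof. exact: le_normr_Rintegral. Qed.

Lemma sqM f g : sq f -> sq g -> intg (fun x => f x * g x).
Proof.
move=> [mf hf] [mg hg]; apply: (le_intg _ _ (intgD hf hg)).
  exact: measurable_funM.
move=> x _; rewrite normrM -[f x ^+ 2]real_normK ?num_real //.
rewrite -[g x ^+ 2]real_normK ?num_real //.
by have := sqr_ge0 (`|f x| - `|g x|); have := normr_ge0 (f x);
  have := normr_ge0 (g x); nra.
Qed.

Lemma sq_bounded f (M : R) : measurable_fun D f -> (forall x, D x -> `|f x| <= M) ->
  sq f.
Proof.
move=> mf hM; split => //; apply: (le_intg _ _ (intg_cst (M ^+ 2))).
  exact: measurable_funX.
by move=> x Dx; rewrite normrX ler_pXn2r ?nnegrE ?(le_trans _ (hM x Dx)) ?hM.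
Qed.

Lemma sq_cst c : sq (fun=> c).
Proof. exact: (@sq_bounded _ `|c|). Qed.

Lemma sq_intg f : sq f -> intg f.
Proof. by move=> hf; apply: eq_intg (sqM hf (sq_cst 1)) => x _; rewrite mulr1. Qed.

Lemma sqD f g : sq f -> sq g -> sq (fun x => f x + g x).
Proof.
move=> hf hg; split; first by apply: measurable_funD; [case: hf|case: hg].
apply: eq_intg (intgD (intgD (proj2 hf) (intgZ 2 (sqM hf hg))) (proj2 hg)).
by move=> x _; ring.
Qed.

Lemma sqZ c f : sq f -> sq (fun x => c * f x).
Proof.
move=> hf; split; first by apply: measurable_funM => //; case: hf.
by apply: eq_intg (intgZ (c ^+ 2) (proj2 hf)) => x _; rewrite exprMn.
Qed.

Lemma eq_sq f g : (forall x, D x -> f x = g x) -> sq f -> sq g.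
Proof.
move=> fg [mf hf]; split; last by apply: eq_intg hf => x /fg ->.
by apply: eq_measurable_fun mf => x /[!inE] /fg.
Qed.

Lemma sqB f g : sq f -> sq g -> sq (fun x => f x - g x).
Proof.
move=> hf hg; have := sqD hf (sqZ (-1) hg).
by apply: eq_sq => x _; rewrite mulN1r.
Qed.

Lemma sq_sum (J : Type) (s : seq J) (F : J -> T -> R) :
  (forall j, sq (F j)) -> sq (fun x => \sum_(j <- s) F j x).
Proof.
move=> hF; elim: s => [|j s IH].
  by apply: eq_sq (sq_cst 0) => x _; rewrite big_nil.
by apply: eq_sq (sqD (hF j) IH) => x _; rewrite big_cons.
Qed.

Lemma I_sqr_comb f g t : sq f -> sq g ->
  I (fun x => (f x + t * g x) ^+ 2) =
  I (fun x => f x ^+ 2) + 2 * t * I (fun x => f x * g x) +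
    t ^+ 2 * I (fun x => g x ^+ 2).
Proof.
move=> hf hg; rewrite -I_Z; last exact: sqM.
rewrite -(I_Z (t ^+ 2) (proj2 hg)) -I_D; last exact: intgZ (sqM hf hg).
  rewrite -I_D; [by apply: eq_I => x _; ring| |exact: intgZ (proj2 hg)].
  by apply: intgD; [case: hf|apply: intgZ; exact: sqM].
by case: hf.
Qed.

Lemma I_cauchy f g : sq f -> sq g ->
  I (fun x => f x * g x) ^+ 2 <= I (fun x => f x ^+ 2) * I (fun x => g x ^+ 2).
Proof.
move=> hf hg; apply: quad_disc => [|t].
  by apply: I_ge0 => x _; rewrite sqr_ge0.
by rewrite -I_sqr_comb //; apply: I_ge0 => x _; rewrite sqr_ge0.
Qed.

Lemma I_sqr_le f : sq f -> I f ^+ 2 <= I (fun x => f x ^+ 2).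
Proof.
move=> hf; have := I_cauchy hf (sq_cst 1); rewrite I_cst expr1n mulr1.
by rewrite (@eq_I (fun x => f x * 1) f) // => x _; rewrite mulr1.
Qed.

End SquareIntegrable.

(** * Dyadic halving of the unit interval and indefinite integrals *)

Section UnitInterval.
Context (R : realType).
Implicit Types (f g : R -> R) (x y : R) (b : bool).

Notation mu := (@lebesgue_measure R).
Notation D01 := (`[0%R, 1%R]%classic : set R).

Lemma m01 : measurable (D01 : set (measurableTypeR R)).
Proof. exact: measurable_itv. Qed.

Lemma mu01 : mu D01 = 1%E.
Proof. by rewrite lebesgue_measure_itv /= lte_fin ltr01 oppr0 adde0. Qed.

(** Restriction to the left or right half, rescaled to [0,1]: every dyadic induction below stays on
    the unit interval. *)
Definition half b f : R -> R := fun t => f ((t + b%:R) / 2).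

Lemma bool_in01 b : 0 <= (b%:R : R) <= 1.
Proof. by case: b; rewrite ?ler01 ?lexx. Qed.

Lemma measurable_half_map b : measurable_fun setT (fun t : R => (t + b%:R) / 2).
Proof. by apply: measurable_funM => //; apply: measurable_funD. Qed.

(** The rescaled pushforward agrees with Lebesgue measure on half-open intervals, and these
    determine it. *)
Lemma lebesgue_half b (A : set R) : measurable A ->
  mu A = (2^-1%:E * mu ((fun t : R => (t + b%:R) / 2)%R @^-1` A))%E.
Proof.
move=> mA.
have k0 : (0 : R) <= 2^-1 by rewrite invr_ge0.
unshelve epose (nu := mscale (NngNum k0) (pushforward mu
  (fun t : measurableTypeR R => (t + b%:R) / 2 : measurableTypeR R)) :
   {measure set (measurableTypeR R) -> \bar R}).
  exact: measurable_half_map.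
rewrite (@lebesgue_measure_unique R nu) // => X [[x y] /= xy <-].
rewrite /nu /= /mscale /= /pushforward /=.
rewrite (_ : _ @^-1` _ = `](x * 2 - b%:R), (y * 2 - b%:R)]%classic); last first.
  apply/seteqP; split=> t /=; rewrite !in_itv /= => /andP[h1 h2];
    apply/andP; split; lra.
rewrite !lebesgue_measure_itv /= !lte_fin.
have -> : (x * 2 - b%:R < y * 2 - b%:R) = (x < y).
  by apply/idP/idP; lra.
case: ifP => _; last by rewrite mule0.
by rewrite -!EFinB -EFinM; congr EFin; field.
Qed.

Lemma ge0_integral_half b (A : set R) (g : R -> \bar R) : measurable A ->
  measurable_fun A g -> (forall x, (0 <= g x)%E) ->
  (\int[mu]_(x in A) g x =
   2^-1%:E * \int[mu]_(x in (fun t : R => (t + b%:R) / 2)%R @^-1` A) g ((x + b%:R) / 2)%R)%E.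
Proof.
move=> mA mg g0.
have k0 : (0 : R) <= 2^-1 by rewrite invr_ge0.
unshelve epose (nu' := pushforward mu
  (fun t : measurableTypeR R => (t + b%:R) / 2 : measurableTypeR R) :
   {measure set (measurableTypeR R) -> \bar R}).
  exact: measurable_half_map.
transitivity (\int[mscale (NngNum k0) nu']_(x in A) g x)%E.
  by apply: eq_measure_integral => B mB _; exact: lebesgue_half.
rewrite ge0_integral_mscale //; congr (_ * _)%E.
by rewrite ge0_integral_pushforward //; exact: measurable_half_map.
Qed.

Lemma half_preimage b x : 
  (fun t : R => (t + b%:R) / 2)%R @^-1` `[b%:R / 2, (x + b%:R) / 2] = `[0, x]%classic.
Proof.
by apply/seteqP; split=> t /=; rewrite !in_itv /= => /andP[h1 h2];
    apply/andP; split; lra.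
Qed.

Lemma sub01 x y : 0 <= x -> y <= 1 -> `[x, y] `<=` D01.
Proof.
by move=> x0 y1 t /=; rewrite !in_itv /= => /andP[h1 h2]; apply/andP; split; lra.
Qed.

(** The substitution is known for nonnegative functions. It is applied to the positive and negative
    parts, whose integrals are finite because [f] is integrable on all of [0,1]. *)
Lemma integral_half b x f : 0 <= x <= 1 -> intg mu D01 f ->
  mu.-integrable `[0, x] (EFin \o half b f) /\
  \int[mu]_(t in `[(b%:R / 2), ((x + b%:R) / 2)]) f t =
  2^-1 * \int[mu]_(t in `[0, x]) half b f t.
Proof.
move=> /andP[x0 x1] hf.
have hb := bool_in01 b.
pose A : set R := `[(b%:R / 2), ((x + b%:R) / 2)]%classic.
have sA : A `<=` D01 by apply: sub01; lra.
have mA' : measurable A by exact: measurable_itv.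
have hA : mu.-integrable A (EFin \o f) by exact: integrableS hf.
have mA := measurable_int _ hA.
have mf : measurable_fun `[0, x] (half b f).
  have /measurable_EFinP mA2 := mA.
  rewrite -(half_preimage b x) /half.
  apply: (measurable_comp _ _ mA2) => //; last first.
    apply: measurable_funTS; exact: measurable_half_map.
  by move=> y [t /= + <-].
have E (g : R -> \bar R) : measurable_fun A g ->
   (forall y, (0 <= g y)%E) -> (\int[mu]_(t in A) g t
   = 2^-1%:E * \int[mu]_(t in `[0%R, x]) g ((t + b%:R) / 2)%R)%E.
  by move=> mg g0; rewrite (ge0_integral_half b) // half_preimage.
have h2 (z : \bar R) : (2^-1%:E * z < +oo)%E -> (z < +oo)%E.
  by case: z => [r _||//]; rewrite ?ltry // gt0_muley // lte_fin invr_gt0.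
split.
  apply/integrableP; split; first exact/measurable_EFinP.
  case/integrableP: hA => _; rewrite E //; first exact: h2.
  by apply: measurableT_comp.
rewrite -/A /Rintegral [in LHS]integralE [in RHS]integralE.
rewrite !E; [|by apply: measurable_funeneg|by []|by apply: measurable_funepos|by []].
set p := (\int[_]_(_ in _) _)%E; set n := (X in (_ - _ * X)%E).
transitivity (2^-1 * fine (p - n)%E); last first.
  by congr (_ * fine (_ - _)%E); apply: eq_integral => y _; rewrite ?funeposE ?funenegE.
have pf : p \is a fin_num.
  rewrite ge0_fin_numE; last by apply: integral_ge0.
  apply: h2; rewrite -E //; last by apply: measurable_funepos.
  exact: integral_funepos_lt_pinfty hA.
have nf : n \is a fin_num.
  rewrite ge0_fin_numE; last by apply: integral_ge0.
  apply: h2; rewrite -E //; last by apply: measurable_funeneg.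
  exact: integral_funeneg_lt_pinfty hA.
by rewrite -(fineK pf) -(fineK nf) -!EFinM -!EFinB /=; ring.
Qed.

Lemma intg_half b f : intg mu D01 f -> intg mu D01 (half b f).
Proof. by move=> hf; have [] := @integral_half b 1 f _ hf; rewrite ?ler01 ?lexx. Qed.

Definition ind x t : R := ((t <= x)%R)%:R.

Lemma ind_le1 x t : `|ind x t| <= 1.
Proof. by rewrite /ind; case: (t <= x)%R; rewrite ?normr1 ?normr0 ?ler01. Qed.

(** Moving the upper limit into an indicator keeps all integrals on one domain, so that linearity
    and Cauchy-Schwarz apply to differences of indefinite integrals. *)
Lemma int0xE x f : 0 <= x <= 1 -> 
  int0x x f = I mu D01 (fun t => ind x t * f t).
Proof.
move=> /andP[x0 x1]; rewrite /int0x /I.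
have -> : `[0, x]%classic = D01 `&` [set t | t <= x].
  apply/seteqP; split=> t /=; rewrite !in_itv /=.
    by move=> /andP[h1 h2]; rewrite h1 h2 (le_trans h2).
  by move=> [/andP[-> _] ->].
rewrite Rintegral_mkcondr; apply: eq_Rintegral => t _.
rewrite patchE /ind; case: ifPn; first by rewrite inE /= => ->; rewrite mul1r.
by move=> /negP; rewrite inE /= => /negP/negbTE ->; rewrite mul0r.
Qed.

Lemma measurable_le_ind x : measurable_fun D01 (ind x).
Proof.
have -> : (ind x) = \1_(`]-oo, x]%classic) :> (R -> R).
  apply/funext => t; rewrite /ind indicE; congr (_%:R); congr nat_of_bool.
  by apply/idP/idP; rewrite inE /= in_itv.
exact: measurable_indic.
Qed.

Lemma sq_le_ind x : sq mu D01 (ind x).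
Proof.
apply: (@sq_bounded _ _ _ _ _ m01 mu01 _ 1); first exact: measurable_le_ind.
by move=> t _; exact: ind_le1.
Qed.

Lemma intg_le_ind x f : intg mu D01 f -> intg mu D01 (fun t => ind x t * f t).
Proof.
move=> hf; apply: (le_intg m01 _ _ (intg_norm hf)).
  by apply: measurable_funM; [exact: measurable_le_ind|exact: intg_meas hf].
move=> t _; rewrite normrM ler_piMl //.
exact: ind_le1.
Qed.

Lemma I_le_ind x : 0 <= x <= 1 -> I mu D01 (ind x) = x.
Proof.
move=> hx; have h := @int0xE x (fun=> 1) hx.
transitivity (I mu D01 (fun t => ind x t * 1)).
  by apply: eq_I => t _; rewrite mulr1.
rewrite -h /int0x.
have -> : \int[mu]_(t in `[0, x]) (1 : R) = 1 * fine (mu `[0, x]%classic).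
  by apply: Rintegral_cst; exact: measurable_itv.
rewrite lebesgue_measure_itv /= mul1r lte_fin.
case: ltP => x0; first by rewrite oppr0 adde0.
by apply/esym/eqP; rewrite eq_le x0 /=; case/andP: hx.
Qed.

Lemma int0x0 f : int0x 0 f = 0.
Proof. by rewrite /int0x set_itv1 Rintegral_set1. Qed.

Lemma int0x1 f : int0x 1 f = I mu D01 f. Proof. by []. Qed.

Lemma int0x_half b x f : 0 <= x <= 1 -> intg mu D01 f ->
  int0x ((x + b%:R) / 2) f = int0x (b%:R / 2) f + 2^-1 * int0x x (half b f).
Proof.
move=> hx hf; have [_ e] := integral_half b hx hf.
have hb := bool_in01 b.
rewrite {3}/int0x -e /int0x -[RHS]addrC; apply/eqP; rewrite -subr_eq; apply/eqP.
have h : intg mu `[0, (x + b%:R) / 2] f.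
  by apply: integrableS hf => //; apply: sub01; lra.
rewrite (Rintegral_itvB h) ?bnd_simp; [|lra|lra].
rewrite Rintegral_itv_obnd_cbnd //; apply: integrableS h => // t /=.
by rewrite !in_itv /=; lra.
Qed.

Lemma I_half f : intg mu D01 f ->
  I mu D01 f = 2^-1 * I mu D01 (half false f) + 2^-1 * I mu D01 (half true f).
Proof.
move=> hf; have h1 : 0 <= (1 : R) <= 1 by rewrite ler01 lexx.
have := int0x_half true h1 hf; have := int0x_half false h1 hf.
rewrite addr0 mul0r int0x0 add0r !int0x1 mul1r => ->.
by rewrite (_ : (1 + 1) / 2 = 1) ?int0x1 //; field.
Qed.

Lemma measurable_half b f : measurable_fun D01 f -> measurable_fun D01 (half b f).
Proof.
move=> mf; apply: (measurable_comp m01 _ mf); last first.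
  apply: measurable_funTS; exact: measurable_half_map.
move=> y [t /=]; rewrite in_itv /= => ht <-; rewrite in_itv /=.
by have hb := bool_in01 b; lra.
Qed.

Lemma sq_half b f : sq mu D01 f -> sq mu D01 (half b f).
Proof.
move=> hf; split; first by exact: (intg_meas (intg_half b (sq_intg m01 mu01 hf))).
by case: hf => _ /(intg_half b).
Qed.

(** Cauchy-Schwarz against the indicator of ]x, y], which equals its own square and has integral
    [y - x]. *)
Lemma int0x_diff_sqr x y f : 0 <= x -> x <= y -> y <= 1 -> sq mu D01 f ->
  (int0x y f - int0x x f) ^+ 2 <= (y - x) * I mu D01 (fun t => f t ^+ 2).
Proof.
move=> x0 xy y1 hf; have fi := sq_intg m01 mu01 hf.
have hx : 0 <= x <= 1 by lra.
have hy : 0 <= y <= 1 by lra.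
rewrite !int0xE // -(I_B m01); [|exact: intg_le_ind..].
pose g t : R := ind y t - ind x t.
have hg : sq mu D01 g by exact: (sqB m01 (sq_le_ind y) (sq_le_ind x)).
rewrite (_ : I _ _ _ = I mu D01 (fun t => g t * f t)); last first.
  by apply: eq_I => t _; rewrite /g mulrBl.
rewrite (le_trans (I_cauchy m01 hg hf)) // ler_wpM2r //.
  by apply: I_ge0 => t _; rewrite sqr_ge0.
have -> : y - x = I mu D01 (ind y) - I mu D01 (ind x) by rewrite !I_le_ind.
rewrite -(I_B m01).
- rewrite le_eqVlt; apply/orP; left; apply/eqP/eq_I => t _; rewrite /g /ind.
  case: (leP t x) => [tx|_]; last by rewrite !subr0; case: (_ <= _)%R; rewrite ?expr1n ?expr0n.
  by rewrite (le_trans tx xy) !subrr expr0n.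
- exact: (sq_intg m01 mu01 (sq_le_ind y)).
- exact: (sq_intg m01 mu01 (sq_le_ind x)).
Qed.

End UnitInterval.

(** * Orthonormal polynomials on the unit interval *)

Section PolynomialsOnUnitInterval.
Context (R : realType).
Implicit Types (f g : R -> R) (p r : {poly R}).

Notation mu := (@lebesgue_measure R).
Notation D01 := (`[0%R, 1%R]%classic : set R).
Notation I01 := (I mu D01).
Notation L2 := (sq mu D01).
Let M1 : measurable (D01 : set (measurableTypeR R)) := @m01 R.
Let U1 : mu D01 = 1%E := @mu01 R.

Lemma D01P x : D01 x <-> 0 <= x <= 1.
Proof. by rewrite /= in_itv. Qed.

Lemma measurable_horner p : measurable_fun setT (horner p).
Proof. by apply: continuous_measurable_fun; exact: continuous_horner. Qed.

Lemma horner_le p x : 0 <= x <= 1 -> `|p.[x]| <= \sum_(i < size p) `|p`_i|.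
Proof.
move=> /andP[x0 x1]; rewrite horner_coef (le_trans (ler_norm_sum _ _ _)) //.
apply: ler_sum => i _; rewrite normrM normrX ler_piMr // exprn_ile1 ?normr_ge0 //.
by rewrite ger0_norm.
Qed.

Lemma L2_horner p : L2 (horner p).
Proof.
apply: (@sq_bounded _ _ _ _ _ M1 U1 _ (\sum_(i < size p) `|p`_i|)).
  by apply: measurable_funTS; exact: measurable_horner.
by move=> x /D01P; exact: horner_le.
Qed.

Definition primp p : {poly R} := \poly_(i < (size p).+1) (p`_i.-1 / i%:R).

Lemma size_primp p : (size (primp p) <= (size p).+1)%N.
Proof. exact: size_poly. Qed.

Lemma primp0 p : (primp p).[0] = 0.
Proof. by rewrite horner_coef0 coef_poly /= invr0 mulr0. Qed.

Lemma deriv_primp p : deriv (primp p) = p.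
Proof.
apply/polyP => i; rewrite coef_deriv coef_poly ltnS /=.
case: ltnP => h; last by rewrite nth_default ?mul0rn.
by rewrite -[LHS]mulr_natr divfK ?pnatr_eq0.
Qed.

Lemma int0x_horner p x : 0 <= x -> int0x x (horner p) = (primp p).[x].
Proof.
rewrite le_eqVlt => /predU1P[<-|x0]; first by rewrite int0x0 primp0.
rewrite /int0x /Rintegral (@continuous_FTC2 _ (horner p) (horner (primp p)) 0 x x0).
- by rewrite primp0 sube0.
- by apply: continuous_subspaceT; exact: continuous_horner.
- split.
  + by move=> y _; exact: derivable_horner.
  + by apply: cvg_at_right_filter; exact: continuous_horner.
  + by apply: cvg_at_left_filter; exact: continuous_horner.
- by move=> y _; rewrite -derivE deriv_primp.
Qed.

(** The primitive of [p ^+ 2] is squeezed to 0 on the whole interval; having more roots than its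
    degree it is the zero polynomial, and so is its derivative. *)
Lemma horner_sqr_int_eq0 p : I01 (fun t => p.[t] ^+ 2) = 0 -> p = 0.
Proof.
move=> h0; suff h : primp (p ^+ 2) = 0.
  have /eqP : p ^+ 2 = 0 by rewrite -(deriv_primp (p ^+ 2)) h deriv0.
  by rewrite expf_eq0 /= => /eqP.
set P := primp _.
have Pz x : 0 <= x <= 1 -> P.[x] = 0.
  move=> hx; have /andP[x0 x1] := hx; rewrite -int0x_horner //.
  have hi : intg mu D01 (horner (p ^+ 2)) := sq_intg M1 U1 (L2_horner _).
  apply/eqP; rewrite eq_le; apply/andP; split; last first.
    by rewrite /int0x; apply: I_ge0 => t _; rewrite hornerE sqr_ge0.
  rewrite -h0 int0xE //; apply: (le_I M1).
  - exact: intg_le_ind.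
  - by apply: (eq_intg M1 _ hi) => t _; rewrite hornerE.
  - move=> t _; rewrite hornerE ler_piMl ?sqr_ge0 //.
    by rewrite (le_trans _ (ind_le1 x t)) ?ler_norm.
apply/eqP; apply: contraT => Pn0.
have := @max_poly_roots _ P [seq i.+1%:R^-1 | i <- iota 0 (size P)] Pn0.
rewrite size_map size_iota ltnn => -> //.
  apply/allP => _ /mapP[i _ ->]; apply/rootP; apply: Pz.
  by rewrite invr_ge0 ler0n /= invf_le1 ?ler1n ?ltr0n.
rewrite map_inj_uniq ?iota_uniq // => i j /invr_inj /eqP.
by rewrite eqr_nat eqSS => /eqP.
Qed.

Definition ipp p r := I01 (fun t => p.[t] * r.[t]).

Lemma ippC p r : ipp p r = ipp r p.
Proof. by apply: eq_I => t _; rewrite mulrC. Qed.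

Lemma ippDl p1 p2 r : ipp (p1 + p2) r = ipp p1 r + ipp p2 r.
Proof.
rewrite /ipp -(I_D M1); try by apply: (sqM M1); exact: L2_horner.
by apply: eq_I => t _; rewrite hornerE mulrDl.
Qed.

Lemma ippZl c p r : ipp (c *: p) r = c * ipp p r.
Proof.
rewrite /ipp -(I_Z M1); last by apply: (sqM M1); exact: L2_horner.
by apply: eq_I => t _; rewrite hornerE mulrA.
Qed.

Lemma ipp_suml (J : Type) (s : seq J) (a : J -> R) (F : J -> {poly R}) r :
  ipp (\sum_(j <- s) a j *: F j) r = \sum_(j <- s) a j * ipp (F j) r.
Proof.
elim: s => [|j s IH]; last by rewrite !big_cons ippDl ippZl IH.
by rewrite !big_nil -(scale0r (0 : {poly R})) ippZl mul0r.
Qed.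

Definition orthobasis K (q : nat -> {poly R}) :=
  [/\ forall l, (l < K)%N -> (size (q l) <= K)%N,
      forall k l, (k < K)%N -> (l < K)%N -> ipp (q k) (q l) = (k == l)%:R &
      forall p, (size p <= K)%N -> p = \sum_(0 <= l < K) ipp p (q l) *: q l].

(** Gram-Schmidt on the monomials: up to sign these are the normalised shifted Legendre polynomials
    of degree below [K]. *)
Lemma orthobasis_exists K : exists q, orthobasis K q.
Proof.
elim: K => [|K [q [sq oq spq]]].
  exists (fun=> 0); split=> // p; rewrite leqn0 size_poly_eq0 => /eqP ->.
  by rewrite big_geq.
pose e := 'X^K - \sum_(0 <= l < K) ipp 'X^K (q l) *: q l.
have se : (size (\sum_(0 <= l < K) ipp 'X^K (q l) *: q l)%R <= K)%N.
  rewrite big_mkord (leq_trans (size_sum _ _ _)) //; apply/bigmax_leqP => l _.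
  by rewrite (leq_trans (size_scale_leq _ _)) // sq.
have eK : e`_K = 1.
  by rewrite /e coefB coefXn eqxx [X in _ - X]nth_default ?subr0.
have e0 : e != 0 by apply/eqP => h; move/eqP: eK; rewrite h coef0 eq_sym oner_eq0.
have se1 : (size e <= K.+1)%N.
  by rewrite (leq_trans (size_polyD _ _)) // size_polyN geq_max size_polyXn leqnn ltnW.
have eo l : (l < K)%N -> ipp e (q l) = 0.
  move=> lK; rewrite /e ippDl -scaleN1r ippZl ipp_suml.
  rewrite big_mkord (bigD1 (Ordinal lK)) //= oq // eqxx mulr1 big1 ?addr0; first by ring.
  move=> i il; rewrite oq // (_ : (_ == _) = false) ?mulr0 //.
  by apply/negbTE; exact: il.
have n0 : 0 < ipp e e.
  rewrite lt_neqAle eq_sym; apply/andP; split.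
    apply/eqP => h; move/eqP: e0; apply; apply: horner_sqr_int_eq0.
    by transitivity (ipp e e) => //; apply: eq_I => t _; rewrite expr2.
  by apply: I_ge0 => t _; rewrite -expr2 sqr_ge0.
pose s := Num.sqrt (ipp e e).
have s0 : 0 < s by rewrite sqrtr_gt0.
have ss : s ^+ 2 = ipp e e by rewrite sqr_sqrtr // ltW.
pose q' l := if l == K then s^-1 *: e else q l.
have q'E l : (l < K)%N -> q' l = q l by move=> lK; rewrite /q' ltn_eqF.
have q'K : q' K = s^-1 *: e by rewrite /q' eqxx.
exists q'; split.
- move=> l; rewrite ltnS leq_eqVlt => /predU1P[->|lK].
    by rewrite q'K (leq_trans (size_scale_leq _ _)).
  by rewrite q'E // ltnW // ltnS sq.
- move=> k l; rewrite !ltnS leq_eqVlt => /predU1P[->|kK];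
    rewrite leq_eqVlt => /predU1P[->|lK].
  + by rewrite q'K ippZl ippC ippZl -ss eqxx expr2 mulKf ?mulVf ?lt0r_neq0.
  + by rewrite q'K q'E // ippZl eo // mulr0 eq_sym ltn_eqF.
  + by rewrite q'K q'E // ippC ippZl eo // mulr0 ltn_eqF.
  + by rewrite !q'E // oq.
- move=> p sp; rewrite big_nat_recr //= q'K.
  (* Since [e] is monic of degree [K], subtracting this multiple lands in the span of the earlier
     basis. *)
  pose r := p - p`_K *: e.
  have sr : (size r <= K)%N.
    apply/leq_sizeP => j; rewrite leq_eqVlt => /predU1P[<-|Kj].
      by rewrite /r coefB coefZ eK mulr1 subrr.
    have ej : e`_j = 0 by apply: nth_default; exact: leq_trans se1 Kj.
    have pj : p`_j = 0 by apply: nth_default; exact: leq_trans sp Kj.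
    by rewrite /r coefB coefZ ej pj mulr0 subr0.
  have pE : p = p`_K *: e + r by rewrite /r addrC subrK.
  have pq l : (l < K)%N -> ipp p (q' l) = ipp r (q l).
    by move=> lK; rewrite q'E // {1}pE ippDl ippZl eo // mulr0 add0r.
  have re : ipp r e = 0.
    rewrite (spq r sr) ipp_suml big_nat_cond big1 // => l /andP[/andP[_ lK] _].
    by rewrite [ipp (q l) e]ippC eo ?mulr0.
  have -> : ipp p (s^-1 *: e) = p`_K * s.
    rewrite ippC ippZl ippC {1}pE ippDl ippZl re -ss addr0.
    by field; exact: lt0r_neq0.
  rewrite scalerA mulfK ?lt0r_neq0 // [X in X = _]pE addrC; congr (_ + _).
  rewrite {1}(spq r sr); apply: eq_big_nat => l /andP[_ lK].
  by rewrite pq // q'E.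
Qed.

End PolynomialsOnUnitInterval.

(* Words index the dyadic intervals of [0,1]: the head selects the half. *)
Fixpoint words (n : nat) : seq (seq bool) :=
  if n is n'.+1 then [seq false :: w | w <- words n'] ++ [seq true :: w | w <- words n']
  else [:: [::]].

Lemma sum_words (R : nmodType) n (F : seq bool -> R) :
  \sum_(w <- words n.+1) F w =
  \sum_(w <- words n) F (false :: w) + \sum_(w <- words n) F (true :: w).
Proof. by rewrite /= big_cat !big_map. Qed.

Lemma sum_nat_eq0 (V : nmodType) K (F : nat -> V) :
  (forall l, (l < K)%N -> F l = 0) -> \sum_(0 <= l < K) F l = 0.
Proof. by move=> h; rewrite big_mkord big1 // => l _; rewrite h. Qed.

(** * Multiwavelet coefficients *)

Section Details.
Context (R : realType) (K : nat) (q : nat -> {poly R}).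
Hypothesis qb : orthobasis K q.
Implicit Types (f g : R -> R) (p r : {poly R}) (b : bool) (w : seq bool).

Notation mu := (@lebesgue_measure R).
Notation D01 := (`[0%R, 1%R]%classic : set R).
Notation I01 := (I mu D01).
Notation L2 := (sq mu D01).
Let M1 : measurable (D01 : set (measurableTypeR R)) := @m01 R.
Let U1 : mu D01 = 1%E := @mu01 R.

Definition cf f l := I01 (fun t => f t * (q l).[t]).
Definition pr f : {poly R} := \sum_(0 <= l < K) cf f l *: q l.
Definition resid f b : R -> R := fun t => half b f t - half b (horner (pr f)) t.

(* Multiwavelet-type coefficients: the polynomial coefficients, on the dyadic
   interval w, of what is left of f after its polynomial projection on the
   parent interval; psi is the matching (overcomplete) frame, rescaled to
   sup-norm O(1), whence the weights 2^-|w| in the energies. *)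
Fixpoint dc f w l : R :=
  match w with
  | [::] => cf f l
  | b :: w' => if w' is [::] then cf (resid f b) l else dc (half b f) w' l
  end.

Fixpoint psi w l (x : R) : R :=
  match w with
  | [::] => (q l).[x]
  | b :: w' => if b == (1 / 2 <= x) then psi w' l (2 * x - b%:R) else 0
  end.

Lemma dc_cons2 f b c w l : dc f (b :: c :: w) l = dc (half b f) (c :: w) l.
Proof. by []. Qed.

Lemma cfD f g l : L2 f -> L2 g -> cf (fun t => f t + g t) l = cf f l + cf g l.
Proof.
move=> hf hg; rewrite /cf -(I_D M1); try by apply: (sqM M1) => //; exact: L2_horner.
by apply: eq_I => t _; rewrite mulrDl.
Qed.

Lemma cfZ c f l : L2 f -> cf (fun t => c * f t) l = c * cf f l.
Proof.
move=> hf; rewrite /cf -(I_Z M1); last by apply: (sqM M1) => //; exact: L2_horner.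
by apply: eq_I => t _; rewrite mulrA.
Qed.

Lemma eq_cf f g l : (forall t, 0 <= t <= 1 -> f t = g t) -> cf f l = cf g l.
Proof. by move=> fg; apply: eq_I => t /D01P /fg ->. Qed.

Lemma cf_horner p l : cf (horner p) l = ipp p (q l). Proof. by []. Qed.

Lemma cfB f g l : L2 f -> L2 g -> cf (fun t => f t - g t) l = cf f l - cf g l.
Proof.
move=> hf hg; rewrite -[- cf g l]mulN1r -cfZ // -cfD //; last exact: (sqZ M1).
by apply: eq_cf => t _; rewrite mulN1r.
Qed.

Lemma size_pr f : (size (pr f) <= K)%N.
Proof.
have [sq _ _] := qb; rewrite /pr big_mkord (leq_trans (size_sum _ _ _)) //.
by apply/bigmax_leqP => l _; rewrite (leq_trans (size_scale_leq _ _)) // sq.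
Qed.

Lemma pr_horner p : (size p <= K)%N -> pr (horner p) = p.
Proof. by have [_ _ sp] := qb => /sp {2}->. Qed.

Lemma I_mul_horner f p : L2 f -> (size p <= K)%N ->
  I01 (fun t => f t * p.[t]) = \sum_(0 <= l < K) cf f l * ipp p (q l).
Proof.
move=> hf sp; have [_ _ /(_ p sp) e] := qb; rewrite {1}e.
transitivity (I01 (fun t => \sum_(0 <= l < K) ipp p (q l) * (f t * (q l).[t]))).
  apply: eq_I => t _; rewrite horner_sum mulr_sumr.
  by apply: eq_bigr => l _; rewrite hornerE mulrCA.
rewrite (I_sum M1 U1).
  by apply: eq_bigr => l _; rewrite (I_Z M1) 1?mulrC //; apply: (sqM M1) => //; exact: L2_horner.
by move=> l; apply: (intgZ M1); apply: (sqM M1) => //; exact: L2_horner.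
Qed.

Lemma ipp_pr f l : (l < K)%N -> ipp (pr f) (q l) = cf f l.
Proof.
have [_ o _] := qb; move=> lK; rewrite /pr ipp_suml big_mkord.
rewrite (bigD1 (Ordinal lK)) //= o // eqxx mulr1 big1 ?addr0 // => i il.
by rewrite o // (_ : (_ == _) = false) ?mulr0 //; apply/negbTE; exact: il.
Qed.

(** Pythagoras around the projection [pr f]. With [p = pr f] the last sum vanishes, which gives both
    Bessel's inequality and the best approximation property. *)
Lemma I_sqr_sub_horner f p : L2 f -> (size p <= K)%N ->
  I01 (fun t => (f t - p.[t]) ^+ 2) =
  I01 (fun t => f t ^+ 2) - \sum_(0 <= l < K) cf f l ^+ 2
  + \sum_(0 <= l < K) (cf f l - ipp p (q l)) ^+ 2.
Proof.
move=> hf sp; transitivity (I01 (fun t => (f t + -1 * p.[t]) ^+ 2)).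
  by apply: eq_I => t _; rewrite mulN1r.
rewrite (I_sqr_comb M1) //; last exact: L2_horner.
rewrite I_mul_horner //.
have -> : I01 (fun t => p.[t] ^+ 2) = \sum_(0 <= l < K) ipp p (q l) ^+ 2.
  transitivity (I01 (fun t => p.[t] * p.[t])); first by apply: eq_I => t _; rewrite expr2.
  by rewrite I_mul_horner //; exact: L2_horner.
rewrite sqrrN expr1n mul1r mulr_sumr -[in RHS]sumrN -!addrA -!big_split /=; congr (_ + _).
by apply: eq_bigr => l _; ring.
Qed.

Lemma I_sqr_resid_le f p : L2 f -> (size p <= K)%N ->
  I01 (fun t => (f t - (pr f).[t]) ^+ 2) <= I01 (fun t => (f t - p.[t]) ^+ 2).
Proof.
move=> hf sp; rewrite !I_sqr_sub_horner ?size_pr //.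
rewrite [X in _ + X <= _]sum_nat_eq0 ?addr0; last first.
  by move=> l lK; rewrite ipp_pr // subrr expr0n.
by rewrite lerDl sumr_ge0 // => l _; rewrite sqr_ge0.
Qed.

Lemma bessel f : L2 f -> \sum_(0 <= l < K) cf f l ^+ 2 <= I01 (fun t => f t ^+ 2).
Proof.
move=> hf; have : 0 <= I01 (fun t => (f t - (pr f).[t]) ^+ 2).
  by apply: I_ge0 => t _; rewrite sqr_ge0.
rewrite I_sqr_sub_horner ?size_pr // [X in _ + X]sum_nat_eq0 ?addr0 ?subr_ge0 //.
by move=> l lK; rewrite ipp_pr // subrr expr0n.
Qed.

Definition halfp b p : {poly R} := p \Po ((2^-1)%:P * 'X + (b%:R / 2)%:P).

Lemma horner_halfp b p : half b (horner p) = horner (halfp b p).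
Proof.
apply/funext => t; rewrite /half /halfp horner_comp !hornerE.
by congr horner; field.
Qed.

Lemma size_halfp b p : (size p <= K)%N -> (size (halfp b p) <= K)%N.
Proof.
move=> sp; have [->|p0] := eqVneq p 0; first by rewrite /halfp comp_poly0 size_poly0.
rewrite (leq_trans _ sp) // (leq_trans (size_comp_poly_leq _ _)) //.
have s2 : (size ((2^-1 : R)%:P * 'X + (b%:R / 2 : R)%:P)%R <= 2)%N.
  by rewrite size_MXaddC; case: ifP => // _; rewrite ltnS size_polyC leq_b1.
rewrite -[X in (_ <= X)%N](@prednK (size p)) ?size_poly_gt0 // ltnS.
by rewrite -[X in (_ <= X)%N]muln1 leq_mul2l; case: (size _) s2 => [|[|[|]]] //=; rewrite ?orbT.
Qed.

Lemma cf_resid f b l : L2 f -> cf (resid f b) l = cf (half b f) l - ipp (halfp b (pr f)) (q l).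
Proof.
move=> hf; rewrite cfB ?horner_halfp //; [exact: sq_half|exact: L2_horner].
Qed.

Definition lsq f w := \sum_(0 <= l < K) dc f w l ^+ 2.

(** Level 0 is left out because its coefficients are invisible to the top derivative; it is added
    back through the L2 norm. The ratio [g] is 1/2 for the L2 energy and [4 ^+ m / 2] for the
    Sobolev energy. *)
Definition energy n (g : R) f :=
  \sum_(1 <= i < n.+1) g ^+ i * \sum_(w <- words i) lsq f w.

Lemma energy0 (g : R) f : energy 0 g f = 0. Proof. by rewrite /energy big_geq. Qed.

Lemma energyS n (g : R) f : energy n.+1 g f =
  g * (lsq f [:: false] + lsq f [:: true])
  + g * (energy n g (half false f) + energy n g (half true f)).
Proof.
rewrite /energy big_nat_recl //= expr1 !big_cons big_nil /= !addr0; congr (_ + _).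
rewrite -big_split /= mulr_sumr; apply: eq_big_nat => i /andP[i1 _].
rewrite sum_words exprS -mulrA mulrDr; congr (_ * (_ + _)); congr (_ * _);
by case: i i1 => // i _; rewrite !sum_words.
Qed.

(** The residual on the halves is orthogonal to [pr f], so half the level-one energy is the energy
    of the two finer projections (averaged) minus that of the coarser one. The levels therefore
    telescope, and Bessel on the finest level finishes. *)
Lemma energy_le_norm n f : L2 f ->
  \sum_(0 <= l < K) cf f l ^+ 2 + energy n 2^-1 f <= I01 (fun t => f t ^+ 2).
Proof.
elim: n f => [|n IH] f hf; first by rewrite energy0 addr0 bessel.
have hb b : L2 (half b f) := sq_half b hf.
have sp : (size (pr f) <= K)%N := size_pr f.
rewrite energyS (I_half (proj2 hf)).
have h2 := IH _ (hb true); have h1 := IH _ (hb false).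
have e b : I01 (half b (fun t => f t ^+ 2)) = I01 (fun t => half b f t ^+ 2) by [].
rewrite !e.
have r b : lsq f [:: b] = \sum_(0 <= l < K) cf (half b f) l ^+ 2
   - 2 * I01 (fun t => half b f t * half b (horner (pr f)) t)
   + I01 (fun t => half b (horner (pr f)) t ^+ 2).
  have -> : I01 (fun t => half b f t * half b (horner (pr f)) t)
     = \sum_(0 <= l < K) cf (half b f) l * ipp (halfp b (pr f)) (q l).
    by rewrite horner_halfp I_mul_horner ?size_halfp.
  have -> : I01 (fun t => half b (horner (pr f)) t ^+ 2)
     = \sum_(0 <= l < K) ipp (halfp b (pr f)) (q l) ^+ 2.
    rewrite horner_halfp; transitivity (I01 (fun t => (halfp b (pr f)).[t] * (halfp b (pr f)).[t])).
      by apply: eq_I => t _; rewrite expr2.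
    by rewrite I_mul_horner ?size_halfp //; exact: L2_horner.
  rewrite /lsq mulr_sumr -sumrN -!big_split /=; apply: eq_bigr => l _.
  by rewrite cf_resid //; ring.
have k1 : 2^-1 * I01 (fun t => half false f t * half false (horner (pr f)) t)
   + 2^-1 * I01 (fun t => half true f t * half true (horner (pr f)) t)
   = \sum_(0 <= l < K) cf f l ^+ 2.
  rewrite -(I_half (sqM M1 hf (L2_horner (pr f)))) I_mul_horner //.
  by apply: eq_big_nat => l /andP[_ lK]; rewrite ipp_pr // expr2.
have k2 : 2^-1 * I01 (fun t => half false (horner (pr f)) t ^+ 2)
   + 2^-1 * I01 (fun t => half true (horner (pr f)) t ^+ 2)
   = \sum_(0 <= l < K) cf f l ^+ 2.
  rewrite -(I_half (proj2 (L2_horner (pr f)))).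
  transitivity (I01 (fun t => (pr f).[t] * (pr f).[t])).
    by apply: eq_I => t _; rewrite expr2.
  rewrite I_mul_horner //; last exact: L2_horner.
  by apply: eq_big_nat => l /andP[_ lK]; rewrite cf_horner !ipp_pr // expr2.
rewrite !r; lra.
Qed.

Lemma lsq_resid_le f p : L2 f -> (size p <= K)%N ->
  2^-1 * (lsq f [:: false] + lsq f [:: true]) <= I01 (fun t => (f t - p.[t]) ^+ 2).
Proof.
move=> hf sp; apply: le_trans (I_sqr_resid_le hf sp).
have hr : L2 (fun t => f t - (pr f).[t]) by apply: (sqB M1) => //; exact: L2_horner.
rewrite (I_half (proj2 hr)) -mulrDr ler_wpM2l ?invr_ge0 //.
by apply: lerD; apply: (bessel (sq_half _ hr)).
Qed.

Definition partial n f x := \sum_(0 <= i < n.+1) \sum_(w <- words i)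
  \sum_(0 <= l < K) dc f w l * psi w l x.

Lemma partial0 f x : partial 0 f x = (pr f).[x].
Proof.
rewrite /partial big_nat1 big_seq1 /= /pr horner_sum.
by apply: eq_bigr => l _; rewrite hornerE.
Qed.

(** On the half that contains [x], the parent projection plus the projected residual is the
    projection of that half. Iterated, the partial sum is the polynomial projection on the level-n
    dyadic interval around [x]. *)
Lemma partialS n f x : L2 f ->
  partial n.+1 f x =
  partial n (half (1 / 2 <= x) f) (2 * x - (1 / 2 <= x)%R%:R).
Proof.
move=> hf; set b : bool := (1 / 2 <= x).
rewrite /partial big_nat_recl //=.
have -> : \sum_(0 <= i < n.+1) \sum_(w <- words i.+1) \sum_(0 <= l < K) dc f w l * psi w l x
  = \sum_(0 <= i < n.+1) \sum_(w <- words i) \sum_(0 <= l < K)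
      dc f (b :: w) l * psi w l (2 * x - b%:R).
  apply: eq_bigr => i _; rewrite sum_words.
  have z c : c != b -> \sum_(w <- words i) \sum_(0 <= l < K) dc f (c :: w) l * psi (c :: w) l x = 0.
    move=> cb; apply: big1 => w _; apply: big1 => l _.
    by rewrite /= -/b (negbTE cb) mulr0.
  have e : \sum_(w <- words i) \sum_(0 <= l < K) dc f (b :: w) l * psi (b :: w) l x =
    \sum_(w <- words i) \sum_(0 <= l < K) dc f (b :: w) l * psi w l (2 * x - b%:R).
    by apply: eq_bigr => w _; apply: eq_bigr => l _; rewrite [psi _ _ _]/= -/b eqxx.
  by rewrite -e; case: (b) z => z; [rewrite (z false) ?add0r|rewrite (z true) ?addr0].
rewrite [X in _ + X]big_nat_recl //= [in RHS]big_nat_recl //= !big_seq1 addrA.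
congr (_ + _); last first.
  apply: eq_bigr => i _; rewrite !sum_words.
  by congr (_ + _); apply: eq_bigr => w _.
have -> : \sum_(0 <= l < K) cf f l * (q l).[x] = (pr f).[x].
  by rewrite /pr horner_sum; apply: eq_bigr => l _; rewrite hornerE.
have -> : \sum_(0 <= l < K) cf (half b f) l * (q l).[2 * x - b%:R] = (pr (half b f)).[2 * x - b%:R].
  by rewrite /pr horner_sum; apply: eq_bigr => l _; rewrite hornerE.
have e : (halfp b (pr f)).[2 * x - b%:R] = (pr f).[x].
  by rewrite -horner_halfp /half; congr horner; field.
have -> : \sum_(0 <= l < K) cf (resid f b) l * (q l).[2 * x - b%:R]
  = (pr (half b f)).[2 * x - b%:R] - (halfp b (pr f)).[2 * x - b%:R].
  rewrite -[halfp b (pr f)]pr_horner ?size_halfp ?size_pr // /pr !horner_sum -sumrB.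
  by apply: eq_bigr => l _; rewrite cf_resid // !hornerE mulrBl.
by rewrite e addrC subrK.
Qed.

Definition qbound : R := \sum_(0 <= l < K) (\sum_(i < size (q l)) `|(q l)`_i|) ^+ 2.

Lemma qboundP x : 0 <= x <= 1 -> \sum_(0 <= l < K) (q l).[x] ^+ 2 <= qbound.
Proof.
move=> hx; apply: ler_sum => l _; rewrite -(real_normK (num_real (_).[_])).
by rewrite lerXn2r ?nnegrE ?sumr_ge0 // horner_le.
Qed.

Lemma qbound_ge0 : 0 <= qbound.
Proof. by apply: sumr_ge0 => l _; rewrite sqr_ge0. Qed.

(** The projection reproduces constants, so its error at [x] is the projection of [f - f x]
    evaluated at [x], controlled by Cauchy-Schwarz and Bessel. *)
Lemma pr_dev f x (L : R) : measurable_fun D01 f -> 0 <= x <= 1 ->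
  (forall y, 0 <= y <= 1 -> `|f y - f x| <= L) -> (1 <= K)%N ->
  `|(pr f).[x] - f x| <= Num.sqrt qbound * L.
Proof.
move=> mf hx hL K1.
have L0 : 0 <= L by rewrite (le_trans _ (hL x hx)).
pose g t := f t - f x.
have Lg : L2 g.
  apply: (@sq_bounded _ _ _ _ _ M1 U1 _ L); first exact: measurable_funB.
  by move=> t /D01P; exact: hL.
have Lf : L2 f.
  by apply: (eq_sq M1 _ (sqD M1 Lg (sq_cst M1 U1 (f x)))) => t _; rewrite /g subrK.
have s1 : (size ((f x)%:P : {poly R}) <= K)%N by rewrite size_polyC (leq_trans (leq_b1 _)).
have e : (pr f).[x] - f x = \sum_(0 <= l < K) cf g l * (q l).[x].
  rewrite -[X in _ - X](hornerC (f x) x) -[(f x)%:P]pr_horner // /pr !horner_sum -sumrB.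
  apply: eq_bigr => l _; rewrite !hornerE -mulrBl; congr (_ * _).
  rewrite -cfB //; last exact: L2_horner.
  by apply: eq_cf => t _; rewrite hornerC.
rewrite e.
have -> : Num.sqrt qbound * L = Num.sqrt (qbound * L ^+ 2).
  by rewrite sqrtrM ?qbound_ge0 // sqrtr_sqr ger0_norm.
rewrite -sqrtr_sqr ler_wsqrtr //.
apply: (@le_trans _ _ ((\sum_(0 <= l < K) (q l).[x] ^+ 2) * (\sum_(0 <= l < K) cf g l ^+ 2))).
  apply: quad_disc => [|t]; first by apply: sumr_ge0 => l _; rewrite sqr_ge0.
  rewrite !mulr_sumr -!big_split /=; apply: sumr_ge0 => l _.
  rewrite (_ : _ + _ = ((q l).[x] + t * cf g l) ^+ 2) ?sqr_ge0 //; ring.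
apply: ler_pM; [by apply: sumr_ge0 => l _; rewrite sqr_ge0..|exact: qboundP|].
apply: le_trans (bessel Lg) _; rewrite -[leRHS](I_cst M1 U1).
apply: (le_I M1); [by case: Lg|exact: intg_cst|move=> t /D01P ht].
by rewrite -(real_normK (num_real (g t))) lerXn2r ?nnegrE // hL.
Qed.

Lemma lip_ge0 f (L : R) :
  (forall y z, 0 <= y <= 1 -> 0 <= z <= 1 -> `|f y - f z| <= L * `|y - z|) -> 0 <= L.
Proof.
move=> /(_ 1 0); rewrite subr0 normr1 mulr1 => h.
by apply: le_trans (normr_ge0 _) (h _ _); rewrite ?lexx ?ler01.
Qed.

(** Each rescaled half has half the Lipschitz constant; after [n] halvings only one projection with
    constant [L / 2 ^+ n] is left. *)
Lemma partial_dev n f x (L : R) : measurable_fun D01 f -> 0 <= x <= 1 ->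
  (forall y z, 0 <= y <= 1 -> 0 <= z <= 1 -> `|f y - f z| <= L * `|y - z|) -> (1 <= K)%N ->
  `|partial n f x - f x| <= Num.sqrt qbound * L * 2^-1 ^+ n.
Proof.
move=> + + + K1; elim: n f x L => [|n IH] f x L mf hx hL.
  rewrite partial0 expr0 mulr1; apply: pr_dev => // y hy.
  have L0 := lip_ge0 hL.
  rewrite (le_trans (hL _ _ hy hx)) // ler_piMr // ler_norml; lra.
have Lf : L2 f.
  apply: (@sq_bounded _ _ _ _ _ M1 U1 _ (`|f 0| + L)) => // y /D01P hy.
  have h0 : 0 <= (0 : R) <= 1 by rewrite lexx ler01.
  have := hL y 0 hy h0; rewrite subr0 => h.
  rewrite -[f y](subrK (f 0)) (le_trans (ler_normD _ _)) // addrC lerD2l (le_trans h) //.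
  by rewrite ler_piMr ?(lip_ge0 hL) // ler_norml; lra.
rewrite partialS //; set b : bool := (1 / 2 <= x).
have e : f x = half b f (2 * x - b%:R) by rewrite /half; congr f; field.
rewrite e (le_trans (IH _ _ (L / 2) _ _ _)) //.
- by apply: measurable_half.
- by rewrite /b; case: (leP (1 / 2) x) => /= hx2; lra.
- move=> y z hy hz; rewrite /half.
  move: (b%:R : R) (bool_in01 R b) => B hb.
  apply: le_trans (hL ((y + B) / 2) ((z + B) / 2) _ _) _; [lra|lra|].
  rewrite (_ : _ - _ = (y - z) / 2); last by field.
  by rewrite normrM (@ger0_norm _ 2^-1) ?invr_ge0 // mulrA mulrAC.
- by rewrite exprS; lra.
Qed.

(** Among the words of a given length exactly one is active at [x], so the bound does not grow with
    the level. *)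
Lemma psi_level i x : 0 <= x <= 1 ->
  \sum_(w <- words i) \sum_(0 <= l < K) psi w l x ^+ 2 <= qbound.
Proof.
elim: i x => [|i IH] x hx; first by rewrite big_seq1 /= qboundP.
set b : bool := (1 / 2 <= x).
have z c : c != b -> \sum_(w <- words i) \sum_(0 <= l < K) psi (c :: w) l x ^+ 2 = 0.
  move=> cb; apply: big1 => w _; apply: big1 => l _.
  by rewrite /= -/b (negbTE cb) expr0n.
have e : \sum_(w <- words i) \sum_(0 <= l < K) psi (b :: w) l x ^+ 2 =
    \sum_(w <- words i) \sum_(0 <= l < K) psi w l (2 * x - b%:R) ^+ 2.
  by apply: eq_bigr => w _; apply: eq_bigr => l _; rewrite [psi _ _ _]/= -/b eqxx.
have h : 0 <= 2 * x - b%:R <= 1 by rewrite /b; case: (leP (1 / 2) x) => /= hx2; lra.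
rewrite sum_words; have := IH _ h; rewrite -e.
by case: (b) z => z; [rewrite (z false) ?add0r|rewrite (z true) ?addr0].
Qed.

Lemma measurable_psi w l : measurable_fun setT (psi w l).
Proof.
elim: w => [|b w IH] /=; first exact: measurable_horner.
apply: measurable_fun_if => //.
- case: b => /=.
    rewrite (_ : (fun _ => _) = (fun x : R => (1 / 2 <= x))); last by apply/funext => x; case: (_ <= _).
    exact: measurable_fun_ler.
  rewrite (_ : (fun _ => _) = (fun x : R => (x < 1 / 2))); last first.
    by apply/funext => x; rewrite ltNge; case: (_ <= _).
  exact: measurable_fun_ltr.
- apply: measurable_funTS; apply: (measurableT_comp IH).
  by apply: measurable_funB => //; apply: measurable_funM.
Qed.

End Details.

(** * Chains of derivatives and decay of the multiwavelet coefficients *)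

Section SobolevChains.
Context (R : realType) (m : nat).
Hypothesis hm : (2 <= m)%N.
Implicit Types (f g : R -> R) (D E : nat -> R -> R) (b : bool).

Notation mu := (@lebesgue_measure R).
Notation D01 := (`[0%R, 1%R]%classic : set R).
Notation I01 := (I mu D01).
Notation L2 := (sq mu D01).
Let M1 : measurable (D01 : set (measurableTypeR R)) := @m01 R.
Let U1 : mu D01 = 1%E := @mu01 R.

Lemma lip_measurable f (L : R) :
  (forall y z, 0 <= y <= 1 -> 0 <= z <= 1 -> `|f y - f z| <= L * `|y - z|) ->
  measurable_fun D01 f.
Proof.
move=> hL; have L0 := lip_ge0 hL.
apply: subspace_continuous_measurable_fun => //.
apply/subspace_continuousP => x /D01P hx.
apply/cvgrPdist_le => e e0; rewrite near_withinE; near=> t => /D01P ht.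
apply: le_trans (hL _ _ hx ht) _.
have : `|x - t| <= e / (L + 1).
  near: t; have /cvgrPdist_le := (@cvg_id R (nbhs x)).
  by apply; rewrite divr_gt0 // ltr_pwDr.
rewrite ler_pdivlMr ?ltr_pwDr // => h; apply: le_trans h.
by rewrite mulrC ler_wpM2l // lerDl.
Unshelve. all: by end_near.
Qed.

Lemma chain_intg f D k : sob_chain m f D -> (1 <= k <= m)%N -> intg mu D01 (D k).
Proof. by move=> [_ [h _]] /h. Qed.

Lemma chain_int0x f D k x : sob_chain m f D -> (k < m)%N -> 0 <= x <= 1 ->
  D k x = D k 0 + int0x x (D k.+1).
Proof. by move=> [_ [_ [h _]]] km; apply: h. Qed.

Lemma int0x_le x f : 0 <= x <= 1 -> intg mu D01 f -> `|int0x x f| <= I01 (fun t => `|f t|).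
Proof.
move=> hx hf; rewrite int0xE // (le_trans (le_norm_I M1 (intg_le_ind x hf))) //.
apply: (le_I M1); [apply: intg_norm; exact: intg_le_ind|exact: intg_norm|].
by move=> t _; rewrite normrM ler_piMl // ind_le1.
Qed.

Lemma chain_bounded f D k : sob_chain m f D -> (k < m)%N ->
  exists M, forall x, 0 <= x <= 1 -> `|D k x| <= M.
Proof.
move=> hD km; exists (`|D k 0| + I01 (fun t => `|D k.+1 t|)) => x hx.
rewrite (chain_int0x hD km hx) (le_trans (ler_normD _ _)) // lerD2l int0x_le //.
exact: (chain_intg hD).
Qed.

Lemma L2_bounded f (M : R) : measurable_fun D01 f ->
  (forall x, 0 <= x <= 1 -> `|f x| <= M) -> L2 f.
Proof.
by move=> mf hM; apply: (@sq_bounded _ _ _ _ _ M1 U1 _ M) => // x /D01P; exact: hM.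
Qed.

Lemma le_I_cst f (M : R) : intg mu D01 f ->
  (forall x, 0 <= x <= 1 -> f x <= M) -> I01 f <= M.
Proof.
move=> hf h; rewrite -[leRHS](I_cst M1 U1); apply: (le_I M1) => //.
exact: intg_cst.
Qed.

Lemma chain_sq_pos f D k : sob_chain m f D -> (1 <= k <= m)%N -> L2 (D k).
Proof.
move=> hD /andP[k1]; rewrite leq_eqVlt => /predU1P[->|km].
  split; last by case: hD => _ [_ []].
  by apply: (@intg_meas _ _ _ mu); apply: (chain_intg hD); rewrite leqnn andbT; exact: ltnW.
have [M hM] := chain_bounded hD km; apply: L2_bounded hM.
by apply: (@intg_meas _ _ _ mu); apply: (chain_intg hD); rewrite k1 ltnW.
Qed.

Lemma chain_diff_sqr f D k x y : sob_chain m f D -> (k < m)%N -> 0 <= x <= 1 -> 0 <= y <= 1 ->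
  (D k y - D k x) ^+ 2 <= `|y - x| * I01 (fun t => D k.+1 t ^+ 2).
Proof.
move=> hD km; wlog xy : x y / x <= y => [hw hx hy|hx hy].
  by case/orP: (le_total x y) => h; [exact: hw|rewrite -sqrrN opprB distrC; exact: hw].
rewrite (chain_int0x hD km hx) (chain_int0x hD km hy) ger0_norm ?subr_ge0 //.
rewrite opprD addrACA subrr add0r.
by apply: int0x_diff_sqr => //; [lra|lra|apply: (chain_sq_pos hD)].
Qed.

(** Since [m >= 2], the first derivative is itself an indefinite integral, hence bounded. *)
Lemma chain_lip f D : sob_chain m f D -> exists L,
  forall y z, 0 <= y <= 1 -> 0 <= z <= 1 -> `|f y - f z| <= L * `|y - z|.
Proof.
move=> hD; have e0 : D 0%N = f by case: hD.
have [M hM] := chain_bounded hD hm.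
exists M; suff h y z : z <= y -> 0 <= y <= 1 -> 0 <= z <= 1 -> `|f y - f z| <= M * `|y - z|.
  move=> y z hy hz; case/orP: (le_total z y) => yz; first exact: h.
  by rewrite distrC [`|y - z|]distrC h.
move=> zy hy hz; rewrite (ger0_norm (_ : 0 <= y - z)) ?subr_ge0 //.
have hi : intg mu D01 (D 1%N) by apply: (chain_intg hD); apply/andP; split=> //; exact: ltnW.
have m0 : (0 < m)%N by rewrite ltnW.
rewrite -e0 (chain_int0x hD m0 hy) (chain_int0x hD m0 hz) opprD addrACA subrr add0r.
rewrite !int0xE // -(I_B M1); [|exact: intg_le_ind..].
have hd : intg mu D01 (fun t => ind y t * D 1%N t - ind z t * D 1%N t).
  by apply: (intgB M1); exact: intg_le_ind.
have hs x : intg mu D01 (ind x) := sq_intg M1 U1 (sq_le_ind x).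
rewrite (le_trans (le_norm_I M1 hd)) //.
have -> : y - z = I01 (ind y) - I01 (ind z) by rewrite !I_le_ind.
rewrite -(I_B M1) // -(I_Z M1); last exact: (intgB M1).
apply: (le_I M1); [exact: intg_norm|exact/(intgZ M1)/(intgB M1)|].
move=> t /D01P ht.
have hn : 0 <= ind y t - ind z t.
  by rewrite /ind subr_ge0; case: (leP t z) => [tz|_]; rewrite ?(le_trans tz zy) ?ler0n.
by rewrite -mulrBl normrM (ger0_norm hn) mulrC ler_wpM2r ?hM.
Qed.

(** The integrability clause of [sob_chain] starts at [D 1]; measurability of [D 0] comes from the
    Lipschitz property. *)
Lemma chain_sq f D k : sob_chain m f D -> (k <= m)%N -> L2 (D k).
Proof.
move=> hD km; case: (posnP k) => [->|k0]; last by apply: (chain_sq_pos hD); rewrite k0.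
have [M hM] := chain_bounded hD (ltnW hm); apply: L2_bounded hM.
have [L hL] := chain_lip hD; have -> : D 0%N = f by case: hD.
exact: lip_measurable hL.
Qed.

Lemma chain_half f D b : sob_chain m f D ->
  sob_chain m (half b f) (fun k t => 2^-1 ^+ k * half b (D k) t).
Proof.
move=> hD; split; first by apply/funext => t; rewrite (proj1 hD) expr0 mul1r.
split; [|split].
- by move=> k km; apply: (intgZ M1); apply: intg_half; exact: (chain_intg hD km).
- move=> k km x hx.
  have hi : intg mu D01 (D k.+1) by apply: (chain_intg hD).
  rewrite [int0x x _](_ : _ = 2^-1 ^+ k.+1 * int0x x (half b (D k.+1))); last first.
    rewrite !int0xE // -(I_Z M1); last exact/intg_le_ind/intg_half.
    by apply: eq_I => t _; rewrite mulrCA.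
  have hb := bool_in01 R b.
  have h1 : 0 <= (x + b%:R) / 2 <= 1.
    by move: (b%:R : R) hb => B hb; lra.
  have h2 : 0 <= (b%:R : R) / 2 <= 1.
    by move: (b%:R : R) hb => B hb; lra.
  rewrite {1}/half (chain_int0x hD km h1) int0x_half // /half add0r.
  rewrite (chain_int0x hD km h2) exprS; ring.
- have := proj2 (sqZ M1 (2^-1 ^+ m) (sq_half b (chain_sq hD (leqnn m)))).
  exact.
Qed.

Lemma chainD f g D E c : sob_chain m f D -> sob_chain m g E ->
  sob_chain m (fun t => f t + c * g t) (fun k t => D k t + c * E k t).
Proof.
move=> hD hE; split; first by case: hD => ->; case: hE => ->.
split; [|split].
- by move=> k km; apply: (intgD M1); [exact: (chain_intg hD km)|apply: (intgZ M1); exact: (chain_intg hE km)].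
- move=> k km x hx.
  have h1 : intg mu D01 (D k.+1) by apply: (chain_intg hD).
  have h2 : intg mu D01 (E k.+1) by apply: (chain_intg hE).
  rewrite [int0x x _](_ : _ = int0x x (D k.+1) + c * int0x x (E k.+1)); last first.
    rewrite !int0xE // -(I_Z M1); last exact: intg_le_ind.
    rewrite -(I_D M1); [|exact: intg_le_ind|exact/(intgZ M1)/intg_le_ind].
    by apply: eq_I => t _; ring.
  rewrite (chain_int0x hD km hx) (chain_int0x hE km hx); ring.
- exact: (proj2 (sqD M1 (chain_sq hD (leqnn m)) (sqZ M1 c (chain_sq hE (leqnn m))))).
Qed.

(* Keeping the term ||bump (D m.-1)||^2 makes the energy inequality [energy_le]
   stable under halving, hence provable by induction on the level. *)
Definition lin0 (F : R -> R) t := F 0 + t * (F 1 - F 0).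
Definition bump (F : R -> R) t := F t - lin0 F t.

Lemma bumpZ c F t : bump (fun s => c * F s) t = c * bump F t.
Proof. by rewrite /bump /lin0; ring. Qed.

Lemma L2_bump F : L2 F -> L2 (bump F).
Proof.
move=> hF; apply: (sqB M1) => //.
apply: (eq_sq M1 _ (L2_horner ((F 0)%:P + (F 1 - F 0) *: 'X))) => t _.
by rewrite !hornerE /lin0 mulrC.
Qed.

(** Integrate the chord of [D m.-1] back [m.-1] times with the initial values of [D]. An error that
    starts at 0 does not grow in L2 norm when integrated over [0,1], and the degree reached is [m],
    which is why the frame uses [m.+1] polynomials. *)
Lemma chain_poly_approx f D : sob_chain m f D ->
  exists2 p : {poly R}, (size p <= m.+1)%N &
    I01 (fun t => (f t - p.[t]) ^+ 2) <= I01 (fun t => bump (D m.-1) t ^+ 2).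
Proof.
move=> hD; have m1 : (m.-1 < m)%N by rewrite prednK // ltnW.
have hb : L2 (bump (D m.-1)) := L2_bump (chain_sq hD (ltnW m1)).
suff h j : (j < m)%N -> exists2 p : {poly R}, (size p <= j.+2)%N &
    I01 (fun t => (D (m.-1 - j)%N t - p.[t]) ^+ 2) <= I01 (fun t => bump (D m.-1) t ^+ 2).
  have [p sp hp] := h m.-1 m1; exists p; first by rewrite prednK // in sp; exact: ltnW.
  by move: hp; rewrite subnn; case: hD => ->.
elim: j => [|j IH] jm.
  exists ((D m.-1 0)%:P + (D m.-1 1 - D m.-1 0) *: 'X).
    rewrite (leq_trans (size_polyD _ _)) // geq_max size_polyC (leq_trans (leq_b1 _)) //=.
    by rewrite (leq_trans (size_scale_leq _ _)) // size_polyX.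
  rewrite subn0 le_eqVlt; apply/orP; left; apply/eqP/eq_I => t _.
  by rewrite !hornerE /bump /lin0; congr (_ ^+ 2); ring.
have [p sp hp] := IH (ltnW jm).
pose k := (m.-1 - j.+1)%N.
have kE : (m.-1 - j)%N = k.+1 by rewrite /k -subSn ?subSS //; rewrite -ltnS prednK // ltnW.
have km : (k.+1 <= m)%N by rewrite -kE (leq_trans (leq_subr _ _)) // ltnW.
rewrite -/k; rewrite kE in hp.
exists ((D k 0)%:P + primp p).
  rewrite (leq_trans (size_polyD _ _)) // geq_max size_polyC (leq_trans (leq_b1 _)) //=.
  by rewrite (leq_trans (size_primp _)) // ltnS.
have hr : L2 (fun t => D k.+1 t - p.[t]).
  by apply: (sqB M1); [exact: chain_sq hD _|exact: L2_horner].
have hr' : L2 (fun t => D k t - ((D k 0)%:P + primp p).[t]).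
  by apply: (sqB M1); [exact: (chain_sq hD (ltnW km))|exact: L2_horner].
apply: le_trans hp; apply: le_I_cst; first by case: hr'.
move=> x hx; have /andP[x0 x1] := hx.
have -> : D k x - ((D k 0)%:P + primp p).[x] =
   int0x x (fun t => D k.+1 t - p.[t]) - int0x 0 (fun t => D k.+1 t - p.[t]).
  rewrite int0x0 subr0 (chain_int0x hD km hx) !hornerE -int0x_horner // !int0xE //.
  have i1 : intg mu D01 (D k.+1) by apply: (chain_intg hD).
  have i2 : intg mu D01 (horner p) := sq_intg M1 U1 (L2_horner p).
  rewrite opprD addrACA subrr add0r -(I_B M1); [|exact: intg_le_ind..].
  by apply: eq_I => t _; rewrite mulrBr.
apply: le_trans (int0x_diff_sqr _ _ _ hr) _ => //.
rewrite subr0 ler_piMl //; apply: I_ge0 => t _; exact: sqr_ge0.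
Qed.

Variable q : nat -> {poly R}.
Hypothesis qb : orthobasis m.+1 q.

Notation energy := (energy m.+1 q).

(** Adding the midpoint as a node changes the piecewise linear interpolant by a tent whose height is
    the deviation of [F] from its chord at 1/2. *)
Lemma bump_half F b t : half b (bump F) t = bump (half b F) t +
  (F 2^-1 - (F 0 + F 1) / 2) * (if b then 1 - t else t).
Proof.
rewrite /half /bump /lin0; case: b; rewrite /= ?mulr1n ?mulr0n.
  have -> : (0 + 1) / 2 = 2^-1 :> R by field.
  have -> : (1 + 1) / 2 = 1 :> R by field.
  by field.
have -> : (0 + 0) / 2 = 0 :> R by field.
have -> : (1 + 0) / 2 = 2^-1 :> R by field.
by field.
Qed.

(** The right side is [4 ^+ m] times the variance of [D m]; passing to variances within the halves
    lowers it, and the loss pays for the new level. In the ratio [4 ^+ m / 2], the factor [4 ^+ m]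
    rescales the squared m-th derivative of a half and 1/2 rescales its integral. *)
Lemma energy_le n f D : sob_chain m f D ->
  energy n (4 ^+ m / 2) f + 4 ^+ m * I01 (fun t => bump (D m.-1) t ^+ 2)
  <= 4 ^+ m * (I01 (fun t => D m t ^+ 2) - (D m.-1 1 - D m.-1 0) ^+ 2).
Proof.
have m1 : (m.-1 < m)%N by rewrite prednK // ltnW.
have mE : m.-1.+1 = m by rewrite prednK // ltnW.
have p4 : (0 : R) < 4 ^+ m by rewrite exprn_gt0.
elim: n f D => [|n IH] f D hD.
  rewrite energy0 add0r ler_pM2l //.
  have hu : L2 (D m) := chain_sq hD (leqnn m).
  set c := D m.-1 1 - D m.-1 0.
  have cE : c = I01 (D m).
    rewrite /c (chain_int0x hD m1 (_ : 0 <= 1 <= 1)) ?lexx ?ler01 // mE int0x1.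
    by rewrite addrAC subrr add0r.
  have hd : L2 (fun t => D m t + - c * 1) by apply: (sqD M1) => //; exact: (sq_cst M1 U1).
  have e : I01 (fun t => D m t ^+ 2) - c ^+ 2 = I01 (fun t => (D m t + - c * 1) ^+ 2).
    rewrite (I_sqr_comb M1) //; last exact: (sq_cst M1 U1).
    rewrite (I_cst M1 U1) (_ : I01 (fun t => D m t * 1) = c); last first.
      by rewrite cE; apply: eq_I => t _; rewrite mulr1.
    by rewrite expr1n; ring.
  rewrite e; apply: le_I_cst; first by case: (L2_bump (chain_sq hD (ltnW m1))).
  move=> x hx; have /andP[x0 x1] := hx.
  (* With [c] the mean of [D m], the bump is the primitive of [D m - c], so its square is at most
     the variance. *)
  have -> : bump (D m.-1) x = int0x x (fun t => D m t + - c * 1) - int0x 0 (fun t => D m t + - c * 1).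
    rewrite int0x0 subr0 /bump /lin0 -/c (chain_int0x hD m1 hx) mE !int0xE //.
    rewrite -[X in _ - (_ + X * _)](I_le_ind hx) opprD addrACA subrr add0r.
    have hs : intg mu D01 (ind x) := sq_intg M1 U1 (sq_le_ind x).
    rewrite mulrC -(I_Z M1) // -(I_B M1).
    + by apply: eq_I => t _; ring.
    + by apply: intg_le_ind; exact: (sq_intg M1 U1).
    + exact: (intgZ M1).
  apply: le_trans (int0x_diff_sqr _ _ _ hd) _ => //.
  by rewrite subr0 ler_piMl //; apply: I_ge0 => t _; exact: sqr_ge0.
have hu : L2 (D m) := chain_sq hD (leqnn m).
have hF : L2 (D m.-1) := chain_sq hD (ltnW m1).
have hf : L2 f by have := chain_sq hD (leq0n m); case: hD => ->.
have [p sp hp] := chain_poly_approx hD.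
have hlsq := le_trans (lsq_resid_le qb hf sp) hp.
have h b := IH _ _ (chain_half b hD).
have E5 : (2^-1 ^+ m.-1) ^+ 2 = 4 * (4 ^+ m)^-1 :> R.
  rewrite exprAC (_ : 2^-1 ^+ 2 = 4^-1 :> R); last by field.
  rewrite (_ : 4 ^+ m = 4 * 4 ^+ m.-1 :> R) -?exprS ?mE // exprVn.
  by rewrite -[in RHS]mE exprS; field; rewrite expf_neq0.
have e1 b : I01 (fun t => (2^-1 ^+ m * half b (D m) t) ^+ 2) =
   (4 ^+ m)^-1 * I01 (fun t => half b (D m) t ^+ 2).
  rewrite -(I_Z M1); last by case: (sq_half b hu).
  apply: eq_I => t _; rewrite exprMn; congr (_ * _).
  by rewrite exprAC -exprVn; congr (_ ^+ _); field.
have e2 b : I01 (fun t => bump (fun t => 2^-1 ^+ m.-1 * half b (D m.-1) t) t ^+ 2) =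
   4 * (4 ^+ m)^-1 * I01 (fun t => bump (half b (D m.-1)) t ^+ 2).
  rewrite -(I_Z M1); last by case: (L2_bump (sq_half b hF)).
  by apply: eq_I => t _; rewrite bumpZ exprMn E5.
have e3 b : (2^-1 ^+ m.-1 * half b (D m.-1) 1 - 2^-1 ^+ m.-1 * half b (D m.-1) 0) ^+ 2 =
   (4 ^+ m)^-1 * (2 * (half b (D m.-1) 1 - half b (D m.-1) 0)) ^+ 2.
  by rewrite -mulrBr exprMn E5; ring.
have iu := I_half (proj2 hu).
have ew := I_half (proj2 (L2_bump hF)).
rewrite /= in iu ew.
(* With [c] the increment of [D m.-1] over [0,1], those over the halves are [c/2 + dl] and
   [c/2 - dl]. Halving thus lowers the variance by exactly [4 * dl ^+ 2], which is what [hw], used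
   for twice the bump norm, spends on the tent. *)
pose dl := D m.-1 2^-1 - (D m.-1 0 + D m.-1 1) / 2.
have hw b : I01 (half b (fun t => bump (D m.-1) t ^+ 2)) <=
   2 * I01 (fun t => bump (half b (D m.-1)) t ^+ 2) + 2 * dl ^+ 2.
  have hbb := L2_bump (sq_half b hF).
  rewrite -(I_Z M1); last by case: hbb.
  rewrite -[X in _ + X](I_cst M1 U1 (2 * dl ^+ 2)) -(I_D M1); last first.
  - exact: intg_cst.
  - by apply: (intgZ M1); case: hbb.
  apply: (le_I M1).
  - by apply: intg_half; case: (L2_bump hF).
  - by apply: (intgD M1); [apply: (intgZ M1); case: hbb|exact: intg_cst].
  move=> t /D01P ht; rewrite [leLHS](_ : _ = half b (bump (D m.-1)) t ^+ 2) // bump_half -/dl.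
  have : `|if b then 1 - t else t| <= 1 by case: (b); rewrite ler_norml; lra.
  set s := (if b then _ else _) => hs.
  have : s ^+ 2 <= 1 by rewrite -(real_normK (num_real s)) expr_le1.
  set B := bump _ _; have := sqr_ge0 (B - dl * s); have := sqr_ge0 dl; nra.
have hT := h true; have hFa := h false; have wT := hw true; have wF := hw false.
rewrite energyS.
move: hT hFa; rewrite !e1 !e2 !e3 => hT hFa.
have k b : 4 ^+ m * ((4 ^+ m)^-1 * I01 (fun t => half b (D m) t ^+ 2) -
  (4 ^+ m)^-1 * (2 * (half b (D m.-1) 1 - half b (D m.-1) 0)) ^+ 2) =
   I01 (fun t => half b (D m) t ^+ 2) - (2 * (half b (D m.-1) 1 - half b (D m.-1) 0)) ^+ 2.
  by field; rewrite lt0r_neq0.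
have k2 b : 4 ^+ m * (4 / 4 ^+ m * I01 (fun t => bump (half b (D m.-1)) t ^+ 2)) =
  4 * I01 (fun t => bump (half b (D m.-1)) t ^+ 2).
  by field; rewrite lt0r_neq0.
rewrite !k !k2 in hT hFa.
have f0 : half false (D m.-1) 0 = D m.-1 0 by rewrite /half; congr (D _ _); rewrite /= mulr0n; field.
have f1 : half false (D m.-1) 1 = D m.-1 2^-1 by rewrite /half; congr (D _ _); rewrite /= mulr0n; field.
have t0 : half true (D m.-1) 0 = D m.-1 2^-1 by rewrite /half; congr (D _ _); rewrite /= mulr1n; field.
have t1 : half true (D m.-1) 1 = D m.-1 1 by rewrite /half; congr (D _ _); rewrite /= mulr1n; field.
rewrite f0 f1 in hFa; rewrite t0 t1 in hT.
rewrite iu ew.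
move: wT wF hT hFa hlsq; rewrite ew /dl.
have -> : I01 (half false (fun t => D m t ^+ 2)) = I01 (fun t => half false (D m) t ^+ 2) by [].
have -> : I01 (half true (fun t => D m t ^+ 2)) = I01 (fun t => half true (D m) t ^+ 2) by [].
move=> wT wF.
set n1 := energy n _ (half true f); set n2 := energy n _ (half false f).
move=> hT hFa hl; set P4 := 4 ^+ m.
rewrite [leLHS](_ : _ = P4 * (2^-1 * (lsq m.+1 q f [:: false] + lsq m.+1 q f [:: true])
  + 2^-1 * (n1 + n2) + (2^-1 * I01 (half false (fun t => bump (D m.-1) t ^+ 2))
  + 2^-1 * I01 (half true (fun t => bump (D m.-1) t ^+ 2))))); last by field.
rewrite ler_pM2l //; lra.
Qed.

End SobolevChains.

(** * Dyadic discretisation of the L2 norm *)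

Section DyadicVariance.
Context (R : realType).
Implicit Types (u v F G : R -> R) (b : bool) (w : seq bool).

Notation mu := (@lebesgue_measure R).
Notation D01 := (`[0%R, 1%R]%classic : set R).
Notation I01 := (I mu D01).
Notation L2 := (sq mu D01).
Let M1 : measurable (D01 : set (measurableTypeR R)) := @m01 R.
Let U1 : mu D01 = 1%E := @mu01 R.

Fixpoint dlt w F : R := if w is b :: w' then dlt w' (half b F) else F 1 - F 0.

(** The endpoints depend on [w] alone, so a dyadic increment is a difference of two point
    evaluations, a functional that pointwise convergence controls. *)
Lemma dltE w : exists x y, [/\ 0 <= x <= 1, 0 <= y <= 1 & forall F, dlt w F = F y - F x].
Proof.
elim: w => [|b w [x [y [hx hy h]]]].
  by exists 0, 1; split=> //; rewrite ?lexx ?ler01.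
exists ((x + b%:R) / 2), ((y + b%:R) / 2).
split=> [||F]; last by rewrite /= h.
- by move: (b%:R : R) (bool_in01 R b) => B hB; lra.
- by move: (b%:R : R) (bool_in01 R b) => B hB; lra.
Qed.

(* The mean variance of u on the 2^n dyadic intervals of level n. *)
Fixpoint vr n u : R :=
  if n is n'.+1 then 2^-1 * (vr n' (half false u) + vr n' (half true u))
  else I01 (fun t => u t ^+ 2) - I01 u ^+ 2.

(** On an interval of length 2^-n the mean of [u] is 2^n times the increment of its primitive [F].
    In the induction, [half b u] has the primitive [2 * half b F]. *)
Lemma vrE n u F : L2 u -> (forall x, 0 <= x <= 1 -> F x = F 0 + int0x x u) ->
  vr n u = I01 (fun t => u t ^+ 2) - 2 ^+ n * \sum_(w <- words n) dlt w F ^+ 2.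
Proof.
elim: n u F => [|n IH] u F hu hF.
  have -> : vr 0 u = I01 (fun t => u t ^+ 2) - I01 u ^+ 2 by [].
  rewrite big_seq1 expr0 mul1r; congr (_ - _ ^+ 2).
  by rewrite /= (hF 1) ?lexx ?ler01 // int0x1 addrC addKr.
have ui : intg mu D01 u := sq_intg M1 U1 hu.
have hb b : forall x, 0 <= x <= 1 ->
  2 * half b F x = 2 * half b F 0 + int0x x (half b u).
  move=> x hx; have hb := bool_in01 R b; rewrite /half add0r.
  rewrite [F (_ / 2)]hF; last by move: (b%:R : R) hb => B hB; lra.
  rewrite int0x_half // [F (b%:R / 2)]hF; last by move: (b%:R : R) hb => B hB; lra.
  by field.
have e b w : dlt w (fun x => 2 * half b F x) = 2 * dlt w (half b F).
  by have [x [y [_ _ h]]] := dltE w; rewrite !h; ring.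
rewrite [vr n.+1 u]/= (IH _ _ (sq_half false hu) (hb false)) (IH _ _ (sq_half true hu) (hb true)).
rewrite (I_half (proj2 hu)) sum_words /=.
have k b : \sum_(w <- words n) dlt w (fun x => 2 * half b F x) ^+ 2 =
  4 * \sum_(w <- words n) dlt w (half b F) ^+ 2.
  by rewrite mulr_sumr; apply: eq_bigr => w _; rewrite e exprMn; congr (_ * _); ring.
rewrite !k exprS.
have -> : I01 (half false (fun t => u t ^+ 2)) = I01 (fun t => half false u t ^+ 2) by [].
have -> : I01 (half true (fun t => u t ^+ 2)) = I01 (fun t => half true u t ^+ 2) by [].
by field.
Qed.

Lemma vr_le n u : L2 u -> vr n u <= I01 (fun t => u t ^+ 2).
Proof.
elim: n u => [|n IH] u hu /=; first by rewrite gerBl sqr_ge0.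
rewrite (I_half (proj2 hu)) -mulrDr ler_wpM2l ?invr_ge0 //.
by apply: lerD; apply: IH; apply: sq_half.
Qed.

Lemma vr_ge0 n u : L2 u -> 0 <= vr n u.
Proof.
elim: n u => [|n IH] u hu; first by rewrite subr_ge0 (I_sqr_le M1 U1).
have := IH _ (sq_half false hu); have := IH _ (sq_half true hu).
by rewrite [vr n.+1 u]/= => h1 h2; rewrite mulr_ge0 ?invr_ge0 ?addr_ge0.
Qed.

Lemma vr_comb n u v : L2 u -> L2 v ->
  vr n u <= 2 * vr n (fun t => u t - v t) + 2 * vr n v.
Proof.
elim: n u v => [|n IH] u v hu hv /=.
  have iu : intg mu D01 u := sq_intg M1 U1 hu.
  have iv : intg mu D01 v := sq_intg M1 U1 hv.
  have h t : I01 (fun x => (u x + t * v x) ^+ 2) - (I01 u + t * I01 v) ^+ 2 >= 0.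
    rewrite subr_ge0 -(I_Z M1) // -(I_D M1) //; last exact: (intgZ M1).
    by apply: (I_sqr_le M1 U1); apply: (sqD M1) => //; exact: (sqZ M1).
  have := h (-2).
  have -> : I01 (fun t => (u t - v t) ^+ 2) = I01 (fun t => (u t + -1 * v t) ^+ 2).
    by apply: eq_I => t _; rewrite mulN1r.
  rewrite (I_B M1) // !(I_sqr_comb M1) //; nra.
have := IH _ _ (sq_half false hu) (sq_half false hv).
have := IH _ _ (sq_half true hu) (sq_half true hv).
have -> : half true (fun t => u t - v t) = (fun t => half true u t - half true v t) by [].
have -> : half false (fun t => u t - v t) = (fun t => half false u t - half false v t) by [].
lra.
Qed.

Lemma vr_osc n v (e : R) : L2 v ->
  (forall x y, 0 <= x <= 1 -> 0 <= y <= 1 -> `|x - y| <= 2^-1 ^+ n -> `|v x - v y| <= e) ->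
  vr n v <= e ^+ 2.
Proof.
elim: n v => [|n IH] v hv h /=.
  have iv : intg mu D01 v := sq_intg M1 U1 hv.
  have hc : L2 (fun t => v t + - v 0 * 1) by apply: (sqD M1) => //; exact: (sq_cst M1 U1).
  have : I01 (fun t => (v t + - v 0 * 1) ^+ 2) <= e ^+ 2.
    apply: le_I_cst; first by case: hc.
    move=> x hx; rewrite mulr1 -(real_normK (num_real (_ - _))).
    have h0 : `|v x - v 0| <= e.
      by apply: h => //; [rewrite lexx ler01|rewrite expr0 subr0 ler_norml; lra].
    by rewrite lerXn2r // nnegrE // (le_trans _ h0).
  rewrite (I_sqr_comb M1) //; last exact: (sq_cst M1 U1).
  rewrite (I_cst M1 U1).
  have -> : I01 (fun t => v t * 1) = I01 v by apply: eq_I => t _; rewrite mulr1.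
  have := sqr_ge0 (I01 v - v 0); rewrite expr1n; nra.
have hh b : vr n (half b v) <= e ^+ 2.
  apply: IH; first exact: sq_half.
  move=> x y hx hy hxy; rewrite /half.
  move: (b%:R : R) (bool_in01 R b) => B hB.
  apply: h; [lra|lra|].
  rewrite (_ : _ - _ = (x - y) / 2); last by field.
  by rewrite normrM (@ger0_norm _ 2^-1) ?invr_ge0 // exprS mulrC ler_wpM2l // invr_ge0.
have := hh true; have := hh false; lra.
Qed.

Lemma unif_osc v (e : R) : continuous v -> 0 < e ->
  exists N, forall n x y, (N <= n)%N -> 0 <= x <= 1 -> 0 <= y <= 1 ->
    `|x - y| <= 2^-1 ^+ n -> `|v x - v y| <= e.
Proof.
move=> cv e0.
have := @segment_compact R 0 1; rewrite compact_near_coveringP.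
move=> /(_ nat \oo (fun n x => forall y, `|x - y| <= 2^-1 ^+ n -> `|v x - v y| <= e)) h.
have {h} [|N _ hN] := h _.
  move=> x _.
  have /cvgrPdist_lt /(_ (e / 2)) := cv x; rewrite divr_gt0 // => /(_ isT) /nbhs_ballP[d d0 hd].
  have hpow : (fun n => (2^-1 : R) ^+ n) @ \oo --> 0.
    by apply: cvg_expr; rewrite ger0_norm ?invr_ge0 // invf_lt1 // ltr1n.
  have hn : \forall n \near \oo, (2^-1 : R) ^+ n < d / 2.
    have /cvgrPdist_lt /(_ (d / 2)) := hpow; rewrite divr_gt0 // => /(_ isT).
    by apply: filterS => n; rewrite sub0r normrN ger0_norm // exprn_ge0 ?invr_ge0.
  exists (ball x (d / 2), [set n | (2^-1 : R) ^+ n < d / 2]) => /=.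
    by split=> //; apply: nbhsx_ballx; rewrite divr_gt0.
  move=> [x' n] /= [hx' hn'] y hy.
  have h1 : `|v x - v x'| < e / 2.
    apply: hd; apply: lt_le_trans hx' _; rewrite ler_pdivrMr // ler_peMr ?ler1n //; exact: ltW.
  have h2 : `|v x - v y| < e / 2.
    apply: hd; rewrite /ball /= -(subrKA x') (le_lt_trans (ler_normD _ _)) //.
    by move: hx'; rewrite /ball /= => hx'; lra.
  rewrite -(subrKA (v x)) (le_trans (ler_normD _ _)) // distrC; lra.
by exists N => n x y Nn hx hy hxy; apply: (hN n).
Qed.

Definition trunc (M x : R) := Num.max (- M) (Num.min x M).

Lemma trunc_le M x : 0 <= M -> `|trunc M x| <= M.
Proof.
move=> M0; rewrite /trunc ler_norml; apply/andP; split.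
  by rewrite le_max lexx.
by rewrite ge_max ge_min lexx orbT andbT; lra.
Qed.

Lemma trunc_id M x : `|x| <= M -> trunc M x = x.
Proof.
rewrite ler_norml => /andP[h1 h2]; rewrite /trunc (min_idPl h2).
exact/max_idPr.
Qed.

Lemma trunc_dist M x : 0 <= M -> `|x - trunc M x| <= `|x|.
Proof.
move=> M0; rewrite /trunc; case: (leP x M) => h1.
  case: (leP (- M) x) => h2; first by rewrite subrr normr0.
  by rewrite opprK !ler0_norm; lra.
case: (leP (- M) M) => h2; last by lra.
by rewrite !ger0_norm; lra.
Qed.

Lemma trunc_lip M x y : 0 <= M -> `|trunc M x - trunc M y| <= `|x - y|.
Proof.
move=> M0; wlog xy : x y / x <= y.
  move=> hw; case/orP: (le_total x y) => h; first exact: hw.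
  by rewrite distrC [`|x - y|]distrC hw.
rewrite [`|x - y|]distrC (@ger0_norm _ (y - x)) ?subr_ge0 // distrC /trunc.
case: (leP y M) => h1; case: (leP x M) => h2; try lra;
  case: (leP (- M) y) => h3; case: (leP (- M) x) => h4; try case: (leP (-M) M) => h5;
  rewrite ?ler_norml; lra.
Qed.

Lemma continuous_trunc M v : 0 <= M -> continuous v -> continuous (fun x => trunc M (v x)).
Proof.
move=> M0 cv x; apply/cvgrPdist_le => e e0.
have /cvgrPdist_le /(_ e e0) := cv x.
by apply: filterS => t ht; apply: le_trans ht; exact: trunc_lip.
Qed.

Lemma L2_continuous v : continuous v -> L2 v.
Proof.
move=> cv; have cw : {within `[(0 : R), 1], continuous v} by exact: continuous_subspaceT.
have cw2 : {within `[(0 : R), 1], continuous (fun x => v x ^+ 2)}.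
  by apply: continuous_subspaceT => x; apply: continuousM; exact: cv.
split; first by apply: measurable_funTS; exact: continuous_measurable_fun.
by apply: continuous_compact_integrable => //; exact: segment_compact.
Qed.

Lemma L2_trunc M u : 0 <= M -> measurable_fun D01 u -> L2 (fun x => trunc M (u x)).
Proof.
move=> M0 mu_; apply: (@L2_bounded _ _ M); last by move=> x _; exact: trunc_le.
apply: measurable_maxr => //; apply: measurable_minr => //.
Qed.

Lemma L2_trunc_approx u (e : R) : L2 u -> 0 < e ->
  exists2 M, 0 <= M & I01 (fun x => (u x - trunc M (u x)) ^+ 2) <= e.
Proof.
move=> hu e0.
have hd n : L2 (fun x => u x - trunc n%:R (u x)).
  by apply: (sqB M1) => //; apply: L2_trunc; case: hu.
have := @dominated_convergence _ _ _ mu D01 M1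
  (fun n x => ((u x - trunc n%:R (u x)) ^+ 2)%:E) (fun=> 0%E) (fun x => (u x ^+ 2)%:E).
case.
- by move=> n; apply/measurable_EFinP; apply: measurable_funX; case: (hd n).
- exact: measurable_cst.
- apply: nearW => x _.
  apply: cvg_near_cst; exists (Num.trunc `|u x|).+1 => // n /= hn.
  have h : `|u x| <= n%:R.
    apply: le_trans (ltW (Num.Theory.truncnS_gt _)) _; by rewrite ler_nat.
  by rewrite trunc_id // subrr expr0n.
- by case: hu.
- apply: nearW => x n _ /=; rewrite lee_fin normrX -(real_normK (num_real (u x))).
  by rewrite lerXn2r ?nnegrE // trunc_dist.
move=> _ _; rewrite integral0 => h.
have /fine_cvg /= : (fun n => \int[mu]_(x in D01) ((u x - trunc n%:R (u x)) ^+ 2)%:E)%E @ \oo --> (0 : R)%:E by exact: h.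
move=> /cvgrPdist_le /(_ e e0) [N _ hN]; exists N%:R => //.
have := hN N (leqnn N); rewrite sub0r normrN => h1.
exact: le_trans (ler_norm _) h1.
Qed.

(** Continuous approximation is taken in L1. Clipping [u] and the approximant at the same height [M]
    turns it into L2, since for values bounded by [M] the squared difference is at most [2 * M]
    times the difference. *)
Lemma continuous_L2_dense u (e : R) : L2 u -> 0 < e ->
  exists2 v, continuous v & I01 (fun x => (u x - v x) ^+ 2) <= e.
Proof.
move=> hu e0; have e4 : 0 < e / 4 by rewrite divr_gt0.
have [M M0 hM] := L2_trunc_approx hu e4.
have hT := L2_trunc M0 (proj1 hu).
have fin : (mu D01 < +oo)%E by rewrite [X in (X < _)%E]U1 ltry.
have [g [cg ig hg]] := approximation_continuous_integrable M1 fin (sq_intg M1 U1 hT).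
have /fine_cvg /= hg' : (fun n => \int[mu]_(x in D01) `|(trunc M (u x) - g n x)%:E|)%E @ \oo --> (0 : R)%:E by exact: hg.
have e5 : 0 < e / (8 * (M + 1)) by rewrite divr_gt0 // mulr_gt0 // ltr_wpDl.
move/cvgrPdist_le: hg' => /(_ _ e5) [N _ /(_ N (leqnn N))]; rewrite sub0r normrN => hN.
have {}hN : I01 (fun x => `|trunc M (u x) - g N x|) <= e / (8 * (M + 1)).
  exact: le_trans (ler_norm _) hN.
pose v x := trunc M (g N x); have cv : continuous v by exact: continuous_trunc.
exists v => //; have hv := L2_continuous cv.
have h1 : L2 (fun x => u x - trunc M (u x)) by apply: (sqB M1).
have h2 : L2 (fun x => trunc M (u x) - v x) by apply: (sqB M1).
have hgi : intg mu D01 (fun x => trunc M (u x) - g N x).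
  by apply: (intgB M1); [exact: (sq_intg M1 U1 hT)|exact: ig].
apply: (@le_trans _ _ (I01 (fun x => 2 * (u x - trunc M (u x)) ^+ 2
   + 4 * M * `|trunc M (u x) - g N x|))).
  apply: (le_I M1); first by case: (sqB M1 hu hv).
    by apply: (intgD M1); apply: (intgZ M1); [case: h1|exact: intg_norm].
  move=> x _; have hac := trunc_lip (trunc M (u x)) (g N x) M0; have ha := trunc_le (u x) M0.
  rewrite (trunc_id ha) -/(v x) in hac.
  have hc := trunc_le (g N x) M0; rewrite -/(v x) in hc.
  move: hac ha hc; set a := trunc M (u x); set c := v x => hac ha hc.
  have : (a - c) ^+ 2 <= 2 * M * `|a - g N x|.
    rewrite -(real_normK (num_real (a - c))) expr2.
    have : `|a - c| <= 2 * M.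
      by rewrite (le_trans (ler_normB _ _)) // mulr_natl mulr2n lerD.
    have := normr_ge0 (a - c); nra.
  have := sqr_ge0 ((u x - a) - (a - c)); nra.
rewrite (I_D M1); last 2 first.
- by apply: (intgZ M1); case: h1.
- by apply: (intgZ M1); exact: intg_norm.
rewrite (I_Z M1); last by case: h1.
rewrite (I_Z M1); last exact: intg_norm.
have h3 : 4 * M * I01 (fun x => `|trunc M (u x) - g N x|) <= e / 2.
  have -> : e / 2 = 4 * (M + 1) * (e / (8 * (M + 1))).
    by field; rewrite lt0r_neq0 // ltr_wpDl.
  apply: ler_pM => //; [by rewrite mulr_ge0|by apply: I_ge0|].
  by rewrite ler_wpM2l // lerDl.
have -> : e = 2 * (e / 4) + e / 2 by field.
by apply: lerD => //; rewrite ler_wpM2l.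
Qed.

(** For continuous [v] the variance on short intervals is small by uniform continuity; the remainder
    [u - v] costs at most its L2 norm at every level. *)
Lemma vr_cvg u (e : R) : L2 u -> 0 < e -> exists N, forall n, (N <= n)%N -> vr n u <= e.
Proof.
move=> hu e0; have e4 : 0 < e / 4 by rewrite divr_gt0.
have [v cv hv] := continuous_L2_dense hu e4.
have s0 : 0 < Num.sqrt (e / 4) by rewrite sqrtr_gt0.
have [N hN] := unif_osc cv s0; exists N => n Nn.
have Lv := L2_continuous cv; have Ld := sqB M1 hu Lv.
have h1 := vr_comb n hu Lv; have h2 := le_trans (vr_le n Ld) hv.
have h3 := vr_osc Lv (fun x y => hN n x y Nn); rewrite (sqr_sqrtr (ltW e4)) in h3.
apply: le_trans h1 _; have -> : e = 2 * (e / 4) + 2 * (e / 4) by field.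
by apply: lerD; rewrite ler_wpM2l.
Qed.

End DyadicVariance.

Lemma sqr_le_split (R : realFieldType) (a b B C : R) :
  (a - b) ^+ 2 <= B -> b ^+ 2 <= C -> a ^+ 2 <= 2 * B + 2 * C.
Proof. by move=> h1 h2; have := sqr_ge0 ((a - b) - b); lra. Qed.

(** * Sobolev spaces *)

Section SobolevSpace.
Context (R : realType) (m : nat).
Hypothesis hm : (2 <= m)%N.
Implicit Types (f g : R -> R) (D E : nat -> R -> R).

Notation mu := (@lebesgue_measure R).
Notation D01 := (`[0%R, 1%R]%classic : set R).
Notation I01 := (I mu D01).
Notation L2 := (sq mu D01).
Let M1 : measurable (D01 : set (measurableTypeR R)) := @m01 R.
Let U1 : mu D01 = 1%E := @mu01 R.
Let hm1 : (1 <= m)%N. Proof. exact: ltnW. Qed.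
Let mP : m.-1.+1 = m. Proof. by rewrite prednK. Qed.
Let mPlt : (m.-1 < m)%N. Proof. by rewrite mP. Qed.
Let in0 : 0 <= (0 : R) <= 1. Proof. by rewrite lexx ler01. Qed.
Let in1 : 0 <= (1 : R) <= 1. Proof. by rewrite lexx ler01. Qed.

Lemma I_sqr_ge0 f : 0 <= I01 (fun t => f t ^+ 2).
Proof. by apply: I_ge0 => t _; exact: sqr_ge0. Qed.

Lemma chain_int f D l : sob_chain m f D -> (l < m)%N -> I01 (D l.+1) = D l 1 - D l 0.
Proof. by move=> hD lm; rewrite (chain_int0x hD lm in1) int0x1 addrC addKr. Qed.

Lemma int0x_diff_le u x y (M : R) : 0 <= x -> x <= y -> y <= 1 -> intg mu D01 u ->
  (forall t, x <= t <= y -> `|u t| <= M) -> `|int0x y u - int0x x u| <= M * (y - x).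
Proof.
move=> x0 xy y1 hu hM.
have hx : 0 <= x <= 1 by lra.
have hy : 0 <= y <= 1 by lra.
rewrite !int0xE // -(I_B M1); [|exact: intg_le_ind..].
have hd : intg mu D01 (fun t => ind y t * u t - ind x t * u t).
  by apply: (intgB M1); exact: intg_le_ind.
have hs z : intg mu D01 (ind z) := sq_intg M1 U1 (sq_le_ind z).
rewrite (le_trans (le_norm_I M1 hd)) //.
have -> : y - x = I01 (ind y) - I01 (ind x) by rewrite !I_le_ind.
rewrite -(I_B M1) // -(I_Z M1); last exact: (intgB M1).
apply: (le_I M1); [exact: intg_norm|exact/(intgZ M1)/(intgB M1)|].
move=> t _; rewrite -mulrBl normrM mulrC /ind.
case: (leP t x) => [tx|xt]; first by rewrite (le_trans tx xy) subrr normr0 !mulr0.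
rewrite subr0; case: (leP t y) => ty; last by rewrite normr0 !mulr0.
by rewrite normr1 !mulr1 hM // ltW.
Qed.

(** The (k+1)-th derivative is Hölder of order 1/2 with the L2 norm of the next one as constant, so
    a difference quotient approximates it at that rate, uniformly over norm balls. *)
Lemma chain_quot f D k x y : sob_chain m f D -> (k.+1 < m)%N -> 0 <= x <= 1 -> 0 <= y <= 1 ->
  x != y ->
  (D k.+1 x - (D k y - D k x) / (y - x)) ^+ 2 <= `|y - x| * I01 (fun t => D k.+2 t ^+ 2).
Proof.
move=> hD km hx hy xy.
set C := I01 _; have C0 : 0 <= C := I_sqr_ge0 _.
have yx0 : y - x != 0 by rewrite subr_eq0 eq_sym.
pose u t := D k.+1 t - D k.+1 x.
have hu : intg mu D01 u.
  apply: (intgB M1); last exact: intg_cst.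
  exact: (sq_intg M1 U1 (chain_sq hm hD (ltnW km))).
have e z : 0 <= z <= 1 -> D k z = D k 0 + int0x z u + z * D k.+1 x.
  move=> hz; rewrite (chain_int0x hD (ltnW km) hz) -addrA; congr (_ + _).
  have hs : intg mu D01 (ind z) := sq_intg M1 U1 (sq_le_ind z).
  have -> : z * D k.+1 x = I01 (fun t => D k.+1 x * ind z t).
    by rewrite (I_Z M1) // I_le_ind // mulrC.
  rewrite !int0xE // -(I_D M1).
  - by apply: eq_I => t _; rewrite /u; ring.
  - exact: intg_le_ind.
  - exact: (intgZ M1).
have key a b : 0 <= a -> a <= b -> b <= 1 -> (a = x \/ b = x) ->
    `|int0x b u - int0x a u| <= Num.sqrt ((b - a) * C) * (b - a).
  move=> a0 ab b1 hab; apply: int0x_diff_le => // t ht.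
  have ht1 : 0 <= t <= 1 by lra.
  rewrite -sqrtr_sqr ler_wsqrtr // (le_trans (chain_diff_sqr hm hD km hx ht1)) //.
  rewrite ler_wpM2r // ler_norml; case: hab => ?; subst; lra.
have q1 : (D k.+1 x - (D k y - D k x) / (y - x)) = - ((int0x y u - int0x x u) / (y - x)).
  by rewrite (e y hy) (e x hx); field.
rewrite q1 sqrrN expr_div_n.
have h2 : `|int0x y u - int0x x u| <= Num.sqrt (`|y - x| * C) * `|y - x|.
  case/orP: (le_total x y) => h.
    by rewrite (ger0_norm (_ : 0 <= y - x)) ?subr_ge0 //; apply: key; [lra|by []|lra|left].
  rewrite [`|y - x|]distrC [`|int0x y u - _|]distrC (ger0_norm (_ : 0 <= x - y)) ?subr_ge0 //.
  by apply: key; [lra|by []|lra|right].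
rewrite ler_pdivrMr ?exprn_even_gt0 //.
rewrite -(real_normK (num_real (int0x y u - _))) -(real_normK (num_real (y - x))).
rewrite (@le_trans _ _ ((Num.sqrt (`|y - x| * C) * `|y - x|) ^+ 2)) //.
  by rewrite lerXn2r ?nnegrE ?mulr_ge0 ?sqrtr_ge0.
by rewrite exprMn sqr_sqrtr ?mulr_ge0.
Qed.

Lemma step_in01 x (e : R) : 0 <= x <= 1 -> 0 < e -> exists y,
  [/\ 0 <= y <= 1, x != y & `|y - x| <= e].
Proof.
move=> hx e0; pose d := Num.min e 2^-1.
have d0 : 0 < d by rewrite /d lt_min e0 /= invr_gt0 ltr0n.
have de : d <= e by rewrite /d ge_min lexx.
have d2 : d <= 2^-1 by rewrite /d ge_min lexx orbT.
case: (leP x 2^-1) => h.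
  exists (x + d); split; [lra| |by rewrite addrC addKr (ger0_norm (ltW d0))].
  by rewrite lt_eqF // ltrDl.
exists (x - d); split; [lra| |by rewrite addrC addKr normrN (ger0_norm (ltW d0))].
by rewrite gt_eqF // gtrDl oppr_lt0.
Qed.

Lemma small_sqr_eq0 (a C : R) : 0 <= C -> (forall e, 0 < e -> a ^+ 2 <= e * C) -> a = 0.
Proof.
move=> C0 h; apply/eqP; rewrite -sqrf_eq0 eq_le sqr_ge0 andbT leNgt; apply/negP => a0.
have d0 : 0 < a ^+ 2 / (2 * (C + 1)) by rewrite divr_gt0 // mulr_gt0 // ltr_wpDl.
have := h _ d0; apply/negP; rewrite -ltNge mulrAC ltr_pdivrMr ?mulr_gt0 ?ltr_wpDl //.
by rewrite ltr_pM2l //; lra.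
Qed.

(** Below order [m] every derivative is a limit of vanishing difference quotients. For the top one,
    all increments of [D m.-1] are zero, so [vr N (D m)] is its full L2 norm for every [N], while it
    tends to 0. *)
Lemma chain0_eq0 D : sob_chain m (fun=> 0) D ->
  (forall k x, (k < m)%N -> 0 <= x <= 1 -> D k x = 0) /\ I01 (fun t => D m t ^+ 2) = 0.
Proof.
move=> hD; have h k x : (k < m)%N -> 0 <= x <= 1 -> D k x = 0.
  elim: k x => [|k IH] x km hx; first by case: hD => ->.
  apply: (small_sqr_eq0 (I_sqr_ge0 (D k.+2))) => e e0.
  have [y [hy xy hxy]] := step_in01 hx e0.
  have := chain_quot hD km hx hy xy.
  rewrite !IH ?(ltnW km) // subrr mul0r subr0 => /le_trans; apply.
  by rewrite ler_wpM2r // I_sqr_ge0.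
split=> //; apply/eqP; rewrite eq_le I_sqr_ge0 andbT.
apply/ler_addgt0Pr => e e0; rewrite add0r.
have [N hN] := vr_cvg (chain_sq hm hD (leqnn m)) e0.
apply: le_trans (hN N (leqnn N)).
have hF x : 0 <= x <= 1 -> D m.-1 x = D m.-1 0 + int0x x (D m).
  by move=> hx; rewrite (chain_int0x hD mPlt hx) mP.
rewrite (vrE N (chain_sq hm hD (leqnn m)) hF) big1 ?mulr0 ?subr0 // => w _.
by have [a [b [ha hb ->]]] := dltE R w; rewrite !h // subrr expr0n.
Qed.

Lemma chain_uniq f D E : sob_chain m f D -> sob_chain m f E ->
  (forall k x, (k < m)%N -> 0 <= x <= 1 -> D k x = E k x) /\
  I01 (fun t => (D m t - E m t) ^+ 2) = 0.
Proof.
move=> hD hE; have := chainD hm (-1) hD hE.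
rewrite (_ : (fun t => f t + -1 * f t) = (fun=> 0)); last by apply/funext => t; ring.
move=> /chain0_eq0 [h1 h2]; split.
  by move=> k x km hx; have := h1 k x km hx; rewrite mulN1r => /subr0_eq.
by rewrite -[RHS]h2; apply: eq_I => t _; rewrite mulN1r.
Qed.

Lemma sobDP f : Sob1 m f -> sob_chain m f (sobD m f).
Proof.
move=> h; rewrite /sobD; case: pselect => [H|//].
by case: (cid H).
Qed.

Lemma I_mul_eq0 f g : L2 f -> L2 g -> I01 (fun t => f t ^+ 2) = 0 -> I01 (fun t => f t * g t) = 0.
Proof.
move=> hf hg h0; have := I_cauchy M1 hf hg; rewrite h0 mul0r => h.
by apply/eqP; rewrite -sqrf_eq0 eq_le h sqr_ge0.
Qed.

Definition ipc D E : R := \sum_(1 <= l < m) I01 (D l) * I01 (E l) + I01 (fun t => D m t * E m t).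

(** The chain picked by [sobD] is arbitrary: two chains agree below order [m], and their top members
    differ by a function of zero L2 norm, which the integrals in [ip1] do not see. *)
Lemma ip1E f g D E : sob_chain m f D -> sob_chain m g E -> ip1 m f g = ipc D E.
Proof.
move=> hD hE.
have hf := sobDP (ex_intro _ _ hD); have hg := sobDP (ex_intro _ _ hE).
have [u1 z1] := chain_uniq hf hD; have [u2 z2] := chain_uniq hg hE.
have e l (f0 : R -> R) (A B : nat -> R -> R) :
   (forall k x, (k < m)%N -> 0 <= x <= 1 -> A k x = B k x) -> (l < m)%N -> I01 (A l) = I01 (B l).
  by move=> h lm; apply: eq_I => t /D01P ht; exact: h.
rewrite /ip1 /ipc; congr (_ + _).
  by apply: eq_big_nat => l /andP[_ lm]; congr (_ * _); apply: e.
have s1 := chain_sq hm hf (leqnn m); have s2 := chain_sq hm hg (leqnn m).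
have t1 := chain_sq hm hD (leqnn m); have t2 := chain_sq hm hE (leqnn m).
have h1 := I_mul_eq0 (sqB M1 s1 t1) s2 z1.
have h2 := I_mul_eq0 (sqB M1 s2 t2) t1 z2.
transitivity (I01 (fun t => (sobD m f m t - D m t) * sobD m g m t) +
   I01 (fun t => (sobD m g m t - E m t) * D m t) + I01 (fun t => D m t * E m t)); last first.
  by rewrite h1 h2 !add0r.
rewrite -(I_D M1); [|by apply: (sqM M1) => //; exact: (sqB M1)..].
rewrite -(I_D M1); [|by apply: (intgD M1); apply: (sqM M1) => //; exact: (sqB M1)|exact: (sqM M1)].
by apply: eq_I => t _; ring.
Qed.

Lemma Sob0_chain f : Sob0 m f -> sob_chain m f (sobD m f).
Proof. by move=> [/sobDP]. Qed.

Lemma Sob0_L2 f : Sob0 m f -> L2 f.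
Proof. by move=> /Sob0_chain h; have := chain_sq hm h (leq0n m); case: h => ->. Qed.

Lemma Sob0_comb f g c : Sob0 m f -> Sob0 m g -> Sob0 m (fun t => f t + c * g t).
Proof.
move=> hf hg; split.
  by exists (fun k t => sobD m f k t + c * sobD m g k t); apply: chainD => //; exact: Sob0_chain.
have fi := sq_intg M1 U1 (Sob0_L2 hf); have gi := sq_intg M1 U1 (Sob0_L2 hg).
rewrite [int01 _](I_D M1) //; last exact: (intgZ M1).
have zf : I01 f = 0 := proj2 hf; have zg : I01 g = 0 := proj2 hg.
by rewrite (I_Z M1) // zf zg mulr0 addr0.
Qed.

Lemma ip1C f g : ip1 m f g = ip1 m g f.
Proof.
rewrite /ip1; congr (_ + _); first by apply: eq_bigr => l _; rewrite mulrC.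
by apply: eq_I => t _; rewrite mulrC.
Qed.

Lemma ip1_combl f g h c : Sob0 m f -> Sob0 m g -> Sob0 m h ->
  ip1 m (fun t => f t + c * g t) h = ip1 m f h + c * ip1 m g h.
Proof.
move=> hf hg hh; have cf := Sob0_chain hf; have cg := Sob0_chain hg; have ch := Sob0_chain hh.
rewrite (ip1E (chainD hm c cf cg) ch) (ip1E cf ch) (ip1E cg ch) /ipc.
have s k (f' : R -> R) D : sob_chain m f' D -> (k <= m)%N -> L2 (D k) by move=> h' km; exact: (chain_sq hm h').
rewrite mulrDr addrACA; congr (_ + _).
  rewrite mulr_sumr -big_split /=; apply: eq_big_nat => l /andP[_ lm].
  have i1 : intg mu D01 (sobD m f l) := sq_intg M1 U1 (s _ _ _ cf (ltnW lm)).
  have i2 : intg mu D01 (sobD m g l) := sq_intg M1 U1 (s _ _ _ cg (ltnW lm)).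
  by rewrite (I_D M1) ?(I_Z M1) //; [ring|exact: (intgZ M1)].
have h1 : intg mu D01 (fun t => sobD m f m t * sobD m h m t) := sqM M1 (s _ _ _ cf (leqnn m)) (s _ _ _ ch (leqnn m)).
have h2 : intg mu D01 (fun t => sobD m g m t * sobD m h m t) := sqM M1 (s _ _ _ cg (leqnn m)) (s _ _ _ ch (leqnn m)).
rewrite -(I_Z M1) // -(I_D M1) //; last exact: (intgZ M1).
by apply: eq_I => t _; ring.
Qed.

Lemma ip1_ge f l : (1 <= l < m)%N -> I01 (sobD m f l) ^+ 2 <= ip1 m f f.
Proof.
move=> hl; rewrite /ip1 (bigD1_seq l) ?iota_uniq ?mem_index_iota //= -expr2 -addrA lerDl.
rewrite addr_ge0 //; first by apply: sumr_ge0 => i _; rewrite -expr2 sqr_ge0.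
by apply: I_ge0 => t _; rewrite -expr2 sqr_ge0.
Qed.

Lemma ip1_ge_top f : I01 (fun t => sobD m f m t ^+ 2) <= ip1 m f f.
Proof.
rewrite /ip1 -[leLHS]add0r lerD //.
by apply: sumr_ge0 => i _; rewrite -expr2 sqr_ge0.
Qed.

Lemma ip1_ge0 f : 0 <= ip1 m f f.
Proof. exact: le_trans (I_sqr_ge0 _) (ip1_ge_top f). Qed.

(** Downward induction from order [m.-1]: a derivative differs from its mean by at most the L2 norm
    of the next one, and the mean is a term of the inner product. *)
Lemma sob_sup k : (k < m)%N -> exists2 C : R, 0 <= C & forall f x, Sob0 m f -> 0 <= x <= 1 ->
  sobD m f k x ^+ 2 <= C * ip1 m f f.
Proof.
move=> km; suff h j : (j < m)%N -> exists2 C : R, 0 <= C & forall f x, Sob0 m f -> 0 <= x <= 1 ->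
  sobD m f (m.-1 - j)%N x ^+ 2 <= C * ip1 m f f.
  have [|C C0 hC] := h (m.-1 - k)%N; first by rewrite (leq_ltn_trans (leq_subr _ _)).
  by exists C => // f x hf hx; have := hC f x hf hx; rewrite subKn // -ltnS mP.
have key i f x (B : R) : Sob0 m f -> (i < m)%N -> 0 <= x <= 1 ->
    I01 (fun t => sobD m f i.+1 t ^+ 2) <= B -> sobD m f i x ^+ 2 <= 2 * B + 2 * ip1 m f f.
  move=> hf im hx hB; have hD := Sob0_chain hf.
  have B0 : 0 <= B := le_trans (I_sqr_ge0 _) hB.
  set D := sobD m f in hD hB *.
  have si := chain_sq hm hD (ltnW im); have ii := sq_intg M1 U1 si.
  have h1 : (D i x - I01 (D i)) ^+ 2 <= B.
    have hd : L2 (fun t => D i x - D i t) by apply: (sqB M1) => //; exact: sq_cst.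
    have -> : D i x - I01 (D i) = I01 (fun t => D i x - D i t).
      by rewrite (I_B M1) // ?(I_cst M1 U1) //; exact: intg_cst.
    apply: le_trans (I_sqr_le M1 U1 hd) _; apply: le_I_cst; first by case: hd.
    move=> t ht; apply: le_trans (chain_diff_sqr hm hD im ht hx) _.
    apply: le_trans hB; rewrite ler_piMl ?I_sqr_ge0 // ler_norml; lra.
  have h2 : I01 (D i) ^+ 2 <= ip1 m f f.
    case: i im {hB si ii h1} => [|i] im; last exact: ip1_ge.
    (* The inner product contains no mean of order 0; the centring in [Sob0] supplies it. *)
    have -> : I01 (D 0%N) = 0 by case: hD => ->; case: hf.
    by rewrite expr0n /= ip1_ge0.
  exact: sqr_le_split h1 h2.
elim: j => [|j IH] jm.
  exists 4 => // f x hf hx; rewrite subn0.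
  have := key _ f x (ip1 m f f) hf mPlt hx; rewrite mP => /(_ (ip1_ge_top f)); lra.
have [C C0 hC] := IH (ltnW jm).
exists (2 * C + 2); first by rewrite addr_ge0 // mulr_ge0.
move=> f x hf hx; have kE : (m.-1 - j)%N = (m.-1 - j.+1).+1.
  by rewrite -subSn ?subSS // -ltnS mP.
have im : (m.-1 - j.+1 < m)%N by rewrite (leq_ltn_trans (leq_subr _ _)).
rewrite mulrDl -mulrA; apply: key => //; rewrite -kE.
apply: le_I_cst; first by case: (chain_sq hm (Sob0_chain hf) (leq_trans (leq_subr j _) (ltnW mPlt))).
by move=> t; exact: hC.
Qed.

Lemma sob_sup0 : exists2 C : R, 0 <= C & forall f x, Sob0 m f -> 0 <= x <= 1 ->
  f x ^+ 2 <= C * ip1 m f f.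
Proof.
have [C C0 hC] := sob_sup hm1; exists C => // f x hf hx.
by have := hC f x hf hx; case: (Sob0_chain hf) => ->.
Qed.

Lemma l2ip_le : exists2 C : R, 0 <= C & forall f, Sob0 m f -> l2ip f f <= C * ip1 m f f.
Proof.
have [C C0 hC] := sob_sup0; exists C => // f hf.
have [_ h2] := Sob0_L2 hf.
have -> : l2ip f f = I01 (fun t => f t ^+ 2) by apply: eq_I => t _; rewrite expr2.
by apply: le_I_cst => // x; exact: hC.
Qed.

(** Level 0 is paid by the L2 norm, the other levels by the top derivative, hence the constant
    [C + 4 ^+ m]. *)
Lemma frame_bound (q : nat -> {poly R}) : orthobasis m.+1 q -> exists2 C : R, 0 <= C &
  forall n f, Sob0 m f ->
    \sum_(0 <= i < n.+1) (4 ^+ m / 2) ^+ i * \sum_(w <- words i) lsq m.+1 q f w <= C * ip1 m f f.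
Proof.
move=> qb; have [C C0 hC] := l2ip_le; exists (C + 4 ^+ m).
  by rewrite addr_ge0 // exprn_ge0.
move=> n f hf; rewrite big_ltn // expr0 mul1r big_seq1 mulrDl; apply: lerD.
  apply: le_trans (hC f hf); apply: le_trans (bessel qb (Sob0_L2 hf)) _.
  by rewrite le_eqVlt; apply/orP; left; apply/eqP/eq_I => t _; rewrite expr2.
have := energy_le hm qb n (Sob0_chain hf); rewrite /energy => h.
have h4 : (0 : R) <= 4 ^+ m by rewrite exprn_ge0.
apply: (@le_trans _ _ (4 ^+ m * I01 (fun t => sobD m f m t ^+ 2))); last first.
  by rewrite ler_wpM2l // ip1_ge_top.
apply: le_trans (le_trans _ h) _; first by rewrite lerDl mulr_ge0 // I_sqr_ge0.
by rewrite ler_wpM2l // gerBl sqr_ge0.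
Qed.

Implicit Types (nu th : (R -> R) -> R).

Definition linS nu := forall f g c, Sob0 m f -> Sob0 m g ->
  nu (fun t => f t + c * g t) = nu f + c * nu g.

Definition bndS nu := exists2 C : R, 0 <= C & forall f, Sob0 m f -> nu f ^+ 2 <= C * ip1 m f f.

(* continuity for pointwise convergence on norm-bounded sets: limits in operator
   norm of finite combinations of point evaluations *)
Definition ptl nu := forall e : R, 0 < e -> exists2 s : seq (R * R),
  (forall p, p \in s -> 0 <= p.2 <= 1) &
  forall f, Sob0 m f -> (nu f - \sum_(p <- s) p.1 * f p.2) ^+ 2 <= e * ip1 m f f.

Definition regS nu := [/\ linS nu, bndS nu & ptl nu].

Lemma regS_comb nu th c : regS nu -> regS th -> regS (fun f => nu f + c * th f).
Proof.
move=> [l1 [C1 C10 b1] p1] [l2 [C2 C20 b2] p2]; split.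
- by move=> f g a hf hg; rewrite l1 // l2 //; ring.
- exists (2 * C1 + 2 * c ^+ 2 * C2).
    apply: addr_ge0; first exact: mulr_ge0.
    by apply: mulr_ge0 => //; apply: mulr_ge0 => //; exact: sqr_ge0.
  move=> f hf; have := b1 f hf; have := b2 f hf.
  have := sqr_ge0 (nu f - c * th f); have := sqr_ge0 c => c2 h1 h2 h3.
  have : c ^+ 2 * th f ^+ 2 <= c ^+ 2 * (C2 * ip1 m f f) by rewrite ler_wpM2l.
  nra.
- move=> e e0; have e4 : 0 < e / 4 by rewrite divr_gt0.
  have ec : 0 < e / (4 * (c ^+ 2 + 1)) by rewrite divr_gt0 // mulr_gt0 // ltr_wpDl ?sqr_ge0.
  have [s1 hs1 k1] := p1 _ e4; have [s2 hs2 k2] := p2 _ ec.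
  exists (s1 ++ [seq (c * p.1, p.2) | p <- s2]).
    move=> p; rewrite mem_cat => /orP[/hs1//|/mapP[p' /hs2 h ->]]; exact: h.
  move=> f hf; have := k1 f hf; have := k2 f hf.
  rewrite big_cat big_map /=.
  have -> : \sum_(p <- s2) c * p.1 * f p.2 = c * \sum_(p <- s2) p.1 * f p.2.
    by rewrite mulr_sumr; apply: eq_bigr => p _; rewrite mulrA.
  set a := \sum_(_ <- s1) _; set b := \sum_(_ <- s2) _ => h2 h1.
  have : c ^+ 2 * (th f - b) ^+ 2 <= (e / 4) * ip1 m f f.
    apply: le_trans (ler_wpM2l (sqr_ge0 c) h2) _.
    rewrite mulrA ler_wpM2r ?ip1_ge0 // mulrA ler_pdivrMr ?mulr_gt0 ?ltr_wpDl ?sqr_ge0 //.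
    by have := sqr_ge0 c; nra.
  have := sqr_ge0 ((nu f - a) - c * (th f - b)); nra.
Qed.

Lemma regSZ nu c : regS nu -> regS (fun f => c * nu f).
Proof.
move=> h; have := regS_comb (c - 1) h h.
by rewrite (_ : (fun f => _) = (fun f => c * nu f)) //; apply/funext => f; ring.
Qed.

(** A derivative evaluation is, up to an error small in operator norm, a difference quotient of
    evaluations of one order less, to which the induction applies. *)
Lemma regS_ev k x : (k < m)%N -> 0 <= x <= 1 -> regS (fun f => sobD m f k x).
Proof.
elim: k x => [|k IH] x km hx.
  split.
  - move=> f g c hf hg /=.
    by rewrite !(proj1 (Sob0_chain _)) //; exact: Sob0_comb.
  - have [C C0 hC] := sob_sup0; exists C => // f hf.
    by rewrite (proj1 (Sob0_chain hf)); exact: hC.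
  - move=> e e0; exists [:: (1, x)] => [p|f hf]; first by rewrite inE => /eqP ->.
    rewrite big_seq1 mul1r (proj1 (Sob0_chain hf)) subrr expr0n /= mulr_ge0 ?ip1_ge0 //.
    exact: ltW.
split.
- move=> f g c hf hg.
  have [h _] := chain_uniq (Sob0_chain (Sob0_comb c hf hg)) (chainD hm c (Sob0_chain hf) (Sob0_chain hg)).
  by rewrite h.
- have [C C0 hC] := sob_sup km; exists C => // f hf; exact: hC.
- move=> e e0.
  have [C C0 hC] : exists2 C : R, 0 <= C & forall f, Sob0 m f ->
      I01 (fun t => sobD m f k.+2 t ^+ 2) <= C * ip1 m f f.
    move: km; rewrite leq_eqVlt => /predU1P[->|km].
      by exists 1 => // f _; rewrite mul1r ip1_ge_top.
    have [C C0 hC] := sob_sup km; exists C => // f hf.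
    apply: le_I_cst; first by case: (chain_sq hm (Sob0_chain hf) (ltnW km)).
    by move=> t; exact: hC.
  (* Step length for which the quotient costs [e / 4] of the squared norm; a further [e / 4]
     replaces the quotient by point evaluations, and [sqr_le_split] doubles both. *)
  have eC : 0 < e / (4 * (C + 1)) by rewrite divr_gt0 // mulr_gt0 // ltr_wpDl.
  have [y [hy xy hxy]] := step_in01 hx eC.
  pose th f := (- (y - x)^-1) * sobD m f k x + 1 * ((y - x)^-1 * sobD m f k y).
  have [_ _ rth] : regS th := regS_comb 1 (regSZ (- (y - x)^-1) (IH x (ltnW km) hx))
    (regSZ (y - x)^-1 (IH y (ltnW km) hy)).
  have e4 : 0 < e / 4 by rewrite divr_gt0.
  have [s hs k1] := rth _ e4; exists s => // f hf.
  have h1 := k1 f hf.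
  have h2 : (sobD m f k.+1 x - th f) ^+ 2 <= e / 4 * ip1 m f f.
    have -> : th f = (sobD m f k y - sobD m f k x) / (y - x) by rewrite /th; ring.
    apply: le_trans (chain_quot (Sob0_chain hf) km hx hy xy) _.
    apply: le_trans (ler_pM (normr_ge0 _) (I_sqr_ge0 _) hxy (hC f hf)) _.
    rewrite mulrA ler_wpM2r ?ip1_ge0 //.
    have -> : e / 4 = e / (4 * (C + 1)) * (C + 1) by field; rewrite lt0r_neq0 // ltr_wpDl.
    by rewrite ler_wpM2l ?(ltW eC) // lerDl.
  have -> : e * ip1 m f f = 2 * (e / 4 * ip1 m f f) + 2 * (e / 4 * ip1 m f f) by field.
  by apply: sqr_le_split h1; rewrite opprB addrA subrK.
Qed.

End SobolevSpace.

(** * Tensor products *)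

Section PositiveSemidefinite.
Context (R : realType) (n : nat).
Notation mu := (@lebesgue_measure R).
Notation D01 := (`[0%R, 1%R]%classic : set R).
Implicit Types (M A B : 'I_n -> 'I_n -> R).

Definition psd M := forall t : 'I_n -> R, 0 <= \sum_i \sum_j t i * t j * M i j.

Definition hmul M A : 'I_n -> 'I_n -> R := fun i j => M i j * A i j.

(* By Schur's product theorem every Gram matrix is good; unlike positivity,
   this is visibly stable under tensor products. *)
Definition good A := forall M, psd M -> psd (hmul M A).

Lemma eq_psd M A : (forall i j, M i j = A i j) -> psd M -> psd A.
Proof.
move=> h hM t; have := hM t; congr (0 <= _).
by apply: eq_bigr => i _; apply: eq_bigr => j _; rewrite h.
Qed.

Lemma eq_good A B : (forall i j, A i j = B i j) -> good A -> good B.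
Proof. by move=> h hA M /hA; apply: eq_psd => i j; rewrite /hmul h. Qed.

Lemma psdD M A : psd M -> psd A -> psd (fun i j => M i j + A i j).
Proof.
move=> h1 h2 t; have := addr_ge0 (h1 t) (h2 t); congr (0 <= _).
rewrite -big_split; apply: eq_bigr => i _; rewrite -big_split; apply: eq_bigr => j _.
by rewrite /= mulrDr.
Qed.

Lemma good_rank1 (x : 'I_n -> R) : good (fun i j => x i * x j).
Proof.
move=> M hM t; have := hM (fun i => t i * x i); congr (0 <= _).
by apply: eq_bigr => i _; apply: eq_bigr => j _; rewrite /hmul; ring.
Qed.

Lemma good_sum (J : Type) (s : seq J) (A : J -> 'I_n -> 'I_n -> R) :
  (forall k, good (A k)) -> good (fun i j => \sum_(k <- s) A k i j).
Proof.
move=> hA; elim: s => [|k s IH] M hM.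
  move=> t; rewrite big1 // => i _; rewrite big1 // => j _.
  by rewrite /hmul big_nil !mulr0.
apply: eq_psd (psdD (hA k M hM) (IH M hM)) => i j.
by rewrite /hmul big_cons mulrDr.
Qed.

Lemma goodD A B : good A -> good B -> good (fun i j => A i j + B i j).
Proof.
move=> hA hB M hM; apply: eq_psd (psdD (hA M hM) (hB M hM)) => i j.
by rewrite /hmul mulrDr.
Qed.

Lemma goodZ c A : 0 <= c -> good A -> good (fun i j => c * A i j).
Proof.
move=> c0 hA M hM t; have := mulr_ge0 c0 (hA M hM t); congr (0 <= _).
rewrite mulr_sumr; apply: eq_bigr => i _; rewrite mulr_sumr.
by apply: eq_bigr => j _; rewrite /hmul; ring.
Qed.

Lemma good_mul A B : good A -> good B -> good (hmul A B).
Proof.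
move=> hA hB M hM; apply: eq_psd (hB _ (hA _ hM)) => i j.
by rewrite /hmul mulrA.
Qed.

Lemma good_one : good (fun _ _ => 1).
Proof. by apply: eq_good (good_rank1 (fun=> 1)) => i j; rewrite mulr1. Qed.

Lemma good_prod (J : eqType) (s : seq J) (A : J -> 'I_n -> 'I_n -> R) :
  (forall k, k \in s -> good (A k)) -> good (fun i j => \prod_(k <- s) A k i j).
Proof.
elim: s => [|k s IH] h; first by apply: eq_good good_one => i j; rewrite big_nil.
have h1 : good (A k) by apply: h; rewrite mem_head.
have h2 := IH (fun k' hk' => h k' (mem_behead (s := k :: s) hk')).
by apply: eq_good (good_mul h1 h2) => i j; rewrite big_cons.
Qed.

Lemma good_psd A : good A -> psd A.
Proof.
move=> hA; have h1 : psd (fun _ _ : 'I_n => 1).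
  move=> t; rewrite (_ : \sum_i _ = (\sum_i t i) ^+ 2) ?sqr_ge0 //.
  rewrite expr2 mulr_suml; apply: eq_bigr => i _; rewrite mulr_sumr.
  by apply: eq_bigr => j _; rewrite mulr1.
by apply: eq_psd (hA _ h1) => i j; rewrite /hmul mul1r.
Qed.

(** A Gram matrix in L2 is an integral of rank-one matrices, and for those the Schur product is
    immediate; positivity passes through the integral. *)
Lemma good_int (u : 'I_n -> R -> R) : (forall i, sq mu D01 (u i)) ->
  good (fun i j => int01 (fun t => u i t * u j t)).
Proof.
move=> hu M hM t.
have i0 i j : intg mu D01 (fun x => u i x * u j x).
  exact: (sqM (@m01 R) (hu i) (hu j)).
have : 0 <= I mu D01 (fun x => \sum_(i <- enum 'I_n)
    \sum_(j <- enum 'I_n) t i * t j * M i j * (u i x * u j x)).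
  apply: I_ge0 => x _; have := hM (fun i => t i * u i x); congr (0 <= _).
  rewrite big_enum /=; apply: eq_bigr => i _; rewrite big_enum /=.
  by apply: eq_bigr => j _; ring.
rewrite (I_sum (@m01 R) (@mu01 R)); last first.
  move=> i; apply: (intg_sum (@m01 R) (@mu01 R)) => j; exact: (intgZ (@m01 R)).
congr (0 <= _); rewrite big_enum /=; apply: eq_bigr => i _.
rewrite (I_sum (@m01 R) (@mu01 R)); last by move=> j; exact: (intgZ (@m01 R)).
rewrite big_enum /=; apply: eq_bigr => j _.
by rewrite (I_Z (@m01 R)) // /hmul mulrA.
Qed.

(** Telescoping: the difference of products is [A k] times the difference of the remaining products,
    plus [A k - B k] times a product of good matrices; both summands are positive semidefinite. *)
Lemma prod_psd_le (J : eqType) (s : seq J) (A B : J -> 'I_n -> 'I_n -> R) :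
  (forall k, k \in s -> good (A k)) -> (forall k, k \in s -> good (B k)) ->
  (forall k, k \in s -> psd (fun i j => A k i j - B k i j)) ->
  psd (fun i j => \prod_(k <- s) A k i j - \prod_(k <- s) B k i j).
Proof.
elim: s => [|k s IH] hA hB hAB.
  by move=> t; rewrite big1 // => i _; rewrite big1 // => j _; rewrite !big_nil subrr mulr0.
have sub k' : k' \in s -> k' \in k :: s by rewrite inE orbC => ->.
have {}IH := IH (fun k' h => hA k' (sub k' h)) (fun k' h => hB k' (sub k' h)) (fun k' h => hAB k' (sub k' h)).
have gA := hA k (mem_head _ _); have pAB := hAB k (mem_head _ _).
have gB : good (fun i j => \prod_(k <- s) B k i j).
  by apply: good_prod => k' h; apply: hB; apply: sub.
apply: eq_psd (psdD (gA _ IH) (gB _ pAB)) => i j.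
by rewrite /hmul !big_cons; ring.
Qed.

End PositiveSemidefinite.

(** * Multi-indices over a list of coordinates *)

Section MultiIndex.
Context (d : nat) (I1 : Type) (i0 : I1).

Definition upd T (nu : 'I_d -> T) (j : 'I_d) (k : T) : 'I_d -> T :=
  fun j' => if j' == j then k else nu j'.

(** Multi-indices are total functions with the dummy value [i0] off [s]. Repeated coordinates would
    overwrite one another, whence [uniq s] in the distributive law. *)
Fixpoint mi (L : seq I1) (s : seq 'I_d) : seq ('I_d -> I1) :=
  if s is j :: s' then flatten [seq [seq upd nu j k | nu <- mi L s'] | k <- L]
  else [:: fun=> i0].

Lemma sum_mi (V : nmodType) L j s (F : ('I_d -> I1) -> V) :
  \sum_(nu <- mi L (j :: s)) F nu = \sum_(k <- L) \sum_(nu <- mi L s) F (upd nu j k).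
Proof.
rewrite /=; elim: L (mi L s) => [|k L IH] ms; first by rewrite !big_nil.
by rewrite /= big_cat big_map big_cons IH.
Qed.

Lemma prod_upd (R : comPzSemiRingType) T j s (F : 'I_d -> T -> R) (nu : 'I_d -> T) k : j \notin s ->
  \prod_(j' <- s) F j' (upd nu j k j') = \prod_(j' <- s) F j' (nu j').
Proof.
move=> js; apply: eq_big_seq => j' hj'; rewrite /upd ifN //.
by apply: contraNneq js => <-.
Qed.

Lemma prod_sum_mi (R : comPzSemiRingType) L s (F : 'I_d -> I1 -> R) : uniq s ->
  \prod_(j <- s) \sum_(k <- L) F j k = \sum_(nu <- mi L s) \prod_(j <- s) F j (nu j).
Proof.
elim: s => [|j s IH] /=; first by rewrite big_seq1 !big_nil.
move=> /andP[js us]; rewrite big_cons (IH us) -/(mi L (j :: s)) sum_mi mulr_suml.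
apply: eq_bigr => k _; rewrite mulr_sumr; apply: eq_bigr => nu _.
by rewrite big_cons /upd eqxx prod_upd.
Qed.

End MultiIndex.

Section TensorForms.
Context (R : realType) (m d : nat).
Hypothesis hm : (2 <= m)%N.
Notation fam := ('I_d -> R -> R).
Implicit Types (v : seq (R * fam)) (s : seq 'I_d).

(* v represents the element sum_(p <- v) p.1 * tensor_j p.2 j. *)
Definition tb s (B : 'I_d -> (R -> R) -> (R -> R) -> R) v v' : R :=
  \sum_(p <- v) \sum_(p' <- v') p.1 * p'.1 * \prod_(j <- s) B j (p.2 j) (p'.2 j).

Definition te s (nu : 'I_d -> (R -> R) -> R) v : R :=
  \sum_(p <- v) p.1 * \prod_(j <- s) nu j (p.2 j).

Definition vval s v := forall p, List.In p v -> forall j, j \in s -> Sob0 m (p.2 j).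

Definition comb n (t : 'I_n -> R) (a : 'I_n -> R -> R) : R -> R :=
  fun x => \sum_(i < n) t i * a i x.

(* okform B: B is a positive semidefinite bilinear form, in the form
   in which it tensorises. *)
Definition okform (B : (R -> R) -> (R -> R) -> R) := forall n (a : 'I_n -> R -> R),
  (forall i, Sob0 m (a i)) -> good (fun i j => B (a i) (a j)) /\
  forall t, B (comb t a) (comb t a) = \sum_i \sum_j t i * t j * B (a i) (a j).

Lemma Sob0_zero : Sob0 m (fun=> (0 : R)).
Proof.
have h0 x : 0 <= x <= 1 -> int0x x (fun=> (0 : R)) = 0.
  move=> hx; rewrite int0xE // -[RHS](I_cst (@m01 R) (@mu01 R)).
  by apply: eq_I => t _; rewrite mulr0.
split; last exact: (I_cst (@m01 R) (@mu01 R) 0).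
exists (fun _ _ => 0); split=> //; split; [|split].
- by move=> k _; exact: (intg_cst (@m01 R) (@mu01 R)).
- by move=> k _ x hx; rewrite h0 // addr0.
- have := intg_cst (@m01 R) (@mu01 R) 0; apply: (eq_intg (@m01 R)) => t _.
  by rewrite expr0n.
Qed.

Lemma comb_recl n (t : 'I_n.+1 -> R) (a : 'I_n.+1 -> R -> R) :
  comb t a = fun x => comb (fun i => t (lift ord0 i)) (fun i => a (lift ord0 i)) x + t ord0 * a ord0 x.
Proof. by apply/funext => x; rewrite /comb big_ord_recl addrC. Qed.

Lemma Sob0_sum n (t : 'I_n -> R) (a : 'I_n -> R -> R) :
  (forall i, Sob0 m (a i)) -> Sob0 m (comb t a).
Proof.
elim: n t a => [|n IH] t a ha.
  by rewrite (_ : comb t a = fun=> 0); [exact: Sob0_zero|apply/funext => x; rewrite /comb big_ord0].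
by rewrite comb_recl; apply: Sob0_comb => //; exact: IH.
Qed.

Lemma linS_sum (nu : (R -> R) -> R) n (t : 'I_n -> R) (a : 'I_n -> R -> R) :
  linS m nu -> (forall i, Sob0 m (a i)) -> nu (comb t a) = \sum_i t i * nu (a i).
Proof.
move=> hl; elim: n t a => [|n IH] t a ha.
  rewrite big_ord0; have := hl _ _ (-1) Sob0_zero Sob0_zero.
  rewrite (_ : comb t a = fun=> 0); last by apply/funext => x; rewrite /comb big_ord0.
  rewrite (_ : (fun t => 0 + -1 * 0) = (fun=> 0)); last by apply/funext => x; ring.
  by move=> ->; ring.
rewrite comb_recl hl //; last exact: Sob0_sum.
by rewrite IH // big_ord_recl addrC.
Qed.

Lemma okform_ip1 : okform (ip1 m).
Proof.
move=> n a ha; have hc i := Sob0_chain (ha i); split; last first.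
  move=> t.
  have l1 (h : R -> R) : Sob0 m h -> linS m (fun f => ip1 m f h).
    by move=> hh f g c hf hg; exact: (ip1_combl hm).
  rewrite (linS_sum t (l1 _ (Sob0_sum t ha)) ha).
  apply: eq_bigr => i _; rewrite ip1C (linS_sum t (l1 _ (ha i)) ha) mulr_sumr.
  by apply: eq_bigr => j _; rewrite ip1C mulrA.
apply: goodD.
  by apply: good_sum => l; exact: good_rank1.
by apply: good_int => i; exact: (chain_sq hm (hc i) (leqnn m)).
Qed.

Lemma okform_l2ip : okform l2ip.
Proof.
move=> n a ha; have hL i := Sob0_L2 hm (ha i); split; last first.
  move=> t.
  have l1 (h : R -> R) : Sob0 m h -> linS m (fun f => l2ip f h).
    move=> hh f g c hf hg.
    have hfh := sqM (@m01 R) (Sob0_L2 hm hf) (Sob0_L2 hm hh).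
    have hgh := sqM (@m01 R) (Sob0_L2 hm hg) (Sob0_L2 hm hh).
    rewrite /l2ip /int01 -[_ * Rintegral _ _ _](I_Z (@m01 R)) // -[RHS](I_D (@m01 R)) //.
      by apply: eq_I => x _; ring.
    exact: (intgZ (@m01 R)).
  have l2C f g : l2ip f g = l2ip g f :> R by apply: eq_I => x _; rewrite mulrC.
  rewrite (linS_sum t (l1 _ (Sob0_sum t ha)) ha).
  apply: eq_bigr => i _; rewrite l2C (linS_sum t (l1 _ (ha i)) ha) mulr_sumr.
  by apply: eq_bigr => j _; rewrite l2C mulrA.
exact: good_int.
Qed.

Lemma okformZ c B : 0 <= c -> okform B -> okform (fun f g => c * B f g).
Proof.
move=> c0 hB n a ha; have [h1 h2] := hB n a ha; split; first exact: goodZ.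
move=> t; rewrite h2 mulr_sumr; apply: eq_bigr => i _; rewrite mulr_sumr.
by apply: eq_bigr => j _; ring.
Qed.

(** Common shape of the frame energies and of the discretised inner product [ipN]: a diagonal form
    in finitely many functionals. *)
Definition lform (K : Type) (L : seq K) (rho : K -> R) (nu : K -> (R -> R) -> R) f g : R :=
  \sum_(k <- L) rho k * (nu k f * nu k g).

Lemma okform_lform (K : Type) (L : seq K) rho nu : (forall k, 0 <= rho k) ->
  (forall k, linS m (nu k)) -> okform (lform L rho nu).
Proof.
move=> hr hl n a ha; split.
  by apply: good_sum => k; apply: goodZ => //; exact: good_rank1.
move=> t; rewrite /lform.
transitivity (\sum_(k <- L) \sum_i \sum_j t i * t j * (rho k * (nu k (a i) * nu k (a j)))).
  apply: eq_bigr => k _; rewrite !(linS_sum t (hl k) ha) mulr_suml mulr_sumr.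
  apply: eq_bigr => i _; rewrite mulrA mulr_sumr.
  by apply: eq_bigr => j _; ring.
rewrite exchange_big; apply: eq_bigr => i _; rewrite exchange_big; apply: eq_bigr => j _.
by rewrite mulr_sumr.
Qed.

Lemma okform_rank1 nu : linS m nu -> okform (fun f g => nu f * nu g).
Proof.
move=> hl n a ha; split; first exact: good_rank1.
move=> t; rewrite (linS_sum t hl ha) mulr_suml; apply: eq_bigr => i _.
by rewrite mulr_sumr; apply: eq_bigr => j _; ring.
Qed.

Lemma tbE s B v v' : tb s B v v' = \sum_(i < size v) \sum_(j < size v')
  (tnth (in_tuple v) i).1 * (tnth (in_tuple v') j).1 *
  \prod_(k <- s) B k ((tnth (in_tuple v) i).2 k) ((tnth (in_tuple v') j).2 k).
Proof. by rewrite /tb big_tnth; apply: eq_bigr => i _; rewrite big_tnth. Qed.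

Lemma In_tnth (T : Type) (v : seq T) i : List.In (tnth (in_tuple v) i) v.
Proof.
rewrite (tnth_nth (tnth (in_tuple v) i)) /=; have := ltn_ord i; move: (nat_of_ord i) => k.
move: (tnth _ _) => x0; elim: v k {i} => [|x v IH] [|k] //=; first by left.
by rewrite ltnS => /IH; right.
Qed.

(** One-dimensional comparisons of forms pass to tensor products. Evaluated on the finitely many
    factors occurring in [v], the forms become Gram matrices; linear combinations of the factors
    show that their differences are positive semidefinite, and [prod_psd_le] multiplies over the
    coordinates. *)
Lemma tensor_le s A B v :
  (forall j, j \in s -> okform (A j)) -> (forall j, j \in s -> okform (B j)) ->
  (forall j f, j \in s -> Sob0 m f -> B j f f <= A j f f) -> vval s v ->
  tb s B v v <= tb s A v v.
Proof.
move=> hA hB hAB hv; rewrite -subr_ge0 !tbE.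
pose a i : fam := (tnth (in_tuple v) i).2; pose t i := (tnth (in_tuple v) i).1.
have ha k : k \in s -> forall i, Sob0 m (a i k) by move=> ks i; apply: hv => //; exact: In_tnth.
have := @prod_psd_le R _ _ s (fun k i j => A k (a i k) (a j k)) (fun k i j => B k (a i k) (a j k)).
move=> /(_ _ _ _ t); rewrite -sumrB => h; apply: le_trans (h _ _ _) _.
- by move=> k ks; have [] := hA k ks _ (a^~ k) (ha k ks).
- by move=> k ks; have [] := hB k ks _ (a^~ k) (ha k ks).
- move=> k ks c; have [_ eA] := hA k ks _ (a^~ k) (ha k ks).
  have [_ eB] := hB k ks _ (a^~ k) (ha k ks).
  have := hAB k _ ks (Sob0_sum c (ha k ks)); rewrite eA eB -subr_ge0 -sumrB.
  congr (0 <= _); apply: eq_bigr => i _; rewrite -sumrB; apply: eq_bigr => j _.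
  by rewrite mulrBr.
- rewrite le_eqVlt; apply/orP; left; apply/eqP; apply: eq_bigr => i _.
  by rewrite -sumrB; apply: eq_bigr => j _; rewrite mulrBr.
Qed.

Lemma tb_ge0 s B v : (forall j, j \in s -> okform (B j)) -> vval s v -> 0 <= tb s B v v.
Proof.
move=> hB hv; rewrite tbE.
apply: (good_psd (good_prod _)) => k ks.
by have [] := hB k ks _ (fun i => (tnth (in_tuple v) i).2 k) (fun i => hv _ (In_tnth i) k ks).
Qed.

Lemma tb_scale s B (c : 'I_d -> R) v v' :
  tb s (fun j f g => c j * B j f g) v v' = (\prod_(j <- s) c j) * tb s B v v'.
Proof.
rewrite /tb mulr_sumr; apply: eq_bigr => p _; rewrite mulr_sumr; apply: eq_bigr => p' _.
by rewrite big_split /=; ring.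
Qed.

Lemma tb_rank1 s (nu : 'I_d -> (R -> R) -> R) v v' :
  tb s (fun j f g => nu j f * nu j g) v v' = te s nu v * te s nu v'.
Proof.
rewrite /tb /te mulr_suml; apply: eq_bigr => p _; rewrite mulr_sumr; apply: eq_bigr => p' _.
by rewrite big_split /=; ring.
Qed.

Lemma te_sqr_le s (nu : 'I_d -> (R -> R) -> R) (C : 'I_d -> R) v :
  (forall j, j \in s -> linS m (nu j)) -> (forall j, 0 <= C j) ->
  (forall j f, j \in s -> Sob0 m f -> nu j f ^+ 2 <= C j * ip1 m f f) -> vval s v ->
  te s nu v ^+ 2 <= (\prod_(j <- s) C j) * tb s (fun=> ip1 m) v v.
Proof.
move=> hl C0 hC hv; rewrite expr2 -tb_rank1 -tb_scale; apply: tensor_le => // j.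
- by move=> _; apply: okformZ => //; exact: okform_ip1.
- by move=> js; apply: okform_rank1; exact: hl.
Qed.

(** A diagonal form tensorises to a diagonal form in the tensor functionals. Together with
    [tensor_le] this carries one-dimensional frame bounds to all of [s]. *)
Lemma tb_lform s (K : Type) (k0 : K) (L : seq K) rho nu v v' : uniq s ->
  tb s (fun=> lform L rho nu) v v' = \sum_(mu <- mi k0 L s) (\prod_(j <- s) rho (mu j)) *
    (te s (fun j => nu (mu j)) v * te s (fun j => nu (mu j)) v').
Proof.
move=> us; rewrite /tb.
transitivity (\sum_(p <- v) \sum_(p' <- v') \sum_(mu <- mi k0 L s)
   (\prod_(j <- s) rho (mu j)) * ((p.1 * \prod_(j <- s) nu (mu j) (p.2 j)) *
      (p'.1 * \prod_(j <- s) nu (mu j) (p'.2 j)))).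
  apply: eq_bigr => p _; apply: eq_bigr => p' _.
  rewrite /lform (prod_sum_mi k0) // mulr_sumr; apply: eq_bigr => mu _.
  by rewrite !big_split /=; ring.
under eq_bigr => p _ do rewrite exchange_big.
rewrite exchange_big /=.
apply: eq_bigr => mu _; rewrite /te mulr_suml mulr_sumr; apply: eq_bigr => p _.
by rewrite mulr_sumr mulr_sumr; apply: eq_bigr => p' _.
Qed.

Lemma tb_catl s B v1 v2 v : tb s B (v1 ++ v2) v = tb s B v1 v + tb s B v2 v.
Proof. by rewrite /tb big_cat. Qed.

Lemma tb_catr s B v1 v2 v : tb s B v (v1 ++ v2) = tb s B v v1 + tb s B v v2.
Proof. by rewrite /tb -big_split; apply: eq_bigr => p _; rewrite big_cat. Qed.

Definition wscale c v : seq (R * fam) := [seq (c * p.1, p.2) | p <- v].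

Lemma tb_scalel s B c v v' : tb s B (wscale c v) v' = c * tb s B v v'.
Proof.
rewrite /tb big_map mulr_sumr; apply: eq_bigr => p _; rewrite mulr_sumr.
by apply: eq_bigr => p' _ /=; ring.
Qed.

Lemma tb_scaler s B c v v' : tb s B v (wscale c v') = c * tb s B v v'.
Proof.
rewrite /tb mulr_sumr; apply: eq_bigr => p _; rewrite big_map mulr_sumr.
by apply: eq_bigr => p' _ /=; ring.
Qed.

Lemma te_cat s nu v1 v2 : te s nu (v1 ++ v2) = te s nu v1 + te s nu v2.
Proof. by rewrite /te big_cat. Qed.

Lemma te_scale s nu c v : te s nu (wscale c v) = c * te s nu v.
Proof. by rewrite /te big_map mulr_sumr; apply: eq_bigr => p _ /=; ring. Qed.

Lemma vval_cat s v1 v2 : vval s v1 -> vval s v2 -> vval s (v1 ++ v2).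
Proof. by move=> h1 h2 p /List.in_app_iff[/h1|/h2]. Qed.

Lemma vval_scale s c v : vval s v -> vval s (wscale c v).
Proof. by move=> h p /List.in_map_iff[p' [<- /h]]. Qed.

Lemma tbC s B v v' : (forall j f g, B j f g = B j g f) -> tb s B v v' = tb s B v' v.
Proof.
move=> hB; rewrite /tb exchange_big; apply: eq_bigr => p _; apply: eq_bigr => p' _.
rewrite [p'.1 * _]mulrC; congr (_ * _); apply: eq_bigr => j _; exact: hB.
Qed.

End TensorForms.

Arguments vval_scale {R m d s} c {v} _.

Lemma cvg_sum_In (R : realType) (T : Type) (v : seq T) (F : nat -> T -> R) (G : T -> R) :
  (forall p, List.In p v -> F ^~ p @ \oo --> G p) ->
  (fun k => \sum_(p <- v) F k p) @ \oo --> \sum_(p <- v) G p.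
Proof.
elim: v => [|p v IH] h.
  rewrite big_nil (_ : (fun k => _) = cst 0); first exact: cvg_cst.
  by apply/funext => k; rewrite big_nil.
rewrite big_cons (_ : (fun k => _) = (fun k => F k p + \sum_(p <- v) F k p)); last first.
  by apply/funext => k; rewrite big_cons.
apply: cvgD; first by apply: h; left.
by apply: IH => p' hp; apply: h; right.
Qed.

Lemma In_mem (T : eqType) (p : T) (v : seq T) : List.In p v -> p \in v.
Proof.
by elim: v => //= q v IH [->|/IH]; rewrite inE ?eqxx // orbC => ->.
Qed.

Lemma cvg_prod_mem (R : realType) (T : eqType) (v : seq T) (F : nat -> T -> R) (G : T -> R) :
  (forall p, p \in v -> F ^~ p @ \oo --> G p) ->
  (fun k => \prod_(p <- v) F k p) @ \oo --> \prod_(p <- v) G p.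
Proof.
elim: v => [|p v IH] h.
  rewrite big_nil (_ : (fun k => _) = cst 1); first exact: cvg_cst.
  by apply/funext => k; rewrite big_nil.
rewrite big_cons (_ : (fun k => _) = (fun k => F k p * \prod_(p <- v) F k p)); last first.
  by apply/funext => k; rewrite big_cons.
apply: cvgM; first by apply: h; rewrite mem_head.
by apply: IH => p' hp; apply: h; rewrite inE hp orbT.
Qed.

Lemma cvg_sqr0 (R : realType) (u : nat -> R) :
  (fun k => u k ^+ 2) @ \oo --> (0 : R) -> u @ \oo --> (0 : R).
Proof.
move=> h; apply/cvgrPdist_le => e e0.
have /cvgrPdist_le /(_ (e ^+ 2)) := h; rewrite exprn_gt0 // => /(_ isT).
apply: filterS => k; rewrite !sub0r !normrN normrX.
by rewrite ler_pXn2r ?nnegrE // ltW.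
Qed.

(** * Completion of the algebraic tensor product as a space of functions *)

Section HilbertTensor.
Context (R : realType) (m d : nat).
Hypothesis hm : (2 <= m)%N.
Variable s : seq 'I_d.
Hypothesis us : uniq s.
Notation fam := ('I_d -> R -> R).
Notation vec := (seq (R * fam)).
Implicit Types (v : vec) (g : nat -> vec) (f : ('I_d -> R) -> R).
Notation vv := (vval m s).
Notation A := (tb s (fun=> ip1 m)).

Definition tbx := (@tb_catl R d, @tb_catr R d, @tb_scalel R d, @tb_scaler R d).

Definition sub v v' : vec := v ++ wscale (-1) v'.

Lemma vval_sub v v' : vv v -> vv v' -> vv (sub v v').
Proof. by move=> h h'; apply: vval_cat => //; exact: vval_scale. Qed.

Section SymmetricForm.
Variable B : (R -> R) -> (R -> R) -> R.
Hypotheses (okB : okform m B) (symB : forall h1 h2, B h1 h2 = B h2 h1).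
Notation b := (tb s (fun=> B)).

Lemma bC v v' : b v v' = b v' v. Proof. by apply: tbC => _ f g; exact: symB. Qed.

Lemma b_ge0 v : vv v -> 0 <= b v v.
Proof. by move=> h; apply: (tb_ge0 _ h) => j _. Qed.

Lemma b_cauchy v v' : vv v -> vv v' -> b v v' ^+ 2 <= b v v * b v' v'.
Proof.
move=> h h'; apply: quad_disc; first exact: b_ge0.
move=> t; have := b_ge0 (vval_cat h (vval_scale t h')).
by rewrite !tbx (bC v' v); congr (0 <= _); ring.
Qed.

Lemma b_sqrt_dist v v' : vv v -> vv v' ->
  `|Num.sqrt (b v v) - Num.sqrt (b v' v')| <= Num.sqrt (b (sub v v') (sub v v')).
Proof.
move=> h h'; have k1 := b_ge0 h; have k2 := b_ge0 h'.
rewrite -sqrtr_sqr ler_wsqrtr // /sub !tbx (bC v' v).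
have e1 := sqr_sqrtr k1; have e2 := sqr_sqrtr k2; have hb := b_cauchy h h'.
rewrite -{1}e1 -{1}e2 in hb.
move: (sqrtr_ge0 (b v v)) (sqrtr_ge0 (b v' v')) e1 e2 hb.
move: (Num.sqrt (b v v)) (Num.sqrt (b v' v')) => x y x0 y0 e1 e2 hb.
have : b v v' <= x * y.
  rewrite (le_trans (ler_norm _)) // -(@ler_pXn2r _ 2) ?nnegrE ?mulr_ge0 //.
  by rewrite real_normK ?num_real // exprMn.
by rewrite -e1 -e2; lra.
Qed.

End SymmetricForm.

Lemma ip1S (h1 h2 : R -> R) : ip1 m h1 h2 = ip1 m h2 h1. Proof. exact: ip1C. Qed.

Definition wcauchy g := forall e : R, 0 < e -> exists N : nat, forall k l : nat,
  (N <= k)%N -> (N <= l)%N -> A (sub (g k) (g l)) (sub (g k) (g l)) <= e.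

(** Counterpart of [approx] with scalar weights on the elementary tensors, so that linear
    combinations of approximating sequences are again of this form. *)
Definition wapprox f g := [/\ forall k, vv (g k), wcauchy g &
  forall x, cube x -> (fun k => te s (fun j h => h (x j)) (g k)) @ \oo --> f x].

Lemma wcauchy_bounded g : (forall k, vv (g k)) -> wcauchy g ->
  exists2 M : R, 0 <= M & exists N : nat, forall k, (N <= k)%N -> A (g k) (g k) <= M.
Proof.
move=> hv /(_ 1 ltr01) [N hN].
have k0 := b_ge0 (okform_ip1 hm) (hv N).
exists (2 * A (g N) (g N) + 2); first by rewrite addr_ge0 // mulr_ge0.
exists N => k Nk; have h1 := hN k N Nk (leqnn N).
have := b_ge0 (okform_ip1 hm) (vval_sub (hv k) (vval_scale 2 (hv N))).
move: h1; rewrite /sub !tbx (bC ip1S (g N) (g k)); lra.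
Qed.

Lemma te_upd nu j0 (mu1 mu2 : (R -> R) -> R) c v : j0 \in s ->
  te s (upd nu j0 (fun h => mu1 h + c * mu2 h)) v =
  te s (upd nu j0 mu1) v + c * te s (upd nu j0 mu2) v.
Proof.
move=> js; rewrite /te mulr_sumr -big_split; apply: eq_bigr => p _ /=.
rewrite !(bigD1_seq j0) //= /upd !eqxx.
have e th : \prod_(j <- s | j != j0) (if j == j0 then th else nu j) (p.2 j) =
    \prod_(j <- s | j != j0) nu j (p.2 j).
  by apply: eq_bigr => j /negbTE ->.
by rewrite !e; ring.
Qed.

Lemma te_upd_sum nu j0 (pts : seq (R * R)) v : j0 \in s ->
  te s (upd nu j0 (fun h => \sum_(p <- pts) p.1 * h p.2)) v =
  \sum_(p <- pts) p.1 * te s (upd nu j0 (fun h => h p.2)) v.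
Proof.
move=> js; elim: pts => [|p pts IH].
  rewrite big_nil /te big1 // => p _; rewrite (bigD1_seq j0) //= /upd eqxx big_nil.
  by rewrite mul0r mulr0.
rewrite big_cons -IH addrC -te_upd //; congr (te s (upd nu j0 _) v).
by apply/funext => h; rewrite big_cons addrC.
Qed.

Lemma te_upd_id nu j0 v : te s (upd nu j0 (nu j0)) v = te s nu v.
Proof.
congr (te s _ v); apply/funext => j; rewrite /upd; by case: eqP => [->|].
Qed.

Lemma regS_eval (x : R) : 0 <= x <= 1 -> regS m (fun h => h x).
Proof.
move=> hx; have [l1 [C C0 b1] p1] := regS_ev hm (ltnW hm) hx; split.
- by move=> f1 f2 c hf1 hf2.
- by exists C => // f hf; have := b1 f hf; rewrite (proj1 (Sob0_chain hf)).
- move=> e e0; have [pts h1 h2] := p1 e e0; exists pts => // f hf.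
  by have := h2 f hf; rewrite (proj1 (Sob0_chain hf)).
Qed.

(** Pointwise convergence to 0 is convergence of all tensors of evaluations. Coordinate by
    coordinate, along [s1], an evaluation is exchanged for a regular functional: up to a small
    operator norm this is a finite sum of evaluations, and the Cauchy sequence stays bounded. *)
Lemma regS_cvg g (s1 : seq 'I_d) (nu : 'I_d -> (R -> R) -> R) (x : 'I_d -> R) :
  wapprox (fun=> 0) g -> cube x -> (forall j, j \in s1 -> regS m (nu j)) ->
  (forall j, j \in s -> j \notin s1 -> nu j = fun h => h (x j)) ->
  (fun k => te s nu (g k)) @ \oo --> (0 : R).
Proof.
move=> [hv hc h0]; elim: s1 nu x => [|j0 s1 IH] nu x cx hr hx.
  rewrite (_ : (fun k => _) = (fun k => te s (fun j h => h (x j)) (g k))); first exact: h0.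
  apply/funext => k; apply: eq_bigr => p _; congr (_ * _).
  by apply: eq_big_seq => j js; rewrite hx.
have [js|js] := boolP (j0 \in s); last first.
  apply: (IH nu x) => // j.
    by move=> h; apply: hr; rewrite inE h orbT.
  move=> jS js1; apply: hx => //; rewrite inE negb_or js1 andbT.
  by apply: contraNneq js => <-.
have hreg j : j \in s -> regS m (nu j).
  move=> jS; have [/hr//|h] := boolP (j \in j0 :: s1).
  by rewrite hx //; exact: regS_eval.
pose Q (j : 'I_d) (c : R) := 0 <= c /\ (j \in s ->
    forall h : R -> R, Sob0 m h -> nu j h ^+ 2 <= c * ip1 m h h).
have hQ j : exists c, Q j c.
  have [/hreg[_ [c c0 b1] _]|h] := boolP (j \in s); first by exists c.
  by exists 0; split=> // js'; rewrite js' in h.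
have [C hC] := choice hQ.
have [M M0 [N hN]] := wcauchy_bounded hv hc.
pose P := \prod_(j <- s | j != j0) C j.
have P0 : 0 <= P by apply: prodr_ge0 => j _; case: (hC j).
apply: cvg_sqr0; apply/cvgrPdist_le => e e0.
(* [P] bounds the other factors and [M] the squared norms along the sequence, so the exchange at
   [j0] costs at most [e / 4]; adding 1 keeps the denominator positive. *)
have e1 : 0 < e / (4 * (P * M + 1)) by rewrite divr_gt0 // mulr_gt0 // ltr_wpDl // mulr_ge0.
have [lj [Cj Cj0 bj] pj] := hreg j0 js.
have [pts hpts hp] := pj _ e1.
have hlim : (fun k => \sum_(p <- pts) p.1 * te s (upd nu j0 (fun h => h p.2)) (g k)) @ \oo --> (0 : R).
  rewrite -[X in _ --> X](_ : \sum_(p <- pts) p.1 * 0 = 0); last by rewrite big1 // => p _; rewrite mulr0.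
  apply: cvg_sum_In => p /In_mem /hpts hp2; apply: cvgMr; apply: (IH _ (upd x j0 p.2)).
  - by move=> j; rewrite /upd; case: eqP => // _; exact: cx.
  - move=> j js1; rewrite /upd; case: eqP => [_|_]; first exact: regS_eval.
    by apply: hr; rewrite inE js1 orbT.
  - move=> j jS js1; rewrite /upd; case: eqP => [//|/eqP jj]; apply: hx => //.
    by rewrite inE negb_or jj.
have e4 : 0 < Num.sqrt (e / 4) by rewrite sqrtr_gt0 divr_gt0.
have /cvgrPdist_le /(_ _ e4) [N' _ hN'] := hlim.
exists (maxn N N') => // k /=; rewrite geq_max => /andP[Nk N'k].
have := hN' k N'k; rewrite sub0r normrN => hS.
rewrite sub0r normrN ger0_norm ?sqr_ge0 //.
set S := \sum_(p <- pts) _ in hS.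
have hS2 : S ^+ 2 <= e / 4.
  have q0 : 0 <= e / 4 by rewrite divr_ge0 // ltW.
  rewrite -(real_normK (num_real S)) -(sqr_sqrtr q0).
  by rewrite ler_pXn2r ?nnegrE ?sqrtr_ge0.
have hD : (te s nu (g k) - S) ^+ 2 <= e / 4.
  have -> : te s nu (g k) - S = te s (upd nu j0 (fun h => nu j0 h + -1 * \sum_(p <- pts) p.1 * h p.2)) (g k).
    by rewrite te_upd // te_upd_sum // te_upd_id mulN1r.
  have := @te_sqr_le R m d hm s (upd nu j0 (fun h => nu j0 h + -1 * \sum_(p <- pts) p.1 * h p.2))
    (upd C j0 (e / (4 * (P * M + 1)))) (g k).
  move=> /(_ _ _ _ (hv k)) h; apply: le_trans (h _ _ _) _.
  - move=> j jS; rewrite /upd; case: eqP => [_|_]; last by case: (hreg j jS).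
    move=> f1 f2 c hf1 hf2; rewrite lj //.
    have -> : \sum_(p <- pts) p.1 * (f1 p.2 + c * f2 p.2) =
       \sum_(p <- pts) p.1 * f1 p.2 + c * \sum_(p <- pts) p.1 * f2 p.2.
      by rewrite mulr_sumr -big_split; apply: eq_bigr => p _ /=; ring.
    by ring.
  - by move=> j; rewrite /upd; case: eqP => [_|_]; [exact: ltW|case: (hC j)].
  - move=> j f jS hf; rewrite /upd; case: eqP => [_|_]; first by rewrite mulN1r; exact: hp.
    by have [_] := hC j; apply.
  - rewrite (bigD1_seq j0) //= {1}/upd eqxx.
    have -> : \prod_(j <- s | j != j0) upd C j0 (e / (4 * (P * M + 1))) j = P.
      by apply: eq_bigr => j /negbTE; rewrite /upd => ->.
    have hA := hN k Nk.
    apply: (@le_trans _ _ (e / (4 * (P * M + 1)) * (P * M))).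
      by rewrite -[leLHS]mulrA; apply: ler_wpM2l; [exact: ltW|exact: ler_wpM2l].
    have PM : 0 <= P * M by rewrite mulr_ge0.
    rewrite mulrAC ler_pdivrMr; last by rewrite mulr_gt0 // ltr_wpDl.
    by rewrite (_ : e / 4 * _ = e * (P * M + 1)); [rewrite ler_wpM2l ?(ltW e0) // lerDl|field].
have -> : e = 2 * (e / 4) + 2 * (e / 4) by field.
exact: sqr_le_split hD hS2.
Qed.

End HilbertTensor.

Lemma cvg_sqrt (R : realType) (u : nat -> R) (l : R) : u @ \oo --> l ->
  (fun k => Num.sqrt (u k)) @ \oo --> Num.sqrt l.
Proof. by move=> h; apply: continuous_cvg => //; exact: sqrt_continuous. Qed.

Section HilbertTensorLimits.
Context (R : realType) (m d : nat).
Hypothesis hm : (2 <= m)%N.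
Variable s : seq 'I_d.
Hypothesis us : uniq s.
Notation fam := ('I_d -> R -> R).
Notation vec := (seq (R * fam)).
Implicit Types (v : vec) (g : nat -> vec) (F : ('I_d -> R) -> R) (f h : R -> R).
Notation vv := (vval m s).
Notation A := (tb s (fun=> ip1 m)).
Notation wapprox := (wapprox m s).
Notation wcauchy := (wcauchy m s).
Let hm1 : (1 <= m)%N. Proof. exact: ltnW. Qed.
Let mP : m.-1.+1 = m. Proof. by rewrite prednK. Qed.
Let mPlt : (m.-1 < m)%N. Proof. by rewrite mP. Qed.
Let in0 : 0 <= (0 : R) <= 1. Proof. by rewrite lexx ler01. Qed.
Let in1 : 0 <= (1 : R) <= 1. Proof. by rewrite lexx ler01. Qed.

(** By the fundamental theorem the increment of the l-th derivative is the mean of the next one, a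
    term of [ip1]; the dyadic increments of order [m.-1] discretise the top term. The boolean factor
    annuls the indices out of range, so that [fnl k] is regular for every [k]. *)
Definition fnl (k : nat + seq bool) : (R -> R) -> R :=
  match k with
  | inl l => fun f => (l < m.-1)%N%:R * (sobD m f l 1 - sobD m f l 0)
  | inr w => fun f => dlt w (sobD m f m.-1)
  end.

Definition rhoN N (k : nat + seq bool) : R := if k is inr _ then 2 ^+ N else 1.

Definition LN N : seq (nat + seq bool) := map inl (index_iota 0 m.-1) ++ map inr (words N).

(* dyadic discretisation of the inner product, using finitely many regular functionals *)
Definition ipN N := lform (LN N) (rhoN N) fnl.

Lemma regS_fnl k : regS m (fnl k).
Proof.
case: k => [l|w] /=.
  case: ltnP => lm.
    have lm' : (l < m)%N := ltn_trans lm mPlt.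
    have := regSZ 1 (regS_comb (-1) (regS_ev hm lm' in1) (regS_ev hm lm' in0)).
    by rewrite (_ : (fun f => _) = (fun f => 1%:R * (sobD m f l 1 - sobD m f l 0))) //;
      apply/funext => f; ring.
  have := regSZ 0 (regS_ev hm mPlt in1).
  by rewrite (_ : (fun f => _) = (fun f => 0%:R * (sobD m f l 1 - sobD m f l 0))) //;
      apply/funext => f; rewrite /= mulr0n !mul0r.
have [x [y [hx hy e]]] := dltE R w.
have := regS_comb (-1) (regS_ev hm mPlt hy) (regS_ev hm mPlt hx).
by rewrite (_ : (fun f => _) = (fun f => dlt w (sobD m f m.-1))) //;
  apply/funext => f; rewrite e; ring.
Qed.

Lemma rhoN_ge0 N k : 0 <= rhoN N k.
Proof. by case: k => [l|w] /=; rewrite ?ler01 // exprn_ge0. Qed.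

Lemma okform_ipN N : okform m (ipN N).
Proof. by apply: (okform_lform hm) => k; [exact: rhoN_ge0|case: (regS_fnl k)]. Qed.

Lemma ipN_diff N f : Sob0 m f -> ip1 m f f - ipN N f f = vr N (sobD m f m).
Proof.
move=> hf; have hD := Sob0_chain hf.
have hF x : 0 <= x <= 1 -> sobD m f m.-1 x = sobD m f m.-1 0 + int0x x (sobD m f m).
  by move=> hx; rewrite (chain_int0x hD mPlt hx) mP.
rewrite (vrE N (chain_sq hm hD (leqnn m)) hF) /ip1 /ipN /lform /LN big_cat !big_map /=.
rewrite big_add1 /=.
have -> : \sum_(0 <= l < m.-1) int01 (sobD m f l.+1) * int01 (sobD m f l.+1) =
  \sum_(0 <= l < m.-1) 1 * ((l < m.-1)%N%:R * (sobD m f l 1 - sobD m f l 0) *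
    ((l < m.-1)%N%:R * (sobD m f l 1 - sobD m f l 0))).
  apply: eq_big_nat => l /andP[_ lm]; rewrite lm.
  have lm' : (l < m)%N := ltn_trans lm mPlt.
  by rewrite [int01 _](chain_int hD lm') !mul1r.
have -> : int01 (fun t => sobD m f m t * sobD m f m t) =
   I (@lebesgue_measure R) `[0%R, 1%R]%classic (fun t => sobD m f m t ^+ 2).
  by apply: eq_I => t _; rewrite expr2.
by rewrite opprD addrACA subrr add0r [in RHS]mulr_sumr; congr (_ - _).
Qed.

Lemma ipN_le N f : Sob0 m f -> ipN N f f <= ip1 m f f.
Proof.
move=> hf; rewrite -subr_ge0 ipN_diff //; apply: vr_ge0.
exact: (chain_sq hm (Sob0_chain hf) (leqnn m)).
Qed.

Lemma ipN_cvg_diag f : Sob0 m f -> (fun N => ipN N f f) @ \oo --> ip1 m f f.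
Proof.
move=> hf; apply/cvgrPdist_le => e e0.
have hu := chain_sq hm (Sob0_chain hf) (leqnn m).
have [N hN] := vr_cvg hu e0; exists N => // k /= Nk.
by rewrite ipN_diff // ger0_norm ?vr_ge0 // hN.
Qed.

Lemma ipN_combl N f1 f2 h c : Sob0 m f1 -> Sob0 m f2 ->
  ipN N (fun t => f1 t + c * f2 t) h = ipN N f1 h + c * ipN N f2 h.
Proof.
move=> h1 h2; rewrite /ipN /lform mulr_sumr -big_split; apply: eq_bigr => k _ /=.
by have [l _ _] := regS_fnl k; rewrite l //; ring.
Qed.

Lemma ipNC N f h : ipN N f h = ipN N h f.
Proof. by apply: eq_bigr => k _; rewrite [fnl k f * _]mulrC. Qed.

(** The dyadic variance controls the diagonal only; polarisation extends the limit to pairs. *)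
Lemma ipN_cvg f h : Sob0 m f -> Sob0 m h -> (fun N => ipN N f h) @ \oo --> ip1 m f h.
Proof.
move=> hf hh; have hs := Sob0_comb hm 1 hf hh.
have pol (B : (R -> R) -> (R -> R) -> R) : (forall a b, B a b = B b a) ->
   (forall a, Sob0 m a -> B (fun t => f t + 1 * h t) a = B f a + 1 * B h a) ->
   B f h = 2^-1 * (B (fun t => f t + 1 * h t) (fun t => f t + 1 * h t) - B f f - B h h).
  move=> sB lB; set fh := (fun t => f t + 1 * h t).
  by rewrite (lB fh hs) (sB f fh) (sB h fh) (lB f hf) (lB h hh) (sB h f); field.
rewrite (pol (ip1 m)); [|exact: ip1C|by move=> a ha; exact: (ip1_combl hm)].
rewrite (_ : (fun N => ipN N f h) = (fun N => 2^-1 * (ipN N (fun t => f t + 1 * h t)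
   (fun t => f t + 1 * h t) - ipN N f f - ipN N h h))); last first.
  by apply/funext => N; rewrite (pol (ipN N)); [|exact: ipNC|move=> a ha; exact: ipN_combl].
by apply: cvgMr; apply: cvgB; [apply: cvgB|]; apply: ipN_cvg_diag.
Qed.

Lemma tb_ipN_cvg v v' : vv v -> vv v' -> (fun N => tb s (fun=> ipN N) v v') @ \oo --> A v v'.
Proof.
move=> hv hv'; rewrite /tb; apply: cvg_sum_In => p hp; apply: cvg_sum_In => p' hp'.
apply: cvgMr; apply: cvg_prod_mem => j js; apply: ipN_cvg; [exact: hv|exact: hv'].
Qed.

Lemma tb_ipN_le N v : vv v -> tb s (fun=> ipN N) v v <= A v v.
Proof.
move=> hv; apply: (tensor_le hm) => // [j _|j _|j f _]; [exact: okform_ip1|exact: okform_ipN|exact: ipN_le].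
Qed.

Lemma tb_ipN_te N v v' : tb s (fun=> ipN N) v v' = \sum_(mu <- mi (inl 0%N) (LN N) s)
  (\prod_(j <- s) rhoN N (mu j)) * (te s (fun j => fnl (mu j)) v * te s (fun j => fnl (mu j)) v').
Proof. exact: tb_lform. Qed.

(* A Cauchy sequence of the algebraic tensor product that vanishes pointwise in
   the limit is a null sequence, so the completion is a space of functions. *)
Lemma wapprox0 g : wapprox (fun=> 0) g -> (fun k => A (g k) (g k)) @ \oo --> (0 : R).
Proof.
move=> hg; have [hv hc h0] := hg; apply/cvgrPdist_le => e e0.
have [K hK] := hc e e0; exists K => // k /= Kk.
rewrite sub0r normrN ger0_norm; last exact: (b_ge0 (okform_ip1 hm)).
(* For fixed [N] this form is a finite sum of squares of functionals that [regS_cvg] sends to 0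
   along the sequence. Hence its value at [g k] is the limit in [l] of its value at [g k - g l],
   which the Cauchy bound controls uniformly in [N]. *)
suff h N : tb s (fun=> ipN N) (g k) (g k) <= e.
  apply: (cvgr_to_le (tb_ipN_cvg (hv k) (hv k))).
  by apply: nearW => N; exact: h.
have c0 : cube (fun _ : 'I_d => 0 : R) by move=> j.
have hl : (fun l => tb s (fun=> ipN N) (sub (g k) (g l)) (sub (g k) (g l))) @ \oo -->
    tb s (fun=> ipN N) (g k) (g k).
  rewrite tb_ipN_te (_ : (fun l => _) = (fun l => \sum_(mu <- mi (inl 0%N) (LN N) s)
    (\prod_(j <- s) rhoN N (mu j)) * ((te s (fun j => fnl (mu j)) (g k) - te s (fun j => fnl (mu j)) (g l)) *
      (te s (fun j => fnl (mu j)) (g k) - te s (fun j => fnl (mu j)) (g l))))); last first.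
    by apply/funext => l; rewrite tb_ipN_te; apply: eq_bigr => mu _; rewrite /sub te_cat te_scale mulN1r.
  apply: cvg_sum_In => mu _; apply: cvgMr.
  have ht : (fun l => te s (fun j => fnl (mu j)) (g k) - te s (fun j => fnl (mu j)) (g l)) @ \oo -->
      te s (fun j => fnl (mu j)) (g k).
    rewrite -[X in _ --> X]subr0; apply: cvgB; first exact: cvg_cst.
    apply: (regS_cvg hm us (s1 := s) hg c0) => j; first by move=> _; exact: regS_fnl.
    by move=> ->.
  exact: cvgM.
apply: (cvgr_to_le hl); exists K => // l /= Kl.
by apply: le_trans (hK k l Kk Kl); apply: tb_ipN_le; apply: vval_sub.
Qed.

Section DominatedForm.
Variables (B : (R -> R) -> (R -> R) -> R) (C : R).
Hypotheses (okB : okform m B) (symB : forall h1 h2, B h1 h2 = B h2 h1).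
Hypotheses (C0 : 0 <= C) (domB : forall f, Sob0 m f -> B f f <= C * ip1 m f f).
Notation b := (tb s (fun=> B)).

Lemma b_le v : vv v -> b v v <= C ^+ size s * A v v.
Proof.
move=> hv.
have -> : C ^+ size s * A v v = tb s (fun=> fun f h => C * ip1 m f h) v v.
  by rewrite tb_scale big_const_seq count_predT iter_mulr_1.
by apply: (tensor_le hm) => // [j _|j f _]; [exact: okformZ (okform_ip1 hm)|exact: domB].
Qed.

Lemma sub_wapprox F g g' : wapprox F g -> wapprox F g' -> wapprox (fun=> 0) (fun k => sub (g k) (g' k)).
Proof.
move=> [hv hc hF] [hv' hc' hF']; split.
- by move=> k; exact: vval_sub.
- move=> e e0; have e4 : 0 < e / 4 by rewrite divr_gt0.
  have [N hN] := hc _ e4; have [N' hN'] := hc' _ e4.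
  exists (maxn N N') => k l; rewrite !geq_max => /andP[Nk N'k] /andP[Nl N'l].
  have h1 := hN k l Nk Nl; have h2 := hN' k l N'k N'l.
  have hw : vv (sub (g k) (g l) ++ sub (g' k) (g' l)).
    by apply: vval_cat; exact: vval_sub.
  have := b_ge0 (okform_ip1 hm) hw; move: h1 h2; rewrite /sub !tbx; lra.
- move=> x cx; rewrite -[X in _ --> X](subrr (F x)).
  rewrite (_ : (fun k => _) = (fun k => te s (fun j h => h (x j)) (g k) - te s (fun j h => h (x j)) (g' k))).
    by apply: cvgB; [exact: hF|exact: hF'].
  by apply/funext => k; rewrite /sub te_cat te_scale mulN1r.
Qed.

(** By the reverse triangle inequality the square roots form a Cauchy sequence, since [b] is
    dominated by a multiple of the Sobolev form. *)
Lemma b_cvg F g : wapprox F g -> cvgn (fun k => b (g k) (g k)).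
Proof.
move=> [hv hc _].
have hs : cvgn (fun k => Num.sqrt (b (g k) (g k))).
  apply/cauchy_cvgP/cauchy_exP => e e0.
  have P0 : 0 <= C ^+ size s by rewrite exprn_ge0.
  have e1 : 0 < (e / 2) ^+ 2 / (C ^+ size s + 1).
    by rewrite divr_gt0 // ?exprn_gt0 ?divr_gt0 // ltr_wpDl.
  have [N hN] := hc _ e1.
  exists (Num.sqrt (b (g N) (g N))); exists N => // k /= Nk.
  rewrite /ball /= (le_lt_trans (b_sqrt_dist okB symB (hv N) (hv k))) //.
  apply: (@le_lt_trans _ _ (e / 2)); last by rewrite ltr_pdivrMr // ltr_pMr // ltr1n.
  rewrite -[e / 2]ger0_norm ?divr_ge0 ?(ltW e0) // -sqrtr_sqr ler_wsqrtr //.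
  apply: le_trans (b_le (vval_sub (hv N) (hv k))) _.
  apply: le_trans (ler_wpM2l P0 (hN N k (leqnn N) Nk)) _.
  rewrite mulrCA ler_piMr ?sqr_ge0 // ler_pdivrMr ?ltr_wpDl // mul1r lerDl //.
rewrite (_ : (fun k => _) = (fun k => Num.sqrt (b (g k) (g k)) * Num.sqrt (b (g k) (g k)))).
  by apply: is_cvgM.
by apply/funext => k; rewrite -expr2 sqr_sqrtr //; exact: (b_ge0 okB).
Qed.

(** The difference of two approximating sequences has limit 0 pointwise, hence is null in norm by
    [wapprox0]. This is why [JS] and [VS] do not depend on the sequence they choose. *)
Lemma b_lim_uniq F g g' : wapprox F g -> wapprox F g' ->
  limn (fun k => b (g k) (g k)) = limn (fun k => b (g' k) (g' k)).
Proof.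
move=> hg hg'; have [hv _ _] := hg; have [hv' _ _] := hg'.
have h0 := wapprox0 (sub_wapprox hg hg').
have hd : (fun k => b (sub (g k) (g' k)) (sub (g k) (g' k))) @ \oo --> (0 : R).
  apply: (@squeeze_cvgr _ _ _ _ (fun=> 0) (fun k => C ^+ size s * A (sub (g k) (g' k)) (sub (g k) (g' k)))).
  - by apply: nearW => k; have w := vval_sub (hv k) (hv' k); apply/andP; split; [exact: (b_ge0 okB w)|exact: b_le].
  - exact: cvg_cst.
  - by rewrite -[X in _ --> X](mulr0 (C ^+ size s)); apply: cvgMr.
have hs : (fun k => Num.sqrt (b (g k) (g k)) - Num.sqrt (b (g' k) (g' k))) @ \oo --> (0 : R).
  apply/norm_cvg0P; apply: (@squeeze_cvgr _ _ _ _ (fun=> 0)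
    (fun k => Num.sqrt (b (sub (g k) (g' k)) (sub (g k) (g' k))))).
  - by apply: nearW => k; rewrite normr_ge0 /=; exact: (b_sqrt_dist okB symB (hv k) (hv' k)).
  - exact: cvg_cst.
  - by have := cvg_sqrt hd; rewrite sqrtr0.
have c1 := b_cvg hg; have c2 := b_cvg hg'.
have c1' : (fun k => Num.sqrt (b (g k) (g k))) @ \oo --> Num.sqrt (limn (fun k => b (g k) (g k))).
  exact: cvg_sqrt.
have c2' : (fun k => Num.sqrt (b (g' k) (g' k))) @ \oo --> Num.sqrt (limn (fun k => b (g' k) (g' k))).
  exact: cvg_sqrt.
pose D k := Num.sqrt (b (g k) (g k)) - Num.sqrt (b (g' k) (g' k)).
have h1 : limn D = 0 by apply: cvg_lim => //; exact: hs.
have h2 : limn D = Num.sqrt (limn (fun k => b (g k) (g k))) - Num.sqrt (limn (fun k => b (g' k) (g' k))).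
  by apply: cvg_lim => //; exact: cvgB.
have l1 : 0 <= limn (fun k => b (g k) (g k)).
  by apply: limr_ge => //; apply: nearW => k; exact: (b_ge0 okB).
have l2 : 0 <= limn (fun k => b (g' k) (g' k)).
  by apply: limr_ge => //; apply: nearW => k; exact: (b_ge0 okB).
have e := subr0_eq (etrans (esym h2) h1).
by rewrite -(sqr_sqrtr l1) -(sqr_sqrtr l2) e.
Qed.

End DominatedForm.

End HilbertTensorLimits.

Lemma all_In (T : Type) (P : pred T) (v : seq T) :
  all P v <-> forall a, List.In a v -> P a.
Proof.
elim: v => //= a v IH; split=> [/andP[pa /IH h] a' [<-//|/h//]|h].
by apply/andP; split; [apply: h; left|apply/IH => a' ha; apply: h; right].
Qed.

Lemma eq_big_In (V : nmodType) (T : Type) (v : seq T) (F G : T -> V) :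
  (forall p, List.In p v -> F p = G p) -> \sum_(p <- v) F p = \sum_(p <- v) G p.
Proof.
elim: v => [|p v IH] h; first by rewrite !big_nil.
by rewrite !big_cons h; [rewrite IH // => p' hp; apply: h; right|left].
Qed.

Lemma cvg_polar (R : realType) (a b : R) (u1 u2 u3 : nat -> R) (l1 l2 l3 : R) :
  u1 @ \oo --> l1 -> u2 @ \oo --> l2 -> u3 @ \oo --> l3 ->
  (fun k => a ^+ 2 * u1 k + 2 * a * b * (2^-1 * (u3 k - u1 k - u2 k)) + b ^+ 2 * u2 k) @ \oo -->
  a ^+ 2 * l1 + 2 * a * b * (2^-1 * (l3 - l1 - l2)) + b ^+ 2 * l2.
Proof.
move=> h1 h2 h3; apply: cvgD; last exact: cvgMr.
apply: cvgD; first exact: cvgMr.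
by do 2 apply: cvgMr; apply: cvgB => //; apply: cvgB.
Qed.

(** * The spaces [HS] and their quadratic forms *)

Section ComponentSpaces.
Context (R : realType) (m d : nat).
Hypothesis hm : (2 <= m)%N.
Notation fam := ('I_d -> R -> R).
Notation vec := (seq (R * fam)).
Implicit Types (S : {set 'I_d}) (F G : ('I_d -> R) -> R) (v : vec) (r : seq fam).
Let en S : seq 'I_d := enum (mem S).
Let uS S : uniq (en S) := enum_uniq (mem S).

Definition wt r : vec := [seq (1, a) | a <- r].

Lemma tb_wt S B r r' : tb (en S) (fun=> B) (wt r) (wt r') =
  \sum_(a <- r) \sum_(b <- r') \prod_(j in S) B (a j) (b j).
Proof.
rewrite /tb big_map; apply: eq_bigr => a _; rewrite big_map; apply: eq_bigr => b _ /=.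
by rewrite !mul1r /en big_enum.
Qed.

Lemma te_wt S r (x : 'I_d -> R) : te (en S) (fun j h => h (x j)) (wt r) = evalrep S r x.
Proof.
by rewrite /te big_map; apply: eq_bigr => a _ /=; rewrite mul1r /en big_enum.
Qed.

Lemma approx_wapprox S F g : Defs.approx m S F g -> wapprox m (en S) F (wt \o g).
Proof.
move=> [hv [hc hx]]; split.
- move=> k p /List.in_map_iff[a [<- ha]] j /= js.
  have /all_In/(_ a ha)/asboolP := hv k; apply; by rewrite -mem_enum.
- move=> e e0; have [N hN] := hc e e0; exists N => k l Nk Nl.
  have := hN k l Nk Nl; rewrite /Jdist /sub !tbx.
  rewrite (tbC _ (wt (g l)) (wt (g k))); last by move=> _ f h; exact: ip1C.
  by rewrite !tb_wt -/(Jrep m S _ _) /Jrep /=; lra.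
- move=> x cx; rewrite (_ : (fun k => _) = (fun k => evalrep S (g k) x)); first exact: hx.
  by apply/funext => k; rewrite te_wt.
Qed.

(** Returns from weighted to unweighted tensors by absorbing the weight into the factor at [j0],
    which needs a coordinate in [S]; the empty set is treated apart throughout. *)
Definition scf (j0 : 'I_d) (p : R * fam) : fam :=
  fun j t => if j == j0 then p.1 * p.2 j t else p.2 j t.

Definition unw j0 v : seq fam := [seq scf j0 p | p <- v].

Lemma linS_Z (nu : (R -> R) -> R) c (f : R -> R) : linS m nu -> Sob0 m f ->
  nu (fun t => c * f t) = c * nu f.
Proof.
move=> l hf; have h0 := Sob0_zero R m.
have := l _ _ c h0 hf; rewrite (_ : (fun t => 0 + c * f t) = (fun t => c * f t)).
  move=> ->; have := l _ _ (-1) h0 h0.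
  rewrite (_ : (fun t => 0 + -1 * 0) = (fun=> 0)); last by apply/funext => x; ring.
  by move=> ->; ring.
by apply/funext => t; rewrite add0r.
Qed.

Lemma Sob0_Z c (f : R -> R) : Sob0 m f -> Sob0 m (fun t => c * f t).
Proof.
move=> hf; have := Sob0_comb hm c (Sob0_zero R m) hf.
by rewrite (_ : (fun t => 0 + c * f t) = (fun t => c * f t)) //; apply/funext => t; rewrite add0r.
Qed.

Lemma unw_valid S j0 v a : vval m (en S) v -> List.In a (unw j0 v) -> valid_fam m S a.
Proof.
move=> hv /List.in_map_iff[p [<- hp]] j js; rewrite /scf.
have h : Sob0 m (p.2 j) by apply: hv => //; rewrite /en mem_enum.
by case: eqP => // _; exact: Sob0_Z.
Qed.

Lemma tb_unw S j0 v v' : j0 \in S -> vval m (en S) v -> vval m (en S) v' ->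
  tb (en S) (fun=> ip1 m) (wt (unw j0 v)) (wt (unw j0 v')) = tb (en S) (fun=> ip1 m) v v'.
Proof.
move=> jS hv hv'; rewrite /tb /wt /unw !big_map.
apply: eq_big_In => p hp.
rewrite !big_map; apply: eq_big_In => p' hp' /=; rewrite !mul1r.
have js : j0 \in en S by rewrite /en mem_enum.
rewrite !(bigD1_seq j0) //= /scf eqxx.
have h := hv _ hp _ js; have h' := hv' _ hp' _ js.
have l1 (f : R -> R) : Sob0 m f -> linS m (fun g => ip1 m g f).
  by move=> hf f1 f2 c h1 h2; exact: (ip1_combl hm).
rewrite (linS_Z p.1 (l1 _ (Sob0_Z p'.1 h')) h) ip1C (linS_Z p'.1 (l1 _ h) h') ip1C.
rewrite (_ : \prod_(j <- en S | j != j0) _ = \prod_(j <- en S | j != j0) ip1 m (p.2 j) (p'.2 j)).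
  by ring.
by apply: eq_bigr => j /negbTE ->.
Qed.

Lemma te_unw S j0 v (x : 'I_d -> R) : j0 \in S ->
  evalrep S (unw j0 v) x = te (en S) (fun j h => h (x j)) v.
Proof.
move=> jS; rewrite -te_wt /te /wt /unw !big_map; apply: eq_bigr => p _ /=.
have js : j0 \in en S by rewrite /en mem_enum.
rewrite mul1r !(bigD1_seq j0) //= /scf eqxx -mulrA; congr (_ * (_ * _)).
by apply: eq_bigr => j /negbTE ->.
Qed.

Lemma wapprox_approx S j0 F g : j0 \in S -> wapprox m (en S) F g ->
  Defs.approx m S F (fun k => unw j0 (g k)).
Proof.
move=> jS [hv hc hx]; split; [|split].
- by move=> k; apply/all_In => a ha; apply/asboolP; exact: unw_valid (hv k) ha.
- move=> e e0; have [N hN] := hc e e0; exists N => k l Nk Nl.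
  have := hN k l Nk Nl; rewrite /Jdist /Jrep -!(tb_wt S (ip1 m)) !tb_unw // /sub !tbx.
  rewrite (tbC _ (g l) (g k)); last by move=> _ f h; exact: ip1C.
  by lra.
- move=> x cx; rewrite (_ : (fun k => _) = (fun k => te (en S) (fun j h => h (x j)) (g k))); first exact: hx.
  by apply/funext => k; rewrite te_unw.
Qed.

Lemma HS_wapprox S F : S != finset.set0 -> HS m S F -> exists g, wapprox m (en S) F g.
Proof.
move=> S0; rewrite /HS (negbTE S0) => -[g hg]; exists (wt \o g); exact: approx_wapprox.
Qed.

Lemma wapprox_HS S F g : S != finset.set0 -> wapprox m (en S) F g -> HS m S F.
Proof.
move=> S0 hg; rewrite /HS (negbTE S0); have /finset.set0Pn[j0 jS] := S0.
by exists (fun k => unw j0 (g k)); exact: wapprox_approx.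
Qed.

Lemma approx_seqP S F g : S != finset.set0 -> wapprox m (en S) F g ->
  wapprox m (en S) F (wt \o approx_seq m S F).
Proof.
move=> S0 hg; apply: approx_wapprox; rewrite /approx_seq.
have /finset.set0Pn[j0 jS] := S0.
case: pselect => [H|[]]; first by case: (cid H).
by exists (fun k => unw j0 (g k)); exact: wapprox_approx.
Qed.

(** Frees [JS] from its chosen sequence: any convenient approximation, such as a linear combination
    of two others, computes it. *)
Lemma JS_lim S F g : S != finset.set0 -> wapprox m (en S) F g ->
  (fun k => tb (en S) (fun=> ip1 m) (g k) (g k)) @ \oo --> JS m S F.
Proof.
move=> S0 hg; have hs := approx_seqP S0 hg.
have dom (f : R -> R) : Sob0 m f -> ip1 m f f <= 1 * ip1 m f f by rewrite mul1r.
have symB (f h : R -> R) : ip1 m f h = ip1 m h f := ip1C m f h.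
have -> : JS m S F = limn (fun k => tb (en S) (fun=> ip1 m) (g k) (g k)).
  rewrite /JS (negbTE S0) (b_lim_uniq hm (uS S) (okform_ip1 hm) symB ler01 dom hg hs).
  by congr (limn _); apply/funext => k; rewrite tb_wt.
exact: (b_cvg hm (okform_ip1 hm) symB ler01 dom hg).
Qed.

Lemma VS_lim S F g : S != finset.set0 -> wapprox m (en S) F g ->
  (fun k => tb (en S) (fun=> l2ip) (g k) (g k)) @ \oo --> VS m S F.
Proof.
move=> S0 hg; have hs := approx_seqP S0 hg; have [C C0 dom] := l2ip_le R hm.
have symB (f h : R -> R) : l2ip f h = l2ip h f :> R by apply: eq_I => t _; rewrite mulrC.
have -> : VS m S F = limn (fun k => tb (en S) (fun=> l2ip) (g k) (g k)).
  rewrite /VS (negbTE S0) (b_lim_uniq hm (uS S) (okform_l2ip hm) symB C0 dom hg hs).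
  by congr (limn _); apply/funext => k; rewrite tb_wt.
exact: (b_cvg hm (okform_l2ip hm) symB C0 dom hg).
Qed.

Lemma JS_ge0 S F : HS m S F -> 0 <= JS m S F.
Proof.
have [->|S0] := eqVneq S finset.set0; first by rewrite /JS eqxx.
move=> /(HS_wapprox S0)[g hg]; have [hv _ _] := hg.
apply: (cvgr_to_ge (JS_lim S0 hg)); apply: nearW => k.
exact: (b_ge0 (okform_ip1 hm) (hv k)).
Qed.

Lemma VS_ge0 S F : HS m S F -> 0 <= VS m S F.
Proof.
have [->|S0] := eqVneq S finset.set0; first by rewrite /VS eqxx sqr_ge0.
move=> /(HS_wapprox S0)[g hg]; have [hv _ _] := hg.
apply: (cvgr_to_ge (VS_lim S0 hg)); apply: nearW => k.
exact: (b_ge0 (okform_l2ip hm) (hv k)).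
Qed.

Lemma wapprox_comb S F G g h a b : wapprox m (en S) F g -> wapprox m (en S) G h ->
  wapprox m (en S) (fun x => a * F x + b * G x) (fun k => wscale a (g k) ++ wscale b (h k)).
Proof.
move=> [hv hc hx] [hv' hc' hx']; split.
- by move=> k; apply: vval_cat; apply: vval_scale.
- move=> e e0.
  have e1 : 0 < e / (4 * (a ^+ 2 + 1)) by rewrite divr_gt0 // mulr_gt0 // ltr_wpDl // sqr_ge0.
  have e2 : 0 < e / (4 * (b ^+ 2 + 1)) by rewrite divr_gt0 // mulr_gt0 // ltr_wpDl // sqr_ge0.
  have [N hN] := hc _ e1; have [N' hN'] := hc' _ e2.
  exists (maxn N N') => k l; rewrite !geq_max => /andP[Nk N'k] /andP[Nl N'l].
  have key c z : 0 <= z -> z <= e / (4 * (c ^+ 2 + 1)) -> c ^+ 2 * z <= e / 4.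
    move=> z0 /(ler_wpM2l (sqr_ge0 c)) /le_trans; apply.
    rewrite mulrA ler_pdivrMr ?mulr_gt0 ?ltr_wpDl ?sqr_ge0 //.
    by have := sqr_ge0 c; nra.
  have h1 := key a _ (b_ge0 (okform_ip1 hm) (vval_sub (hv k) (hv l))) (hN k l Nk Nl).
  have h2 := key b _ (b_ge0 (okform_ip1 hm) (vval_sub (hv' k) (hv' l))) (hN' k l N'k N'l).
  have hw : vval m (en S) (wscale a (sub (g k) (g l)) ++ wscale (- b) (sub (h k) (h l))).
    by apply: vval_cat; apply: vval_scale; exact: vval_sub.
  have := b_ge0 (okform_ip1 hm) hw; move: h1 h2; rewrite /sub !tbx; lra.
- move=> x cx; rewrite (_ : (fun k => _) = (fun k => a * te (en S) (fun j f => f (x j)) (g k)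
    + b * te (en S) (fun j f => f (x j)) (h k))).
    by apply: cvgD; apply: cvgMr; [exact: hx|exact: hx'].
  by apply/funext => k; rewrite te_cat !te_scale.
Qed.

Lemma HS_comb S F G a b : HS m S F -> HS m S G -> HS m S (fun x => a * F x + b * G x).
Proof.
have [->|S0] := eqVneq S finset.set0.
  rewrite /HS eqxx => -[c hc] [c' hc']; exists (a * c + b * c') => x.
  by rewrite hc hc'.
move=> /(HS_wapprox S0)[g hg] /(HS_wapprox S0)[h hh].
exact: wapprox_HS S0 (wapprox_comb a b hg hh).
Qed.

(** The inner product of [HS], recovered from [JS] by polarisation; the factors 1 match the shape of
    [HS_comb]. *)
Definition JB S F G := 2^-1 * (JS m S (fun x => 1 * F x + 1 * G x) - JS m S F - JS m S G).

Lemma JS_comb S F G a b : HS m S F -> HS m S G ->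
  JS m S (fun x => a * F x + b * G x) = a ^+ 2 * JS m S F + 2 * a * b * JB S F G + b ^+ 2 * JS m S G.
Proof.
have [->|S0] := eqVneq S finset.set0; first by rewrite /JB /JS eqxx => _ _; ring.
move=> /(HS_wapprox S0)[g hg] /(HS_wapprox S0)[h hh].
pose A v v' := tb (en S) (fun=> ip1 m) v v'.
have symA v v' : A v v' = A v' v by apply: tbC => _ f1 f2; exact: ip1C.
have l1 := JS_lim S0 hg; have l2 := JS_lim S0 hh.
have l3 := JS_lim S0 (wapprox_comb 1 1 hg hh).
have l4 := JS_lim S0 (wapprox_comb a b hg hh).
have l5 := @cvg_polar R a b _ _ _ _ _ _ l1 l2 l3.
have e : (fun k => a ^+ 2 * A (g k) (g k) + 2 * a * b *
   (2^-1 * (A (wscale 1 (g k) ++ wscale 1 (h k)) (wscale 1 (g k) ++ wscale 1 (h k)) - A (g k) (g k) - A (h k) (h k)))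
   + b ^+ 2 * A (h k) (h k)) = (fun k => A (wscale a (g k) ++ wscale b (h k)) (wscale a (g k) ++ wscale b (h k))).
  by apply/funext => k; move: (symA (h k) (g k)); rewrite /A !tbx => ->; field.
transitivity (limn (fun k => A (wscale a (g k) ++ wscale b (h k)) (wscale a (g k) ++ wscale b (h k)))).
  by apply/esym/cvg_lim => //; exact: l4.
by rewrite -e; apply: cvg_lim => //; exact: l5.
Qed.

Lemma JB_sqr_le S F G : HS m S F -> HS m S G -> JB S F G ^+ 2 <= JS m S F * JS m S G.
Proof.
move=> hF hG; apply: quad_disc; first exact: JS_ge0.
move=> t; have := JS_ge0 (HS_comb 1 t hF hG); rewrite JS_comb //.
by rewrite expr1n mul1r mulr1.
Qed.

End ComponentSpaces.

(** * The tensor product frame *)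

Section Frame.
Context (R : realType) (m : nat).
Hypothesis hm : (2 <= m)%N.
Variable q : nat -> {poly R}.
Hypothesis qb : orthobasis m.+1 q.
Implicit Types (f h : R -> R).
Notation mu := (@lebesgue_measure R).
Notation D01 := (`[0%R, 1%R]%classic : set R).
Notation I01 := (I mu D01).
Notation L2 := (sq mu D01).
Let M1 : measurable (D01 : set (measurableTypeR R)) := @m01 R.
Let U1 : mu D01 = 1%E := @mu01 R.

Definition idx N : seq (seq bool * nat) :=
  flatten [seq flatten [seq [seq (w, l) | l <- index_iota 0 m.+1] | w <- words i] | i <- index_iota 0 N.+1].

Lemma sum_flatten (V : nmodType) (A B : Type) (s : seq A) (G : A -> seq B) (F : B -> V) :
  \sum_(k <- flatten [seq G a | a <- s]) F k = \sum_(a <- s) \sum_(k <- G a) F k.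
Proof. by elim: s => [|a s IH] /=; rewrite ?big_nil // big_cat big_cons IH. Qed.

Lemma sum_idx (V : nmodType) N (F : seq bool * nat -> V) :
  \sum_(k <- idx N) F k = \sum_(0 <= i < N.+1) \sum_(w <- words i) \sum_(0 <= l < m.+1) F (w, l).
Proof.
rewrite /idx sum_flatten; apply: eq_bigr => i _; rewrite sum_flatten.
by apply: eq_bigr => w _; rewrite big_map.
Qed.

Lemma size_words i w : w \in words i -> size w = i.
Proof.
elim: i w => [|i IH] w /=; first by rewrite inE => /eqP ->.
by rewrite mem_cat => /orP[] /mapP[w' /IH <- ->].
Qed.

Definition lf (k : seq bool * nat) f := dc m.+1 q f k.1 k.2.
(** Set to 0 off [0,1] so as to be bounded and measurable on the whole line, because the coordinates
    of [X] lie in [0,1] only almost surely. *)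
Definition psc (k : seq bool * nat) (x : R) : R :=
  if 0 <= x <= 1 then psi q k.1 k.2 x else 0.
Definition lev (k : seq bool * nat) := size k.1.

Lemma dc_lin w l f h c : L2 f -> L2 h ->
  dc m.+1 q (fun t => f t + c * h t) w l = dc m.+1 q f w l + c * dc m.+1 q h w l.
Proof.
have cfl l' f' h' : L2 f' -> L2 h' -> cf q (fun t => f' t + c * h' t) l' = cf q f' l' + c * cf q h' l'.
  by move=> hf hh; rewrite cfD ?cfZ //; exact: (sqZ M1).
elim: w f h => [|b w IH] f h hf hh; first exact: cfl.
case: w IH => [_|b' w IH]; last first.
  rewrite !dc_cons2 -IH; [by []|exact: sq_half|exact: sq_half].
rewrite /= !cf_resid //; last by apply: (sqD M1) => //; exact: (sqZ M1).
have -> : half b (fun t => f t + c * h t) = (fun t => half b f t + c * half b h t) by [].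
rewrite cfl; [|exact: sq_half|exact: sq_half].
have -> : pr m.+1 q (fun t => f t + c * h t) = pr m.+1 q f + c *: pr m.+1 q h.
  rewrite /pr scaler_sumr -big_split; apply: eq_bigr => i _ /=.
  by rewrite cfl // scalerDl scalerA.
rewrite /halfp comp_polyD comp_polyZ ippDl ippZl.
by move: (cf q (half b f) l) (cf q (half b h) l) (ipp _ _) (ipp _ _) => x y z u; ring.
Qed.

Lemma linS_lf k : linS m (lf k).
Proof. by move=> f h c hf hh; apply: dc_lin; apply: (Sob0_L2 hm). Qed.

Definition part N f x := \sum_(k <- idx N) lf k f * psc k x.

Lemma partE N f x : 0 <= x <= 1 -> part N f x = partial m.+1 q N f x.
Proof.
by move=> hx; rewrite /part sum_idx; do 3 (apply: eq_bigr => ? _); rewrite /psc hx.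
Qed.

Lemma part_unif f : Sob0 m f -> exists2 C : R, 0 <= C &
  forall N x, 0 <= x <= 1 -> `|part N f x - f x| <= C * 2^-1 ^+ N.
Proof.
move=> hf; have [L hL] := chain_lip hm (Sob0_chain hf).
have L0 := lip_ge0 hL; exists (Num.sqrt (qbound m.+1 q) * L).
  by rewrite mulr_ge0 // sqrtr_ge0.
move=> N x hx; rewrite partE //; apply: (partial_dev qb) => //.
by case: (Sob0_L2 hm hf).
Qed.

Lemma cvg_pow2 : (fun n => (2^-1 : R) ^+ n) @ \oo --> 0.
Proof. by apply: cvg_expr; rewrite ger0_norm ?invr_ge0 // invf_lt1 // ltr1n. Qed.

Lemma part_cvg f x : Sob0 m f -> 0 <= x <= 1 -> (fun N => part N f x) @ \oo --> f x.
Proof.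
move=> hf hx; have [C C0 hC] := part_unif hf.
have h : (fun N => `|part N f x - f x|) @ \oo --> (0 : R).
  apply: (@squeeze_cvgr _ _ _ _ (fun=> 0) (fun N => C * 2^-1 ^+ N)).
  - by apply: nearW => N; rewrite normr_ge0 hC.
  - exact: cvg_cst.
  - by rewrite -[X in _ --> X](mulr0 C); apply: cvgMr; exact: cvg_pow2.
by apply/subr_cvg0; apply/norm_cvg0P.
Qed.

Lemma lf_l2 N f : Sob0 m f -> \sum_(k <- idx N) 2^-1 ^+ lev k * (lf k f * lf k f) <= l2ip f f.
Proof.
move=> hf; have := energy_le_norm qb N (Sob0_L2 hm hf).
have -> : I01 (fun t => f t ^+ 2) = l2ip f f by apply: eq_I => t _; rewrite expr2.
apply: le_trans; rewrite le_eqVlt; apply/orP; left; apply/eqP.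
rewrite sum_idx big_ltn // big_seq1; congr (_ + _).
  by apply: eq_bigr => l _; rewrite expr0 mul1r expr2.
apply: eq_bigr => i _; rewrite mulr_sumr; apply: eq_big_seq => w /size_words sw.
by rewrite mulr_sumr; apply: eq_bigr => l _; rewrite /lev sw expr2.
Qed.

Lemma lf_ip1 : exists2 C : R, 0 <= C & forall N f, Sob0 m f ->
  \sum_(k <- idx N) (4 ^+ m / 2) ^+ lev k * (lf k f * lf k f) <= C * ip1 m f f.
Proof.
have [C C0 hC] := frame_bound hm qb; exists C => // N f hf; apply: le_trans (hC N f hf).
rewrite le_eqVlt; apply/orP; left; apply/eqP.
rewrite sum_idx; apply: eq_bigr => i _; rewrite mulr_sumr; apply: eq_big_seq => w /size_words sw.
by rewrite mulr_sumr; apply: eq_bigr => l _; rewrite /lev sw expr2.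
Qed.

(** The uniform bound per level reduces any sum over the frame with level-dependent weights to a sum
    over levels. *)
Lemma psc_level N (G : nat -> R) x : (forall i, 0 <= G i) ->
  \sum_(k <- idx N) psc k x ^+ 2 * G (lev k) <= qbound m.+1 q * \sum_(0 <= i < N.+1) G i.
Proof.
move=> G0; rewrite sum_idx mulr_sumr; apply: ler_sum => i _.
rewrite (_ : \sum_(w <- words i) _ = (\sum_(w <- words i) \sum_(0 <= l < m.+1) psc (w, l) x ^+ 2) * G i).
  rewrite ler_wpM2r // /psc; case: (boolP (0 <= x <= 1)) => hx; first exact: psi_level.
  by rewrite big1 ?qbound_ge0 // => w _; rewrite big1 // => l _; rewrite expr0n.
rewrite mulr_suml; apply: eq_big_seq => w /size_words sw.
by rewrite mulr_suml; apply: eq_bigr => l _; rewrite /lev sw.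
Qed.

Lemma psi_bounded w l : exists M : R, forall x, 0 <= x <= 1 -> `|psi q w l x| <= M.
Proof.
elim: w => [|b w [M hM]] /=.
  by exists (\sum_(i < size (q l)) `|(q l)`_i|) => x hx; exact: horner_le.
exists (Num.max M 0) => x hx; case: eqP => [e|_]; last by rewrite normr0 le_max lexx orbT.
rewrite le_max hM //; move: e; case: (b); case: (leP (1 / 2) x) => // h _; rewrite ?mulr1n ?mulr0n; lra.
Qed.

Lemma psc_bounded k : exists M : R, forall x, `|psc k x| <= M.
Proof.
have [M hM] := psi_bounded k.1 k.2; exists (Num.max M 0) => x.
rewrite /psc; case: ifP => hx; rewrite le_max; first by rewrite hM.
by rewrite normr0 lexx orbT.
Qed.

Lemma measurable_psc k : measurable_fun setT (psc k).
Proof.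
apply: measurable_fun_if => //; last by apply: measurable_funTS; exact: measurable_psi.
rewrite (_ : (fun _ => _) = (fun x : R => (0 <= x) && (x <= 1))) //.
by apply: measurable_and; exact: measurable_fun_ler.
Qed.

Lemma L2_psc k : L2 (psc k).
Proof.
have [M hM] := psc_bounded k; apply: (@L2_bounded _ _ M) => [|x _]; last exact: hM.
by apply: measurable_funTS; exact: measurable_psc.
Qed.

Lemma L2_part N f : L2 (part N f).
Proof. by apply: (sq_sum M1 U1) => k; apply: (sqZ M1); exact: L2_psc. Qed.

Lemma I_part_cvg f : Sob0 m f -> (fun N => I01 (part N f)) @ \oo --> (0 : R).
Proof.
move=> hf; have [C C0 hC] := part_unif hf.
have if_ := sq_intg M1 U1 (Sob0_L2 hm hf).
have e0 : I01 f = 0 := proj2 hf.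
apply/norm_cvg0P; apply: (@squeeze_cvgr _ _ _ _ (fun=> 0) (fun N => C * 2^-1 ^+ N)).
- apply: nearW => N; have ip := sq_intg M1 U1 (L2_part N f).
  have hd : intg mu D01 (fun x => part N f x - f x) := intgB M1 ip if_.
  have -> : I01 (part N f) = I01 (fun x => part N f x - f x).
    by rewrite (I_B M1) // e0 subr0.
  rewrite normr_ge0 /=.
  apply: le_trans (le_norm_I M1 hd) _; apply: le_I_cst; first exact: intg_norm.
  by move=> x; exact: hC.
- exact: cvg_cst.
- by rewrite -[X in _ --> X](mulr0 C); apply: cvgMr; exact: cvg_pow2.
Qed.

(** The partial sums converge uniformly, so the expectations computed in the frame tend to the true
    inner product. *)
Lemma I_part_mul_cvg f h : Sob0 m f -> Sob0 m h ->
  (fun N => I01 (fun x => part N f x * part N h x)) @ \oo --> l2ip f h.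
Proof.
move=> hf hh; have [C C0 hC] := part_unif hf; have [C' C'0 hC'] := part_unif hh.
have [K K0 hK] := sob_sup0 R hm.
have bd (g : R -> R) : Sob0 m g -> exists2 B : R, 0 <= B & forall x, 0 <= x <= 1 -> `|g x| <= B.
  move=> hg; exists (Num.sqrt (K * ip1 m g g)); first exact: sqrtr_ge0.
  by move=> x hx; rewrite -sqrtr_sqr ler_wsqrtr // hK.
have [B B0 hB] := bd f hf; have [B' B'0 hB'] := bd h hh.
have Lf := Sob0_L2 hm hf; have Lh := Sob0_L2 hm hh.
have i1 N : intg mu D01 (fun x => part N f x * part N h x).
  by apply: (sqM M1); exact: L2_part.
have i2 : intg mu D01 (fun x => f x * h x) := sqM M1 Lf Lh.
apply/subr_cvg0; apply/norm_cvg0P.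
apply: (@squeeze_cvgr _ _ _ _ (fun=> 0) (fun N => (C * (C' + B') + B * C') * 2^-1 ^+ N)).
- apply: nearW => N; rewrite normr_ge0 /= -(I_B M1) //.
  have hd := intgB M1 (i1 N) i2.
  apply: le_trans (le_norm_I M1 hd) _; apply: le_I_cst; first exact: intg_norm.
  move=> x hx; have a1 := hC N x hx; have a2 := hC' N x hx.
  have b1 := hB x hx; have b2 := hB' x hx.
  have p1 : (2^-1 : R) ^+ N <= 1 by rewrite exprn_ile1 ?invr_ge0 // invf_le1 // ler1n.
  have p0 : 0 <= (2^-1 : R) ^+ N by rewrite exprn_ge0 // invr_ge0.
  have -> : part N f x * part N h x - f x * h x =
     (part N f x - f x) * part N h x + f x * (part N h x - h x) by ring.
  apply: le_trans (ler_normD _ _) _; rewrite !normrM.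
  have a3 : `|part N h x| <= C' + B'.
    rewrite -[part N h x](subrK (h x)); apply: le_trans (ler_normD _ _) _; apply: lerD => //.
    by apply: le_trans a2 _; rewrite ler_piMr.
  rewrite mulrDl; apply: lerD.
    by rewrite mulrAC; apply: ler_pM.
  by rewrite -mulrA; apply: ler_pM.
- exact: cvg_cst.
- by rewrite -[X in _ --> X](mulr0 (C * (C' + B') + B * C')); apply: cvgMr; exact: cvg_pow2.
Qed.

End Frame.

Lemma exchange_big4 (V : nmodType) (A B C E : Type) (a : seq A) (b : seq B) (c : seq C) (e : seq E)
    (F : A -> B -> C -> E -> V) :
  \sum_(i <- a) \sum_(j <- b) \sum_(k <- c) \sum_(l <- e) F i j k l =
  \sum_(k <- c) \sum_(l <- e) \sum_(i <- a) \sum_(j <- b) F i j k l.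
Proof.
transitivity (\sum_(i <- a) \sum_(k <- c) \sum_(l <- e) \sum_(j <- b) F i j k l).
  apply: eq_bigr => i _; rewrite exchange_big; apply: eq_bigr => k _ /=.
  by rewrite exchange_big.
rewrite exchange_big; apply: eq_bigr => k _ /=.
by rewrite exchange_big.
Qed.

Section TensorFrame.
Context (R : realType) (m d : nat).
Hypothesis hm : (2 <= m)%N.
Variable q : nat -> {poly R}.
Hypothesis qb : orthobasis m.+1 q.
Notation fam := ('I_d -> R -> R).
Notation vec := (seq (R * fam)).
Notation k0 := ([::], 0%N).
Notation I01 := (I (@lebesgue_measure R) `[0%R, 1%R]%classic).
Implicit Types (s : seq 'I_d) (v : vec) (nu : 'I_d -> seq bool * nat) (x : 'I_d -> R).

Definition MI N s := mi k0 (idx m N) s.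
Definition coef s nu v : R := te s (fun j => lf m q (nu j)) v.
Definition Psi s nu x : R := \prod_(j <- s) psc q (nu j) (x j).
(** The frame weights of [V] and of [lam * J] in one: each summand tensorises, and both depend only
    on the total level of the multi-index. *)
Definition W s (lam : R) nu : R :=
  \prod_(j <- s) 2^-1 ^+ lev (nu j) + lam * \prod_(j <- s) (4 ^+ m / 2) ^+ lev (nu j).

Lemma sum_coef_Psi N s v x : uniq s ->
  \sum_(nu <- MI N s) coef s nu v * Psi s nu x =
  \sum_(p <- v) p.1 * \prod_(j <- s) part m q N (p.2 j) (x j).
Proof.
move=> us; rewrite /part.
under [RHS]eq_bigr => p _ do rewrite (prod_sum_mi k0) // mulr_sumr.
rewrite exchange_big; apply: eq_bigr => nu _ /=.
rewrite /coef /te /Psi mulr_suml; apply: eq_bigr => p _.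
by rewrite big_split /= mulrA.
Qed.

Lemma coef_Psi_cvg s v x : uniq s -> vval m s v -> cube x ->
  (fun N => \sum_(nu <- MI N s) coef s nu v * Psi s nu x) @ \oo --> te s (fun j h => h (x j)) v.
Proof.
move=> us hv cx; rewrite (_ : (fun N => _) = (fun N => \sum_(p <- v) p.1 * \prod_(j <- s) part m q N (p.2 j) (x j))); last first.
  by apply/funext => N; exact: sum_coef_Psi.
apply: cvg_sum_In => p hp; apply: cvgMr; apply: cvg_prod_mem => j js.
by apply: (part_cvg hm qb) => //; exact: hv.
Qed.

(** The two one-dimensional energy bounds, tensorised separately and added. Taking the constant at
    least 1 lets one power of it cover both parts and makes it monotone in the number of
    coordinates. *)
Lemma coef_energy : exists2 C : R, 1 <= C & forall N s v (lam : R), uniq s -> vval m s v -> 0 <= lam ->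
  \sum_(nu <- MI N s) W s lam nu * coef s nu v ^+ 2 <=
  C ^+ size s * (tb s (fun=> l2ip) v v + lam * tb s (fun=> ip1 m) v v).
Proof.
have [C C0 hC] := lf_ip1 hm qb; exists (C + 1); first by rewrite lerDr.
move=> N s v lam us hv lam0.
have c0 : 0 <= C + 1 by rewrite addr_ge0.
have P1 : 1 <= (C + 1) ^+ size s by rewrite exprn_ege1 // lerDr.
have r1 k : 0 <= (2^-1 : R) ^+ lev k by rewrite exprn_ge0 // invr_ge0.
have r2 k : 0 <= (4 ^+ m / 2 : R) ^+ lev k by rewrite exprn_ge0 // divr_ge0 // exprn_ge0.
have lv k : linS m (lf m q k) := linS_lf hm q k.
have ok1 : okform m (lform (idx m N) (fun k => 2^-1 ^+ lev k) (lf m q)) := okform_lform hm _ r1 lv.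
have ok2 : okform m (lform (idx m N) (fun k => (4 ^+ m / 2) ^+ lev k) (lf m q)) := okform_lform hm _ r2 lv.
have h1 : tb s (fun=> lform (idx m N) (fun k => 2^-1 ^+ lev k) (lf m q)) v v <= tb s (fun=> l2ip) v v.
  apply: (tensor_le hm) => // [j _|j f _ hf]; first exact: okform_l2ip.
  exact: (lf_l2 hm qb).
have h2 : tb s (fun=> lform (idx m N) (fun k => (4 ^+ m / 2) ^+ lev k) (lf m q)) v v
    <= (C + 1) ^+ size s * tb s (fun=> ip1 m) v v.
  have -> : (C + 1) ^+ size s * tb s (fun=> ip1 m) v v = tb s (fun=> fun f h => (C + 1) * ip1 m f h) v v.
    by rewrite tb_scale big_const_seq count_predT iter_mulr_1.
  apply: (tensor_le hm) => // [j _|j f _ hf]; first exact: okformZ (okform_ip1 hm).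
  by apply: le_trans (hC N f hf) _; rewrite ler_wpM2r ?ip1_ge0 // lerDl.
rewrite (tb_lform k0) // in h1; rewrite (tb_lform k0) // in h2.
have V0 : 0 <= tb s (fun=> l2ip) v v by apply: (tb_ge0 _ hv) => j _; exact: okform_l2ip.
have -> : \sum_(nu <- MI N s) W s lam nu * coef s nu v ^+ 2 =
   \sum_(nu <- MI N s) \prod_(j <- s) 2^-1 ^+ lev (nu j) * (coef s nu v * coef s nu v) +
   lam * \sum_(nu <- MI N s) \prod_(j <- s) (4 ^+ m / 2) ^+ lev (nu j) * (coef s nu v * coef s nu v).
  by rewrite mulr_sumr -big_split; apply: eq_bigr => nu _ /=; rewrite /W; ring.
rewrite mulrDr; apply: lerD.
  by apply: le_trans h1 _; rewrite ler_peMl.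
by rewrite [leRHS]mulrCA ler_wpM2l.
Qed.

(** The expectation of [Psi s nu * Psi s' nu'] under the uniform law on the cube, as a product over
    all coordinates; a coordinate outside a set contributes the constant 1. *)
Definition ex s s' nu nu' : R := \prod_(j : 'I_d)
  I01 (fun t => (if j \in s then psc q (nu j) t else 1) * (if j \in s' then psc q (nu' j) t else 1)).

Lemma prod_mem s (F : 'I_d -> R) : uniq s ->
  \prod_(j <- s) F j = \prod_(j : 'I_d) (if j \in s then F j else 1).
Proof.
move=> us; rewrite (big_uniq _ us) /= big_mkcond /=.
by apply: eq_bigr => j _.
Qed.

Lemma prod_I_part N s (f B : 'I_d -> R -> R) : uniq s ->
  (forall j, sq (@lebesgue_measure R) `[0%R, 1%R]%classic (B j)) ->
  \prod_(j : 'I_d) I01 (fun t => (if j \in s then part m q N (f j) t else 1) * B j t) =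
  \sum_(nu <- MI N s) (\prod_(j <- s) lf m q (nu j) (f j)) *
     \prod_(j : 'I_d) I01 (fun t => (if j \in s then psc q (nu j) t else 1) * B j t).
Proof.
move=> us hB.
have split_prod (F : 'I_d -> R) : \prod_(j : 'I_d) F j = \prod_(j <- s) F j * \prod_(j | j \notin s) F j.
  by rewrite (bigID (mem s)) /= (big_uniq _ us).
rewrite split_prod.
have -> : \prod_(j <- s) I01 (fun t => (if j \in s then part m q N (f j) t else 1) * B j t) =
  \prod_(j <- s) \sum_(k <- idx m N) lf m q k (f j) * I01 (fun t => psc q k t * B j t).
  apply: eq_big_seq => j js; rewrite js.
  have hk k : intg (@lebesgue_measure R) `[0%R, 1%R]%classic (fun t => psc q k t * B j t).
    by apply: (sqM (@m01 R)) => //; exact: L2_psc.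
  transitivity (I01 (fun t => \sum_(k <- idx m N) lf m q k (f j) * (psc q k t * B j t))).
    apply: eq_I => t _; rewrite /part mulr_suml; apply: eq_bigr => k _; exact: esym (mulrA _ _ _).
  rewrite (I_sum (@m01 R) (@mu01 R)); last by move=> k; exact: (intgZ (@m01 R)).
  by apply: eq_bigr => k _; rewrite (I_Z (@m01 R)).
rewrite (prod_sum_mi k0) // mulr_suml; apply: eq_bigr => nu _.
rewrite big_split /= -mulrA; congr (_ * _); rewrite [in RHS]split_prod; congr (_ * _).
  by apply: eq_big_seq => j js; rewrite js.
by apply: eq_bigr => j /negbTE js; rewrite js.
Qed.

Lemma ex_sum N s s' v v' : uniq s -> uniq s' ->
  \sum_(nu <- MI N s) \sum_(nu' <- MI N s') coef s nu v * coef s' nu' v' * ex s s' nu nu' =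
  \sum_(p <- v) \sum_(p' <- v') p.1 * p'.1 * \prod_(j : 'I_d)
    I01 (fun t => (if j \in s then part m q N (p.2 j) t else 1) *
                  (if j \in s' then part m q N (p'.2 j) t else 1)).
Proof.
move=> us us'.
have L1 : sq (@lebesgue_measure R) `[0%R, 1%R]%classic (fun=> 1) := sq_cst (@m01 R) (@mu01 R) 1.
have E p p' : \prod_(j : 'I_d) I01 (fun t => (if j \in s then part m q N (p j) t else 1) *
                  (if j \in s' then part m q N (p' j) t else 1)) =
   \sum_(nu <- MI N s) \sum_(nu' <- MI N s') (\prod_(j <- s) lf m q (nu j) (p j)) *
      (\prod_(j <- s') lf m q (nu' j) (p' j)) * ex s s' nu nu'.
  rewrite (@prod_I_part N s p (fun j t => if j \in s' then part m q N (p' j) t else 1)) //; last first.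
    by move=> j; case: (j \in s') => //; exact: L2_part.
  apply: eq_bigr => nu _.
  under [RHS]eq_bigr => nu' _ do rewrite -mulrA.
  rewrite -mulr_sumr; congr (_ * _).
  have C (F G : 'I_d -> R -> R) : \prod_(j : 'I_d) I01 (fun t => F j t * G j t) = \prod_(j : 'I_d) I01 (fun t => G j t * F j t).
    by apply: eq_bigr => j _; apply: eq_I => t _; rewrite mulrC.
  rewrite (C (fun j t => if j \in s then psc q (nu j) t else 1)).
  rewrite (@prod_I_part N s' p' (fun j t => if j \in s then psc q (nu j) t else 1)) //; last first.
    by move=> j; case: (j \in s) => //; exact: L2_psc.
  apply: eq_bigr => nu' _; congr (_ * _); rewrite /ex.
  by rewrite (C (fun j t => if j \in s then psc q (nu j) t else 1)).
under [RHS]eq_bigr => p _ do under eq_bigr => p' _ do rewrite (E p.2 p'.2).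
rewrite /coef /te.
transitivity (\sum_(nu <- MI N s) \sum_(nu' <- MI N s') \sum_(p <- v) \sum_(p' <- v')
   p.1 * p'.1 * ((\prod_(j <- s) lf m q (nu j) (p.2 j)) *
      (\prod_(j <- s') lf m q (nu' j) (p'.2 j)) * ex s s' nu nu')).
  apply: eq_bigr => nu _; apply: eq_bigr => nu' _.
  rewrite mulr_suml mulr_suml; apply: eq_bigr => p _.
  rewrite mulr_sumr mulr_suml; apply: eq_bigr => p' _; ring.
rewrite exchange_big4; apply: eq_bigr => p _; apply: eq_bigr => p' _ /=.
by rewrite mulr_sumr; apply: eq_bigr => nu _; rewrite mulr_sumr.
Qed.

(** A coordinate lying in only one of the two sets integrates a centred factor against 1, hence the
    value 0: this is the orthogonality of distinct components. *)
Definition fac_lim s s' (f f' : 'I_d -> R -> R) (j : 'I_d) : R :=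
  if j \in s then (if j \in s' then l2ip (f j) (f' j) else 0) else (if j \in s' then 0 else 1).

Lemma ex_cvg s s' v v' : uniq s -> uniq s' -> vval m s v -> vval m s' v' ->
  (fun N => \sum_(nu <- MI N s) \sum_(nu' <- MI N s') coef s nu v * coef s' nu' v' * ex s s' nu nu')
  @ \oo --> \sum_(p <- v) \sum_(p' <- v') p.1 * p'.1 * \prod_(j : 'I_d) fac_lim s s' p.2 p'.2 j.
Proof.
move=> us us' hv hv'.
rewrite (_ : (fun N => _) = (fun N => \sum_(p <- v) \sum_(p' <- v') p.1 * p'.1 * \prod_(j : 'I_d)
    I01 (fun t => (if j \in s then part m q N (p.2 j) t else 1) *
                  (if j \in s' then part m q N (p'.2 j) t else 1)))); last first.
  by apply/funext => N; exact: ex_sum.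
apply: cvg_sum_In => p hp; apply: cvg_sum_In => p' hp'; apply: cvgMr.
apply: cvg_prod_mem => j _; rewrite /fac_lim.
case: ifPn => js; case: ifPn => js'.
- by apply: (I_part_mul_cvg hm qb (hv _ hp _ js) (hv' _ hp' _ js')).
- rewrite (_ : (fun N => _) = (fun N => I01 (part m q N (p.2 j)))).
    by apply: (I_part_cvg hm qb (hv _ hp _ js)).
  by apply/funext => N; apply: eq_I => t _; rewrite mulr1.
- rewrite (_ : (fun N => _) = (fun N => I01 (part m q N (p'.2 j)))).
    by apply: (I_part_cvg hm qb (hv' _ hp' _ js')).
  by apply/funext => N; apply: eq_I => t _; rewrite mul1r.
- have -> : I01 (fun=> 1 * 1) = 1 by rewrite mulr1 (I_cst (@m01 R) (@mu01 R)).
  exact: cvg_cst.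
Qed.

Lemma ex_cvg_same s v v' : uniq s -> vval m s v -> vval m s v' ->
  (fun N => \sum_(nu <- MI N s) \sum_(nu' <- MI N s) coef s nu v * coef s nu' v' * ex s s nu nu')
  @ \oo --> tb s (fun=> l2ip) v v'.
Proof.
move=> us hv hv'; have := ex_cvg us us hv hv'.
rewrite (_ : \sum_(p <- v) _ = tb s (fun=> l2ip) v v') //.
rewrite /tb; apply: eq_bigr => p _; apply: eq_bigr => p' _; congr (_ * _).
rewrite prod_mem //; apply: eq_bigr => j _; by rewrite /fac_lim; case: (j \in s).
Qed.

Lemma ex_cvg_diff s s' v v' j : uniq s -> uniq s' -> vval m s v -> vval m s' v' ->
  (j \in s) != (j \in s') ->
  (fun N => \sum_(nu <- MI N s) \sum_(nu' <- MI N s') coef s nu v * coef s' nu' v' * ex s s' nu nu')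
  @ \oo --> (0 : R).
Proof.
move=> us us' hv hv' jj; have := ex_cvg us us' hv hv'.
rewrite (_ : \sum_(p <- v) _ = 0) //.
rewrite big1 // => p _; rewrite big1 // => p' _.
rewrite (bigD1 j) //= /fac_lim; move: jj; case: (j \in s); case: (j \in s') => //= _;
  by rewrite mul0r mulr0.
Qed.

End TensorFrame.

(** * Diagonal of the reproducing kernel *)

Section KernelBound.
Context (R : realType) (m : nat).
Hypothesis hm : (2 <= m)%N.

(* With a = lam^(1/2m), the inverse weight at level i is a^-1 phi (a 2^i). *)
Definition phi (z : R) := z / (1 + z ^+ (2 * m)).

Lemma phi_le z : 0 < z -> phi z <= z /\ phi z <= z^-1.
Proof.
move=> z0; have p0 : 0 <= z ^+ (2 * m) by rewrite exprn_ge0 // ltW.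
have p1 : 0 < 1 + z ^+ (2 * m) by rewrite ltr_pwDl.
split; rewrite /phi ler_pdivrMr //.
  by rewrite ler_peMr ?(ltW z0) // lerDl.
rewrite -(@ler_pM2l _ z) // mulrA mulfV ?lt0r_neq0 // mul1r.
case: (leP 1 z) => h; last first.
  by apply: le_trans (_ : 1 <= _); [rewrite -expr2 expr_le1 // ltW|rewrite lerDl].
apply: le_trans (_ : z ^+ (2 * m) <= _); last by rewrite lerDr.
rewrite -expr2; apply: ler_weXn2l => //.
by rewrite -[X in (X <= _)%N]muln1 leq_mul2l /= ltnW.
Qed.

(** [phi] is below both [z] and [1/z], so the dyadic sum is geometric on either side of 1. The right
    side is chosen to survive the passage from [2 * z] to [z]: for z in [1/2, 1[ this is
    [1/z <= 4 - 3 z], i.e. (3z - 1)(z - 1) <= 0. *)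
Lemma phi_sum M z : 0 < z ->
  \sum_(0 <= i < M) phi (z * 2 ^+ i) <= if 1 <= z then 2 / z else 4 - 2 * z.
Proof.
elim: M z => [|M IH] z z0.
  rewrite big_geq //; case: (leP 1 z) => h; [by rewrite divr_ge0 // ltW|lra].
rewrite big_nat_recl // expr0 mulr1.
have -> : \sum_(0 <= i < M) phi (z * 2 ^+ i.+1) = \sum_(0 <= i < M) phi ((2 * z) * 2 ^+ i).
  by apply: eq_bigr => i _; rewrite exprS mulrA [z * 2]mulrC.
have z2 : 0 < 2 * z by rewrite mulr_gt0.
have := IH _ z2; have [h1 h2] := phi_le z0.
case: (leP 1 z) => hz.
  have -> : 1 <= 2 * z by lra.
  have -> : 2 / (2 * z) = z^-1 by field; rewrite lt0r_neq0.
  have -> : 2 / z = z^-1 + z^-1 by field; rewrite lt0r_neq0.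
  lra.
case: (leP 1 (2 * z)) => hz2 h3; last by lra.
have e : 2 / (2 * z) = z^-1 by field; rewrite lt0r_neq0.
rewrite e in h3.
have : z^-1 <= 4 - 3 * z.
  by rewrite -(@ler_pM2l _ z) // mulfV ?lt0r_neq0 //; nra.
lra.
Qed.

(** For [z >= 1] this weakens [1/z], for [z < 1] it weakens a constant. The power keeps just enough
    decay in [z] to sum over the levels of the other coordinates. *)
Lemma phi_sum_powR M z (eta : R) : 0 < z -> 0 <= eta <= 1 ->
  \sum_(0 <= i < M) phi (z * 2 ^+ i) <= 4 * z `^ (- eta).
Proof.
move=> z0 /andP[e0 e1]; apply: le_trans (phi_sum M z0) _.
case: (leP 1 z) => h.
  have h2 : z^-1 <= z `^ (- eta).
    rewrite -(powR_inv1 (ltW z0)); apply: ler_powR => //; lra.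
  apply: le_trans (_ : 2 * z `^ (- eta) <= _); first by rewrite ler_wpM2l.
  by rewrite ler_wpM2r ?powR_ge0 // ler_nat.
have h2 : 1 <= z `^ (- eta).
  rewrite powRN invr_ge1 ?unitfE ?lt0r_neq0 ?powR_gt0 //.
  apply: le_trans (_ : 1 `^ eta <= _); last by rewrite powR1.
  by apply: ge0_ler_powR => //; rewrite ?nnegrE ltW.
by apply: le_trans (_ : 4 * 1 <= _); [lra|rewrite ler_wpM2l].
Qed.

Lemma geo_sum_le (c : R) n : 0 <= c -> c < 1 -> \sum_(0 <= i < n) c ^+ i <= (1 - c)^-1.
Proof.
move=> c0 c1; have h : 0 < 1 - c by rewrite subr_gt0.
rewrite -(@ler_pM2l _ (1 - c)) // mulfV ?lt0r_neq0 //.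
have -> : (1 - c) * \sum_(0 <= i < n) c ^+ i = 1 - c ^+ n.
  rewrite big_mkord; have := subrX1 c n; move=> e.
  by rewrite -[1 - c ^+ n]opprB e -mulNr opprB.
by rewrite gerBl exprn_ge0.
Qed.

(** From exp(x) >= 1 + x; a geometric series of ratio 2^-eta thus sums to a constant over eta. *)
Lemma pow2_gap (eta : R) : 0 < eta <= 1 ->
  [/\ 0 < 2 `^ (- eta), 2 `^ (- eta) < 1 &
      (1 - 2 `^ (- eta))^-1 <= (1 + ln 2) / ln 2 * eta^-1].
Proof.
move=> /andP[e0 e1]; have l2 : 0 < ln (2 : R) by rewrite ln_gt0 // ltr1n.
have p0 : 0 < (2 : R) `^ (- eta) by rewrite powR_gt0.
have h : 1 + eta * ln 2 <= (2 : R) `^ eta.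
  by rewrite /powR ifF ?pnatr_eq0 //; exact: expR_ge1Dx.
have el : 0 < eta * ln 2 by rewrite mulr_gt0.
have q0 : 0 < (2 : R) `^ eta by rewrite powR_gt0.
have c1 : (2 : R) `^ (- eta) <= (1 + eta * ln 2)^-1.
  by rewrite powRN lef_pV2 // posrE ?ltr_wpDr // ltW.
have g : eta * ln 2 / (1 + ln 2) <= 1 - 2 `^ (- eta).
  apply: le_trans (_ : eta * ln 2 / (1 + eta * ln 2) <= _).
    rewrite ler_pM2l // lef_pV2 ?posrE ?addr_gt0 // lerD2l ler_piMl // ltW //.
  have -> : eta * ln 2 / (1 + eta * ln 2) = 1 - (1 + eta * ln 2)^-1.
    by field; rewrite lt0r_neq0 // addr_gt0.
  by rewrite lerD2l lerN2.
have g0 : 0 < eta * ln 2 / (1 + ln 2) by rewrite divr_gt0 // addr_gt0.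
split=> //; first by rewrite -subr_gt0; exact: lt_le_trans g.
have -> : (1 + ln 2) / ln 2 * eta^-1 = (eta * ln 2 / (1 + ln 2))^-1.
  by field; rewrite !lt0r_neq0 // addr_gt0.
by rewrite lef_pV2 // posrE; exact: lt_le_trans g.
Qed.

Variables (d : nat) (q : nat -> {poly R}).
Implicit Types (s : seq 'I_d) (x : 'I_d -> R).

(** [n] is the number of coordinates. The value 1 at 0 belongs to the intercept and yields its
    parametric rate. *)
Definition kappa (n : nat) (lam : R) : R :=
  if n is n'.+1 then lam `^ (- (1 / (2 * m%:R))) * (- ln lam) ^+ n' else 1.

Lemma W_pow s (lam : R) (nu : 'I_d -> seq bool * nat) :
  W m s lam nu = 2^-1 ^+ (\sum_(j <- s) lev (nu j)) + lam * (4 ^+ m / 2) ^+ (\sum_(j <- s) lev (nu j)).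
Proof. by rewrite /W !prodrXr. Qed.

Lemma W_gt0 s (lam : R) (nu : 'I_d -> seq bool * nat) : 0 < lam -> 0 < W m s lam nu.
Proof.
by move=> l0; rewrite W_pow addr_gt0 // ?mulr_gt0 // exprn_gt0 ?invr_gt0 // divr_gt0 // exprn_gt0.
Qed.

Lemma inv_weight (a lam : R) n : 0 < a -> a ^+ (2 * m) = lam ->
  (2^-1 ^+ n + lam * (4 ^+ m / 2) ^+ n)^-1 = a^-1 * phi (a * 2 ^+ n).
Proof.
move=> a0 <-; have p2 : 0 < (2 : R) ^+ n by rewrite exprn_gt0.
have e : (4 ^+ m / 2 : R) ^+ n = (2 ^+ n) ^+ (2 * m) / 2 ^+ n.
  rewrite expr_div_n; congr (_ / _).
  have -> : 4 = 2 ^+ 2 :> R by rewrite expr2 -natrM.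
  by rewrite -!exprM; congr (_ ^+ _); rewrite mulnA mulnC.
rewrite e exprVn /phi exprMn.
have t0 : 0 < 1 + a ^+ (2 * m) * (2 ^+ n) ^+ (2 * m).
  by rewrite ltr_pwDl // mulr_ge0 // exprn_ge0 // ltW.
by field; rewrite !lt0r_neq0.
Qed.

(* Sum over the first coordinate by phi <= 4 z^-eta, the others as geometric
   series of ratio 2^-eta; eta = 1 / (- ln lam) makes the loss a^-eta bounded
   while each series contributes a factor - ln lam. *)
Lemma kernel_bound n : exists2 C : R, 0 < C & forall N s x (lam : R), uniq s -> size s = n ->
  0 < lam -> 1 <= - ln lam ->
  \sum_(nu <- MI m N s) Psi q s nu x ^+ 2 / W m s lam nu <= C * kappa n lam.
Proof.
set Q := qbound m.+1 q; have Q0 : 0 <= Q := qbound_ge0 _ _.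
case: n => [|n].
  exists 1 => // N [|//] x lam _ _ l0 _.
  rewrite /MI /mi big_seq1 /Psi big_nil expr1n mul1r W_pow big_nil !expr0 mulr1 mulr1.
  by rewrite invf_le1 ?lerDl ?(ltW l0) // addr_gt0.
pose K0 : R := (1 + ln 2) / ln 2.
have K00 : 0 < K0 by rewrite /K0 divr_gt0 // ?addr_gt0 // ln_gt0 // ltr1n.
pose C := (Q * 4 * expR 1 * (Q * K0) ^+ n).
have C0 : 0 <= C.
  have k1 := ltW K00; have e1 := @expR_ge0 R 1.
  by rewrite /C; apply: mulr_ge0; [rewrite !mulr_ge0|rewrite exprn_ge0 // mulr_ge0].
exists (C + 1); first by rewrite ltr_wpDl.
move=> N [//|j0 s] x lam /= /andP[js us] [sn] l0 L1.
set L := - ln lam in L1 *.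
have L0 : 0 < L by rewrite (lt_le_trans _ L1).
pose eta := L^-1.
have he : 0 < eta <= 1 by rewrite invr_gt0 L0 /= invf_le1.
have [c0 c1 cg] := pow2_gap he.
set c := 2 `^ (- eta) in c0 c1 cg.
pose a := lam `^ (1 / (2 * m%:R)).
have a0 : 0 < a by rewrite powR_gt0.
have m0 : (m%:R : R) != 0 by rewrite pnatr_eq0 -lt0n ltnW.
have aE : a ^+ (2 * m) = lam.
  rewrite /a -powR_mulrn ?powR_ge0 // -powRrM natrM (_ : 1 / _ * _ = 1) ?powRr1 ?ltW //.
  by field.
have ae : a `^ (- eta) <= expR 1.
  rewrite /a -powRrM /powR ifF ?lt0r_neq0 //; last by apply/negbTE; rewrite lt0r_neq0.
  rewrite ler_expR (_ : 1 / (2 * m%:R) * - eta * ln lam = 1 / (2 * m%:R)); last first.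
    have -> : ln lam = - L by rewrite opprK.
    by rewrite /eta; field; rewrite m0 lt0r_neq0.
  rewrite ler_pdivrMr ?mulr_gt0 ?ltr0n ?(ltnW hm) // mul1r.
  by rewrite -natrM ler1n muln_gt0 /= ltnW.
(* When the levels of the other coordinates add up to [r], the first coordinate sums [phi] along
   [a 2^r 2^i]; the resulting [(a 2^r)^-eta] splits into [a^-eta] and one factor [c] per level of
   the others. *)
have step1 : \sum_(nu <- MI m N (j0 :: s)) Psi q (j0 :: s) nu x ^+ 2 / W m (j0 :: s) lam nu <=
   \sum_(nu <- MI m N s) Psi q s nu x ^+ 2 * (Q * (a^-1 * (4 * (a `^ (- eta) * c ^+ (\sum_(j <- s) lev (nu j)))))).
  rewrite /MI sum_mi exchange_big; apply: ler_sum => nu _.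
  set r := \sum_(j <- s) lev (nu j).
  pose G i := (2^-1 ^+ (i + r) + lam * (4 ^+ m / 2) ^+ (i + r))^-1.
  have G0 i : 0 <= G i.
    have h1 : 0 <= (2^-1 : R) ^+ (i + r) by rewrite exprn_ge0 // invr_ge0.
    have h2 : 0 <= (4 ^+ m / 2 : R) ^+ (i + r) by rewrite exprn_ge0 // divr_ge0 // exprn_ge0.
    by rewrite invr_ge0 addr_ge0 // mulr_ge0 // ltW.
  have -> : \sum_(k <- idx m N) Psi q (j0 :: s) (upd nu j0 k) x ^+ 2 / W m (j0 :: s) lam (upd nu j0 k) =
     Psi q s nu x ^+ 2 * \sum_(k <- idx m N) psc q k (x j0) ^+ 2 * G (lev k).
    rewrite mulr_sumr; apply: eq_bigr => k _.
    have -> : Psi q (j0 :: s) (upd nu j0 k) x = psc q k (x j0) * Psi q s nu x.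
      rewrite /Psi big_cons {1}/upd eqxx.
      by rewrite (prod_upd (fun j k => psc q k (x j))).
    have -> : W m (j0 :: s) lam (upd nu j0 k) = (G (lev k))^-1.
      rewrite W_pow /G invrK big_cons {1 3}/upd eqxx.
      have -> : (\sum_(j <- s) lev (upd nu j0 k j) = r)%N; last by [].
      apply: eq_big_seq => j hj; rewrite /upd ifN //.
      by apply: contraNneq js => <-.
    by rewrite exprMn invrK; ring.
  apply: ler_wpM2l; first exact: sqr_ge0.
  apply: le_trans (psc_level m q N (x j0) G0) _; apply: ler_wpM2l => //.
  have -> : \sum_(0 <= i < N.+1) G i = a^-1 * \sum_(0 <= i < N.+1) phi (a * 2 ^+ r * 2 ^+ i).
    rewrite mulr_sumr; apply: eq_bigr => i _; rewrite /G (inv_weight _ a0 aE).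
    by rewrite exprD mulrAC mulrA.
  apply: ler_wpM2l; first by rewrite invr_ge0 ltW.
  have z0 : 0 < a * 2 ^+ r by rewrite mulr_gt0 // exprn_gt0.
  have he' : 0 <= eta <= 1 by case/andP: he => /ltW -> ->.
  apply: le_trans (phi_sum_powR N.+1 z0 he') _; rewrite ler_wpM2l //.
  rewrite powRM ?(ltW a0) ?exprn_ge0 // ler_wpM2l ?powR_ge0 //.
  rewrite le_eqVlt; apply/orP; left; apply/eqP.
  by rewrite -powR_mulrn // -powRrM mulrC powRrM powR_mulrn ?powR_ge0.
apply: le_trans step1 _.
(* The weight is now multiplicative, so the sum factors into one geometric series per remaining
   coordinate. *)
have step2 : \sum_(nu <- MI m N s) Psi q s nu x ^+ 2 * c ^+ (\sum_(j <- s) lev (nu j)) <= (Q * K0) ^+ n * L ^+ n.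
  have -> : \sum_(nu <- MI m N s) Psi q s nu x ^+ 2 * c ^+ (\sum_(j <- s) lev (nu j)) =
     \prod_(j <- s) \sum_(k <- idx m N) psc q k (x j) ^+ 2 * c ^+ lev k.
    rewrite (prod_sum_mi ([::], 0%N)) //; apply: eq_bigr => nu _.
    by rewrite big_split /= /Psi prodrXl prodrXr.
  have hj j : 0 <= \sum_(k <- idx m N) psc q k (x j) ^+ 2 * c ^+ lev k <= Q * K0 * L.
    apply/andP; split; first by apply: sumr_ge0 => k _; rewrite mulr_ge0 ?sqr_ge0 // exprn_ge0 // ltW.
    apply: le_trans (@psc_level R m q N (fun i => c ^+ i) (x j) _) _.
      by move=> i; rewrite exprn_ge0 // ltW.
    rewrite -mulrA; apply: ler_wpM2l => //.
    apply: le_trans (geo_sum_le _ (ltW c0) c1) _.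
    by rewrite /eta invrK in cg.
  rewrite -exprMn -sn; elim: (s) => [|j s' IH]; first by rewrite big_nil expr0.
  rewrite big_cons /= exprS; have /andP[h1 h2] := hj j; apply: ler_pM => //.
  by apply: prodr_ge0 => j' _; case/andP: (hj j').
have P0 : 0 <= \sum_(nu <- MI m N s) Psi q s nu x ^+ 2 * c ^+ (\sum_(j <- s) lev (nu j)).
  by apply: sumr_ge0 => nu _; rewrite mulr_ge0 ?sqr_ge0 // exprn_ge0 // ltW.
rewrite (_ : \sum_(nu <- MI m N s) _ = (Q * 4) * a^-1 * a `^ (- eta) *
   \sum_(nu <- MI m N s) Psi q s nu x ^+ 2 * c ^+ (\sum_(j <- s) lev (nu j))); last first.
  by rewrite mulr_sumr; apply: eq_bigr => nu _; ring.
have ai : a^-1 = lam `^ (- (1 / (2 * m%:R))) by rewrite powRN.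
have ai0 : 0 <= a^-1 by rewrite invr_ge0 ltW.
have k0 : 0 <= a^-1 * L ^+ n by rewrite mulr_ge0 // exprn_ge0 // ltW.
rewrite /kappa -ai -/L.
apply: (@le_trans _ _ (Q * 4 * a^-1 * expR 1 * ((Q * K0) ^+ n * L ^+ n))).
  apply: ler_pM => //; first by rewrite !mulr_ge0 // powR_ge0.
  by rewrite ler_wpM2l // !mulr_ge0.
rewrite mulrDl mul1r -[leLHS]addr0; apply: lerD => //.
by rewrite le_eqVlt; apply/orP; left; apply/eqP; rewrite /C; ring.
Qed.

End KernelBound.



(** * Independent random variables *)

Section Independence.
Import HBSimple HBNNSimple.
Context (R : realType) (d0 : measure_display) (T : measurableType d0) (P : probability T R).
Context (J : eqType) (Z : J -> T -> R).
Hypothesis mZ : forall i, measurable_fun setT (Z i).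
Hypothesis hZ : mutual_indep P Z.
Let MT : measurable (setT : set T) := measurableT.
Let PT : P setT = 1%E := probability_setT P.
Notation intP := (intg P setT).
Notation IP := (I P setT).
Implicit Types (s : seq J) (f g : J -> R -> R).

Lemma I_indic (A : set T) : measurable A -> IP (\1_A) = fine (P A).
Proof. by move=> mA; rewrite /I /Rintegral integral_indic // setIT. Qed.

Lemma intg_indic (A : set T) : measurable A -> intP (\1_A).
Proof. by move=> mA; rewrite /intg; apply: integrable_indic => //; rewrite PT ltry. Qed.

(* Passing from indicators to h by monotone approximation with simple functions. *)
Lemma mul_indep_ge0 (X W : T -> R) (h : R -> R) : measurable_fun setT X ->
  measurable_fun setT h -> (forall t, 0 <= h t) -> intP (h \o X) ->
  (forall w, 0 <= W w) -> intP W ->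
  (forall B, measurable B -> IP (fun w => \1_B (X w) * W w) = IP (\1_B \o X) * IP W) ->
  intP (fun w => h (X w) * W w) /\ IP (fun w => h (X w) * W w) = IP (h \o X) * IP W.
Proof.
move=> mX mh h0 ih W0 iW hB.
have mW := intg_meas iW.
have mh' : measurable_fun (setT : set (measurableTypeR R)) (EFin \o h) by exact/measurable_EFinP.
pose g := nnsfun_approx measurableT mh'.
have g0 n t : 0 <= g n t by [].
have gnd n k t : (n <= k)%N -> g n t <= g k t by move=> nk; have /lefP := @nd_nnsfun_approx _ _ _ _ measurableT _ mh' n k nk; apply.
have gcv t : (EFin \o g^~ t) @ \oo --> (h t)%:E.
  by apply: (@cvg_nnsfun_approx _ _ _ _ measurableT _ mh') => // x _; rewrite lee_fin.
have mc (f : R -> R) : measurable_fun setT f -> measurable_fun setT (f \o X).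
  by move=> mf; exact: measurableT_comp.
have iB B : measurable B -> intP (fun w => \1_B (X w) * W w).
  move=> mB; apply: (le_intg MT _ _ iW) => //.
    by apply: measurable_funM => //; apply: (mc (\1_B)); exact: measurable_indic.
  move=> w _; rewrite normrM (ger0_norm (W0 w)) indicE.
  by case: (X w \in B); rewrite ?normr1 ?mul1r // normr0 mul0r.
have iB1 B : measurable B -> intP (fun w => \1_B (X w)).
  move=> mB; apply: (le_intg MT _ _ (intg_cst MT PT 1)) => //.
    by apply: (mc (\1_B)); exact: measurable_indic.
  by move=> w _; rewrite indicE; case: (X w \in B); rewrite ?normr1 // normr0.
have step n : intP (fun w => g n (X w)) /\ intP (fun w => g n (X w) * W w) /\
    IP (fun w => g n (X w) * W w) = IP (fun w => g n (X w)) * IP W.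
  have [k [c [A [mA gE]]]] : exists k (c : 'I_k -> R) (A : 'I_k -> set R), (forall i, measurable (A i)) /\
      forall t, g n t = \sum_(i < k) c i * \1_(A i) t.
    pose r := finmap.enum_fset (fset_set (range (g n))).
    exists (size r), (fun i => r`_i), (fun i => g n @^-1` [set r`_i]); split; last by move=> t; rewrite [LHS]fimfunEord.
    move=> i; have mg : measurable_fun (setT : set (measurableTypeR R)) (g n) by exact: measurable_funP.
    by rewrite -[X in measurable X]setTI; exact: (mg measurableT).
  have e1 : (fun w => g n (X w)) = (fun w => \sum_(i < k) c i * \1_(A i) (X w)).
    by apply/funext => w; exact: gE.
  have e2 : (fun w => g n (X w) * W w) = (fun w => \sum_(i < k) c i * (\1_(A i) (X w) * W w)).
    by apply/funext => w; rewrite gE mulr_suml; apply: eq_bigr => i _; rewrite mulrA.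
  rewrite e2 e1; split; [|split].
  - by apply: (intg_sum MT PT) => i; apply: (intgZ MT); exact: iB1.
  - by apply: (intg_sum MT PT) => i; apply: (intgZ MT); exact: iB.
  - rewrite !(I_sum MT PT) => [|i|i]; last 2 first.
    + by apply: (intgZ MT); exact: iB1.
    + by apply: (intgZ MT); exact: iB.
    rewrite mulr_suml; apply: eq_bigr => i _.
    rewrite !(I_Z MT) ?hB ?mulrA //; [exact: iB1|exact: iB].
have gcv' w : (fun n => g n (X w)) @ \oo --> h (X w).
  by have /fine_cvg := gcv (X w).
have lim (V : T -> R) : measurable_fun setT V -> (forall w, 0 <= V w) ->
   (fun n => \int[P]_w (g n (X w) * V w)%:E)%E @ \oo --> (\int[P]_w (h (X w) * V w)%:E)%E.
  move=> mV V0; have e w : ((h (X w) * V w)%:E = limn (fun n => (g n (X w) * V w)%:E))%E.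
    apply/esym/cvg_lim => //; apply: cvg_EFin; first by apply: nearW.
    by apply: cvgMl; exact: gcv'.
  under [X in _ --> X]eq_integral do rewrite e.
  apply: (cvg_monotone_convergence MT).
  - move=> n; apply/measurable_EFinP; apply: measurable_funM => //.
    have mg : measurable_fun (setT : set (measurableTypeR R)) (g n) by exact: measurable_funP.
    exact: mc.
  - by move=> n w _; rewrite lee_fin mulr_ge0.
  - by move=> w _ n k nk; rewrite lee_fin ler_wpM2r // gnd.
have fin (V : T -> R) : intP V -> (\int[P]_w (V w)%:E = (IP V)%:E)%E.
  by move=> iV; rewrite /I /Rintegral fineK //; exact: integrable_fin_num.
have l1 : (fun n => IP (fun w => g n (X w))) @ \oo --> IP (h \o X).
  have := lim (fun=> 1) (@measurable_cst _ _ _ _ _ _) (fun=> ler01).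
  under eq_fun => n do under eq_integral do rewrite mulr1.
  under [X in _ --> X]eq_integral do rewrite mulr1.
  rewrite (fin (h \o X)) // => /fine_cvg; exact.
have key : (\int[P]_w (h (X w) * W w)%:E = (IP (h \o X) * IP W)%:E)%E.
  have l2 := lim W mW W0.
  have l3 : (fun n => \int[P]_w (g n (X w) * W w)%:E)%E @ \oo --> ((IP (h \o X) * IP W)%:E)%E.
    rewrite (_ : (fun n => _) = (fun n => (IP (fun w => g n (X w)) * IP W)%:E)).
      by apply: cvg_EFin; [exact: nearW|apply: cvgMl].
    by apply/funext => n; have [_ [i2 e2]] := step n; rewrite fin // e2.
  exact: (cvg_unique _ l2 l3).
have mhW : measurable_fun setT (fun w => h (X w) * W w) by apply: measurable_funM => //; exact: mc.
have iN : intP (fun w => h (X w) * W w).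
  apply/integrableP; split; first exact/measurable_EFinP.
  under eq_integral => w _ do rewrite /= ger0_norm ?mulr_ge0 //.
  by rewrite key ltry.
by split => //; rewrite /I /Rintegral key.
Qed.
Definition prodI s f := intP (fun w => \prod_(i <- s) f i (Z i w)) /\
  IP (fun w => \prod_(i <- s) f i (Z i w)) = \prod_(i <- s) IP (fun w => f i (Z i w)).

Definition fupd f i (h : R -> R) : J -> R -> R := fun i' => if i' == i then h else f i'.

Lemma prod_fupd (G : J -> (R -> R) -> R) s f i h : i \notin s ->
  \prod_(j <- s) G j (fupd f i h j) = \prod_(j <- s) G j (f j).
Proof.
move=> si; apply: eq_big_seq => j js; rewrite /fupd ifN //.
by apply: contraNneq si => <-.
Qed.

Lemma prodI_cat s i s' f : prodI (s ++ i :: s') f <->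
  intP (fun w => f i (Z i w) * \prod_(j <- s ++ s') f j (Z j w)) /\
  IP (fun w => f i (Z i w) * \prod_(j <- s ++ s') f j (Z j w)) =
    IP (fun w => f i (Z i w)) * \prod_(j <- s ++ s') IP (fun w => f j (Z j w)).
Proof.
have e (F : J -> R) : \prod_(j <- s ++ i :: s') F j = F i * \prod_(j <- s ++ s') F j.
  by rewrite !big_cat big_cons /= mulrCA.
rewrite /prodI e; have -> // : (fun w => \prod_(j <- s ++ i :: s') f j (Z j w)) =
  (fun w => f i (Z i w) * \prod_(j <- s ++ s') f j (Z j w)).
by apply/funext => w; rewrite e.
Qed.

Lemma measurable_comp_Z (h : R -> R) i : measurable_fun setT h -> measurable_fun setT (fun w => h (Z i w)).
Proof. by move=> mh; exact: measurableT_comp. Qed.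

Definition indf (h : R -> R) := exists2 B : set R, measurable B & h = \1_B.

Lemma prodI_indic s f : uniq s -> (forall i, i \in s -> indf (f i)) ->
  prodI s f.
Proof.
move=> us hf; pose B i := if pselect (i \in s) is left h then projT1 (cid2 (hf i h)) else setT.
have mB i : measurable (B i) by rewrite /B; case: pselect => // h; case: cid2.
have fB i : i \in s -> f i = \1_(B i) by move=> h; rewrite /B; case: pselect => // h'; case: cid2.
have mZB i : measurable (Z i @^-1` B i) by rewrite -[X in measurable X]setTI; exact: mZ.
have mI : measurable (\big[setI/setT]_(i <- s) (Z i @^-1` B i)).
  by apply: bigsetI_measurable.
have e : (fun w => \prod_(i <- s) f i (Z i w)) = \1_(\big[setI/setT]_(i <- s) (Z i @^-1` B i)).
  apply/funext => w; transitivity (\prod_(i <- s) (\1_(Z i @^-1` B i) w : R)).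
    by apply: eq_big_seq => i /fB ->.
  elim: (s) => [|i s' IH]; first by rewrite !big_nil indicT.
  by rewrite !big_cons IH indicI.
have e' i : i \in s -> (fun w => f i (Z i w)) = \1_(Z i @^-1` B i).
  by move=> /fB ->.
split; rewrite e; first exact: intg_indic.
rewrite I_indic // hZ //.
rewrite [RHS](eq_big_seq (fun i => fine (P (Z i @^-1` B i)))); last first.
  by move=> i /e' ->; rewrite I_indic.
elim: (s) => [|i s' IH]; first by rewrite !big_nil.
rewrite !big_cons fineM ?IH //; first by rewrite fin_num_measure.
elim: (s') => [|i' s'' IH']; first by rewrite !big_nil.
by rewrite big_cons fin_numM // fin_num_measure.
Qed.

Definition okf i (h : R -> R) := measurable_fun setT h /\ intP (fun w => h (Z i w)).

(** Mutual independence is given for indicators. They are replaced by nonnegative functions one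
    index at a time: the induction hypothesis with [i] moved to the indicator part is the premise of
    [mul_indep_ge0]. *)
Lemma prodI_ge0 s s' f : uniq (s ++ s') ->
  (forall i, i \in s -> okf i (f i) /\ forall t, 0 <= f i t) ->
  (forall i, i \in s' -> indf (f i)) -> prodI (s ++ s') f.
Proof.
elim: s s' f => [|i s IH] s' f us hs hs'; first exact: prodI_indic.
have [[mf If] f0] := hs i (mem_head _ _).
have hsT j : j \in s -> okf j (f j) /\ forall t, 0 <= f j t.
  by move=> js; apply: hs; rewrite inE js orbT.
move: us => /= /andP[nis us].
have usi : uniq (s ++ i :: s') by rewrite uniq_catC /= mem_cat orbC -mem_cat nis uniq_catC.
have ns : i \notin s by move: nis; rewrite mem_cat negb_or => /andP[].
have ns' : i \notin s' by move: nis; rewrite mem_cat negb_or => /andP[].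
pose W w := \prod_(j <- s ++ s') f j (Z j w).
have [iW eW] := IH s' f us hsT hs'.
apply/(prodI_cat [::]) => /=; rewrite -eW.
apply: (@mul_indep_ge0 (Z i) W (f i)) => //.
  move=> w; rewrite /W; rewrite big_seq; apply: prodr_ge0 => j; rewrite mem_cat => /orP[/hsT[]//|/hs'[B _ ->]].
  by rewrite indicE.
move=> B mB; rewrite /W eW.
have hf1 j : j \in s -> okf j (fupd f i (\1_B) j) /\ forall t, 0 <= fupd f i (\1_B) j t.
  rewrite /fupd => js; case: eqP js => [->|_ js]; [by rewrite (negbTE ns)|exact: hsT].
have hf2 j : j \in i :: s' -> indf (fupd f i (\1_B) j).
  rewrite inE /fupd => /orP[/eqP -> | js]; first by exists B; rewrite ?eqxx.
  by case: eqP js => [->|_ js]; [rewrite (negbTE ns')|exact: hs'].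
have /prodI_cat[_] := IH _ _ usi hf1 hf2.
have e w : \prod_(j <- s ++ s') fupd f i (\1_B) j (Z j w) = W w.
  by rewrite (prod_fupd (fun j h => h (Z j w))).
rewrite (prod_fupd (fun j h => IP (fun w => h (Z j w)))) //.
have -> : fupd f i (\1_B) i = \1_B by rewrite /fupd eqxx.
move=> <-.
by apply: eq_I => w _; rewrite e.
Qed.

(** The same exchange, one index at a time, with positive and negative parts in place of
    indicators. *)
Lemma prodI_signed s s' f : uniq (s ++ s') -> (forall i, i \in s ++ s' -> okf i (f i)) ->
  (forall i, i \in s' -> forall t, 0 <= f i t) -> prodI (s ++ s') f.
Proof.
elim: s s' f => [|i s IH] s' f us hs f0.
  have := @prodI_ge0 s' [::] f; rewrite cats0 => h; apply: h => //.
  by move=> i is'; split; [exact: hs|exact: f0].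
have [mf If] := hs i (mem_head _ _).
move: us => /= /andP[nis us].
have usi : uniq (s ++ i :: s') by rewrite uniq_catC /= mem_cat orbC -mem_cat nis uniq_catC.
have ns' : i \notin s' by move: nis; rewrite mem_cat negb_or => /andP[].
pose fp t := Num.max (f i t) 0; pose fm t := Num.max (- f i t) 0.
have fE t : f i t = fp t - fm t.
  rewrite /fp /fm; case: (leP 0 (f i t)) => h.
    by rewrite max_r ?oppr_le0 // subr0.
  by rewrite max_l ?oppr_ge0 ?(ltW h) // sub0r opprK.
have mfp : measurable_fun setT fp by apply: measurable_maxr.
have mfm : measurable_fun setT fm by apply: measurable_maxr => //; exact: measurableT_comp.
have fp0 t : 0 <= fp t by rewrite le_max lexx orbT.
have fm0 t : 0 <= fm t by rewrite le_max lexx orbT.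
have fpl t : `|fp t| <= `|f i t| by rewrite ger0_norm // ge_max ler_norm normr_ge0.
have fml t : `|fm t| <= `|f i t| by rewrite ger0_norm // ge_max -normrN ler_norm normr_ge0.
have okh (h : R -> R) : measurable_fun setT h -> (forall t, `|h t| <= `|f i t|) -> okf i h.
  move=> mh hl; split=> //; apply: (le_intg MT _ _ (intg_norm If)) => [|w _]; last exact: hl.
  exact: measurable_comp_Z.
pose W w := \prod_(j <- s ++ s') f j (Z j w).
have key (h : R -> R) : okf i h -> (forall t, 0 <= h t) ->
    intP (fun w => h (Z i w) * W w) /\ IP (fun w => h (Z i w) * W w) =
    IP (fun w => h (Z i w)) * \prod_(j <- s ++ s') IP (fun w => f j (Z j w)).
  move=> oh h0.
  have h1 j : j \in s ++ i :: s' -> okf j (fupd f i h j).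
    move=> js; rewrite /fupd; case: eqP => [->//|/eqP ji]; apply: hs.
    by move: js; rewrite /= !(mem_cat, inE) (negbTE ji).
  have h2 j : j \in i :: s' -> forall t, 0 <= fupd f i h j t.
    rewrite inE /fupd; case: eqP => [//|/eqP ji] /= js; exact: f0.
  have /prodI_cat := IH _ _ usi h1 h2.
  rewrite (prod_fupd (fun j h => IP (fun w => h (Z j w)))) //.
  have -> : fupd f i h i = h by rewrite /fupd eqxx.
  have -> // : (fun w => h (Z i w) * \prod_(j <- s ++ s') fupd f i h j (Z j w)) = (fun w => h (Z i w) * W w).
  by apply/funext => w; rewrite (prod_fupd (fun j h => h (Z j w))).
have [op om] := (okh _ mfp fpl, okh _ mfm fml).
have [i1 e1] := key _ op fp0; have [i2 e2] := key _ om fm0.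
apply/(prodI_cat [::]) => /=.
have e : (fun w => f i (Z i w) * W w) = (fun w => fp (Z i w) * W w - fm (Z i w) * W w).
  by apply/funext => w; rewrite fE mulrBl.
have e' : IP (fun w => f i (Z i w)) = IP (fun w => fp (Z i w)) - IP (fun w => fm (Z i w)).
  by rewrite -(I_B MT) ?(proj2 op) ?(proj2 om) //; apply: eq_I => w _; exact: fE.
split; first by rewrite e; exact: (intgB MT).
by rewrite e e' (I_B MT) // e1 e2 mulrBl.
Qed.

Lemma prodIP s f : uniq s -> (forall i, i \in s -> okf i (f i)) -> prodI s f.
Proof. by rewrite -[s]cats0 => us hf; apply: prodI_signed. Qed.

End Independence.

(** * Markov inequalities *)

Section Markov.
Context (R : realType) (d0 : measure_display) (T : measurableType d0) (P : probability T R).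
Let MT : measurable (setT : set T) := measurableT.
Let PT : P setT = 1%E := probability_setT P.
Notation intP := (intg P setT).
Notation IP := (I P setT).

Lemma measurable_gt (f : T -> R) c : measurable_fun setT f -> measurable [set w | c < f w].
Proof.
move=> mf; rewrite (_ : [set w | c < f w] = setT `&` f @^-1` [set` `]c, +oo[]).
  by apply: mf.
by rewrite setTI; apply/seteqP; split=> w /=; rewrite in_itv /= andbT.
Qed.

Lemma markov_real (f : T -> R) (c K : R) : intP f -> (forall w, 0 <= f w) -> 0 < c -> IP f <= K ->
  (P [set w | (c < f w)%R] <= (K / c)%:E)%E.
Proof.
move=> hf f0 c0 hK; have mA := measurable_gt c (intg_meas hf).
rewrite -(fineK (fin_num_measure P _ mA)) lee_fin ler_pdivlMr // mulrC.
apply: le_trans hK; rewrite -(I_indic P mA) -(I_Z MT); last exact: intg_indic.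
apply: (le_I MT) => //; first by apply: (intgZ MT); exact: intg_indic.
move=> w _; rewrite indicE; case: (boolP (w \in _)) => /= [|_]; last by rewrite mulr0.
by rewrite inE /= mulr1 => /ltW.
Qed.

(* A bound for infinitely many N suffices to pass to the limit in N, and it
   holds off a set of the same probability as for a single N, whereas a bound
   for all N would need a maximal inequality. *)
Lemma markov_io (Q : nat -> T -> R) (c K : R) : (forall N, intP (Q N)) -> (forall N w, 0 <= Q N w) ->
  0 < c -> (forall N, IP (Q N) <= K) ->
  exists A : set T, [/\ measurable A, (P A <= (K / c)%:E)%E &
    forall w, ~ A w -> forall N0, exists2 N, (N0 <= N)%N & Q N w <= c].
Proof.
move=> iQ Q0 c0 hK.
pose B N := [set w | c < Q N w].
have mB N : measurable (B N) by apply: measurable_gt; exact: intg_meas (iQ N).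
(* The event that the bound fails for all [N >= N0]. It grows with [N0] and lies in [B N0], so its
   union inherits the bound for a single [N]. *)
pose F N0 := \bigcap_(N in [set N | (N0 <= N)%N]) B N.
have mF N0 : measurable (F N0) by apply: bigcap_measurable => //; exists N0 => /=.
exists (\bigcup_N0 F N0); split.
- exact: bigcup_measurable.
- have nd : nondecreasing_seq F.
    move=> i j ij; apply/subsetPset => w h N /= jN; apply: h => /=; exact: leq_trans jN.
  have cv := @nondecreasing_cvg_mu _ _ _ P F mF (bigcup_measurable (fun k _ => mF k)) nd.
  rewrite -(cvg_lim _ cv) //; apply: lime_le; first by apply/cvg_ex; eexists; exact: cv.
  apply: nearW => N /=; apply: le_trans (markov_real (iQ N) (Q0 N) c0 (hK N)).
  by apply: le_measure; rewrite ?inE; [exact: mF|exact: (mB N)|move=> w; apply => /=].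
- move=> w hw N0; apply: contrapT => h; apply: hw; exists N0 => // N /= N0N.
  rewrite /B /= ltNge; apply/negP => hc; apply: h; by exists N.
Qed.

End Markov.

(** * Variance of sums of products of independent variables *)

Section Variance.
Context (R : realType) (d0 : measure_display) (T : measurableType d0) (P : probability T R).
Context (O : finType) (Z : nat * O -> T -> R).
Hypothesis mZ : forall i, measurable_fun setT (Z i).
Hypothesis hZ : mutual_indep P Z.
Let MT : measurable (setT : set T) := measurableT.
Let PT : P setT = 1%E := probability_setT P.
Notation intP := (intg P setT).
Notation IP := (I P setT).
Notation L2P := (sq P setT).

(* The first index of Z is the observation, the second one its component. *)
Record okg (g : O -> R -> R) (e q : O -> R) : Prop := Okg {
  okg_meas : forall o, measurable_fun setT (g o);
  okg_sq : forall i o, L2P (fun w => g o (Z (i, o) w));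
  okg_mean : forall i o, IP (fun w => g o (Z (i, o) w)) = e o;
  okg_var : forall i o, IP (fun w => g o (Z (i, o) w) ^+ 2) = q o }.

Definition Gp (g : O -> R -> R) i w := \prod_(o : O) g o (Z (i, o) w).

Lemma uniq_row (i : nat) : uniq [seq (i, o) | o <- index_enum O].
Proof. by rewrite (map_inj_uniq (f := fun o : O => (i, o))) ?index_enum_uniq // => o o' []. Qed.

Variables (g : O -> R -> R) (e q : O -> R).
Hypothesis hg : okg g e q.
Let E := \prod_(o : O) e o.
Let G := Gp g.

Let okp p : okf P Z p (g p.2).
Proof.
case: p => i o; split; first exact: okg_meas hg _.
by have /(sq_intg MT PT) := okg_sq hg i o.
Qed.

Lemma G_mean i : intP (G i) /\ IP (G i) = E.
Proof.
have := @prodIP R _ T P _ Z mZ hZ [seq (i, o) | o <- index_enum O] (fun p => g p.2) (uniq_row i).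
case=> [p _|]; first exact: okp.
rewrite (_ : (fun w => _) = G i); last by apply/funext => w; rewrite big_map.
by rewrite big_map => hi ->; split=> //; apply: eq_bigr => o _; exact: okg_mean hg _ _.
Qed.

Lemma G_sq i : L2P (G i) /\ IP (fun w => G i w ^+ 2) = \prod_(o : O) q o.
Proof.
have := @prodIP R _ T P _ Z mZ hZ [seq (i, o) | o <- index_enum O] (fun p t => g p.2 t ^+ 2) (uniq_row i).
case=> [p _|].
  split; first by apply: measurable_funX; case: (okp p).
  by case: p => i' o; have [] := okg_sq hg i' o.
rewrite (_ : (fun w => _) = (fun w => G i w ^+ 2)); last by apply/funext => w; rewrite big_map /G /Gp prodrXl.
rewrite big_map => hi ->; split; last by apply: eq_bigr => o _; exact: okg_var hg _ _.
by split=> //; apply: intg_meas (proj1 (G_mean i)).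
Qed.

Lemma G_cov i k : i != k -> IP (fun w => G i w * G k w) = E * E.
Proof.
move=> ik.
have := @prodIP R _ T P _ Z mZ hZ ([seq (i, o) | o <- index_enum O] ++ [seq (k, o) | o <- index_enum O])
  (fun p => g p.2).
case=> [|p _|]; [|exact: okp|].
  rewrite cat_uniq !uniq_row /= andbT; apply/hasPn => p /mapP[p1 _ ->].
  by apply/negP => /mapP[p2 _ [ki _]]; rewrite ki eqxx in ik.
rewrite (_ : (fun w => _) = (fun w => G i w * G k w)); last first.
  by apply/funext => w; rewrite big_cat !big_map.
move=> _ ->; rewrite big_cat !big_map; congr (_ * _); apply: eq_bigr => o _; exact: okg_mean hg _ _.
Qed.

Let eta i w := G i w - E.

Lemma eta_sq i : L2P (eta i).
Proof. by apply: (sqB MT); [case: (G_sq i)|exact: (sq_cst MT PT)]. Qed.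

Lemma eta_cov i k : i != k -> IP (fun w => eta i w * eta k w) = 0.
Proof.
move=> ik; have [[si _] [sk _]] := (G_sq i, G_sq k).
have [[ii ei] [ik' ek]] := (G_mean i, G_mean k).
rewrite (@eq_I _ _ _ _ _ _ (fun w => (G i w * G k w - E * G i w) - (E * G k w - E * E))); last first.
  by move=> w _; rewrite /eta; ring.
have h1 := sqM MT si sk; have h2 := intgZ MT E ii; have h3 := intgZ MT E ik'.
have h4 := intg_cst MT PT (E * E).
rewrite (I_B MT (intgB MT h1 h2) (intgB MT h3 h4)) (I_B MT h1 h2) (I_B MT h3 h4).
by rewrite (I_Z MT E ii) (I_Z MT E ik') (G_cov ik) ei ek (I_cst MT PT); ring.
Qed.

(** The mean square of [G i] is the product of the [q o] for every [i], which reduces all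
    observations to the first; centring can only lower it. *)
Lemma eta_var i : IP (fun w => eta i w ^+ 2) <= IP (fun w => G 0%N w ^+ 2).
Proof.
have [si e2] := G_sq i; have [_ e0] := G_sq 0%N; have [ii ei] := G_mean i.
rewrite e0 -e2; have s1 := sq_cst MT PT (1 : R).
rewrite (@eq_I _ _ _ _ _ _ (fun w => (G i w + - E * 1) ^+ 2)); last first.
  by move=> w _; rewrite /eta mulr1.
rewrite (I_sqr_comb MT) // (@eq_I _ _ _ _ _ (fun w => 1 ^+ 2) (fun=> 1)); last by move=> w _; rewrite expr1n.
rewrite (@eq_I _ _ _ _ _ (fun w => G i w * 1) (G i)); last by move=> w _; rewrite mulr1.
rewrite ei (I_cst MT PT); have := sqr_ge0 E; nra.
Qed.

(** Distinct observations are uncorrelated, so the variances add. *)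
Lemma var_sum n : L2P (fun w => \sum_(0 <= i < n) eta i w) /\
  IP (fun w => (\sum_(0 <= i < n) eta i w) ^+ 2) <= n%:R * IP (fun w => G 0%N w ^+ 2).
Proof.
elim: n => [|n [sS hS]].
  have z : (fun w => \sum_(0 <= i < 0) eta i w) = (fun=> 0) by apply/funext => w; rewrite big_geq.
  rewrite z; split; first exact: (sq_cst MT PT).
  rewrite mul0r (@eq_I _ _ _ _ _ _ (fun=> 0)) ?(I_cst MT PT) // => w _.
  by rewrite big_geq // expr0n.
have r : (fun w => \sum_(0 <= i < n.+1) eta i w) = (fun w => \sum_(0 <= i < n) eta i w + 1 * eta n w).
  by apply/funext => w; rewrite big_nat_recr //= mul1r.
rewrite r; split; first by apply: (sqD MT) => //; apply: (sqZ MT); exact: eta_sq.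
rewrite (@eq_I _ _ _ _ _ _ (fun w => (\sum_(0 <= i < n) eta i w + 1 * eta n w) ^+ 2)); last first.
  by move=> w _; rewrite -[in RHS](congr1 (fun h => h w) r).
rewrite (I_sqr_comb MT) //; last exact: eta_sq.
have -> : IP (fun w => (\sum_(0 <= i < n) eta i w) * eta n w) = 0.
  rewrite (@eq_I _ _ _ _ _ _ (fun w => \sum_(0 <= i < n) eta i w * eta n w)); last first.
    by move=> w _; rewrite mulr_suml.
  rewrite (I_sum MT PT) => [|i]; last by apply: (sqM MT); exact: eta_sq.
  apply: big1_seq => i /=; rewrite mem_index_iota => /andP[_ hi].
  by apply: eta_cov; rewrite neq_ltn hi.
rewrite mulr0 addr0 expr1n mul1r -natr1 mulrDl mul1r; apply: lerD => //; exact: eta_var.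
Qed.

End Variance.

(** * Transfer of integrals between equal laws *)

Section Law.
Context (R : realType) (d1 d2 : measure_display) (T1 : measurableType d1) (T2 : measurableType d2).
Context (P1 : {measure set T1 -> \bar R}) (P2 : {measure set T2 -> \bar R}).
Variables (X : T1 -> R) (Y : T2 -> R) (D : set R) (f : R -> R).
Hypotheses (mX : measurable_fun setT X) (mY : measurable_fun setT Y) (mD : measurable D).
Hypothesis mf : measurable_fun setT f.
Hypothesis law : forall A : set R, measurable A -> A `<=` D -> P1 (X @^-1` A) = P2 (Y @^-1` A).

Let eqint (g : R -> \bar R) : (\int[pushforward P1 X]_(x in D) g x = \int[pushforward P2 Y]_(x in D) g x)%E.
Proof. by apply: eq_measure_integral => A mA AD; exact: law. Qed.

Lemma law_intg : intg P1 (X @^-1` D) (f \o X) -> intg P2 (Y @^-1` D) (f \o Y).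
Proof.
have mfa : measurable_fun setT (fun t => `|f t|%:E).
  by apply/measurable_EFinP; apply: measurableT_comp.
move=> /integrableP[_ h]; apply/integrableP; split.
  by apply/measurable_EFinP/measurable_funTS; exact: measurableT_comp.
have e1 : (\int[pushforward P1 X]_(x in D) `|f x|%:E = \int[P1]_(x in X @^-1` D) `|f (X x)|%:E)%E.
  by rewrite ge0_integral_pushforward // ; exact: measurable_funTS.
have e2 : (\int[pushforward P2 Y]_(x in D) `|f x|%:E = \int[P2]_(x in Y @^-1` D) `|f (Y x)|%:E)%E.
  by rewrite ge0_integral_pushforward // ; exact: measurable_funTS.
by move: h => /=; rewrite -e1 -e2 eqint.
Qed.

(** Both sides are integrals against pushforwards that agree on [D]. It serves for a coordinate of
    [X] against Lebesgue measure on [0,1], and for [eps i] against [eps 0]. *)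
Lemma law_I : intg P1 (X @^-1` D) (f \o X) -> I P1 (X @^-1` D) (f \o X) = I P2 (Y @^-1` D) (f \o Y).
Proof.
move=> h1; have h2 := law_intg h1; rewrite /I /Rintegral.
have mfe : measurable_fun setT (EFin \o f) by exact/measurable_EFinP.
have := @integral_pushforward _ _ _ _ R X mX P1 D (EFin \o f) mfe h1 mD.
have := @integral_pushforward _ _ _ _ R Y mY P2 D (EFin \o f) mfe h2 mD.
by rewrite eqint => -> e; congr fine; exact: esym e.
Qed.

End Law.

Section QuadraticForms.
Context (R : realType) (d0 : measure_display) (T : measurableType d0) (P : probability T R).
Context (O : finType) (Z : nat * O -> T -> R).
Hypothesis mZ : forall i, measurable_fun setT (Z i).
Hypothesis hZ : mutual_indep P Z.
Let MT : measurable (setT : set T) := measurableT.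
Let PT : P setT = 1%E := probability_setT P.

(** Variances are summed before taking means, so a single pointwise bound [H] covers all functionals
    at once. Hence the estimate does not deteriorate with the size of the list, that is, with the
    frame level. *)
Lemma quad_mean (A : Type) (L : seq A) (g : A -> O -> R -> R) (e q : A -> O -> R) (c : A -> R)
    (H : T -> R) n : (forall a, okg P Z (g a) (e a) (q a)) -> (forall a, 0 <= c a) -> (0 < n)%N ->
  intg P setT H -> (forall w, \sum_(a <- L) Gp Z (g a) 0 w ^+ 2 * c a <= H w) ->
  let Q w := \sum_(a <- L) (n%:R^-1 * \sum_(0 <= i < n) (Gp Z (g a) i w - \prod_o e a o)) ^+ 2 * c a in
  intg P setT Q /\ I P setT Q <= n%:R^-1 * I P setT H.
Proof.
move=> hg c0 n0 iH hH Q.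
have v a := var_sum mZ hZ (hg a) n.
have nR : 0 < n%:R :> R by rewrite ltr0n.
have QE w : Q w = \sum_(a <- L) (n%:R^-1 ^+ 2 * c a) * (\sum_(0 <= i < n) (Gp Z (g a) i w - \prod_o e a o)) ^+ 2.
  by apply: eq_bigr => a _; rewrite exprMn mulrAC.
have it a : intg P setT (fun w => (n%:R^-1 ^+ 2 * c a) * (\sum_(0 <= i < n) (Gp Z (g a) i w - \prod_o e a o)) ^+ 2).
  by apply: (intgZ MT); case: (v a) => -[].
have ig a : intg P setT (fun w => c a * Gp Z (g a) 0 w ^+ 2).
  by apply: (intgZ MT); case: (G_sq mZ hZ (hg a) 0) => -[].
split.
  apply: (eq_intg MT _ (intg_sum MT PT L it)) => w _; exact: esym (QE w).
rewrite (@eq_I _ _ _ _ _ _ _ (fun w _ => QE w)) (I_sum MT PT) //.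
apply: (@le_trans _ _ (\sum_(a <- L) n%:R^-1 * I P setT (fun w => c a * Gp Z (g a) 0 w ^+ 2))).
  apply: ler_sum => a _.
  rewrite (I_Z MT _ (proj2 (proj1 (v a)))) (I_Z MT _ (proj2 (proj1 (G_sq mZ hZ (hg a) 0)))).
  have [_ hv] := v a.
  apply: (@le_trans _ _ (n%:R^-1 ^+ 2 * c a * (n%:R * I P setT (fun w => Gp Z (g a) 0 w ^+ 2)))).
    by rewrite ler_wpM2l // mulr_ge0 // sqr_ge0.
  by rewrite le_eqVlt; apply/orP; left; apply/eqP; field; rewrite lt0r_neq0.
rewrite -mulr_sumr ler_wpM2l ?invr_ge0 ?(ltW nR) // -(I_sum MT PT) //.
apply: (le_I MT) => //; first exact: (intg_sum MT PT).
by move=> w _; apply: le_trans (hH w); apply: ler_sum => a _; rewrite mulrC.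
Qed.

End QuadraticForms.

(** * Noise and design functionals in the frame *)

Section Samples.
Context (R : realType) (d m : nat) (hm : (2 <= m)%N) (q : nat -> {poly R}).
Context (d0 : measure_display) (T : measurableType d0) (P : probability T R).
Context (X : nat -> T -> 'I_d -> R) (eps : nat -> T -> R).
Hypothesis hXmeas : forall i j, measurable_fun setT (fun w => X i w j).
Hypothesis hepsmeas : forall i, measurable_fun setT (eps i).
Let Z (p : nat * option 'I_d) : T -> R :=
  match p.2 with Some j => fun w => X p.1 w j | None => eps p.1 end.
Hypothesis hindep : mutual_indep P Z.
Hypothesis hunif : forall i j (B : set R), measurable B ->
  P ((fun w => X i w j) @^-1` B) = lebesgue_measure (B `&` `[0%R, 1%R]).
Hypothesis hident : forall i (B : set R), measurable B ->
  P (eps i @^-1` B) = P (eps 0%N @^-1` B).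
Hypothesis heps : intg P setT (fun w => eps 0%N w ^+ 4).
Hypothesis hmean : I P setT (eps 0%N) = 0.
Let MT : measurable (setT : set T) := measurableT.
Let PT : P setT = 1%E := probability_setT P.
Notation intP := (intg P setT).
Notation IP := (I P setT).
Notation L2P := (sq P setT).
Notation D01 := (`[0%R, 1%R]%classic : set R).
Notation I01 := (I (@lebesgue_measure R) D01).
Let M1 : measurable (D01 : set (measurableTypeR R)) := @m01 R.

Lemma mZs p : measurable_fun setT (Z p).
Proof. by case: p => i [j|]; [exact: hXmeas|exact: hepsmeas]. Qed.

Lemma X_out_null i j : measurable [set w | ~ D01 (X i w j)] /\ P [set w | ~ D01 (X i w j)] = 0%E.
Proof.
have e : [set w | ~ D01 (X i w j)] = (fun w => X i w j) @^-1` (~` D01) by [].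
have mc : measurable (~` D01 : set (measurableTypeR R)) by apply: measurableC.
split; rewrite e; first by rewrite -[Y in measurable Y]setTI; apply: (hXmeas i j measurableT).
by rewrite hunif // setICl measure0.
Qed.

Lemma X_law i j (f : R -> R) (M : R) : measurable_fun setT f -> (forall t, `|f t| <= M) ->
  L2P (fun w => f (X i w j)) /\ IP (fun w => f (X i w j)) = I01 f.
Proof.
move=> mf hM.
have s : L2P (fun w => f (X i w j)).
  apply: (@sq_bounded _ _ _ _ _ MT PT _ M) => [|w _]; last exact: hM.
  exact: measurableT_comp.
split=> //; have is_ := sq_intg MT PT s.
have [mN PN] := X_out_null i j.
have mV : measurable ((fun w => X i w j) @^-1` D01).
  by rewrite -[Y in measurable Y]setTI; apply: (hXmeas i j measurableT).
rewrite /I /Rintegral (negligible_integral mN) // -/(Rintegral _ _ _).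
have -> : setT `\` [set w | ~ D01 (X i w j)] = (fun w => X i w j) @^-1` D01.
  by apply/seteqP; split => w /=; [move=> [_ /contrapT]|move=> h; split].
have iV : intg P ((fun w => X i w j) @^-1` D01) (f \o (fun w => X i w j)).
  by apply: integrableS is_ => //.
have law (A : set R) : measurable A -> A `<=` D01 ->
   P ((fun w => X i w j) @^-1` A) = lebesgue_measure ((fun x : measurableTypeR R => x) @^-1` A).
  by move=> mA AD; rewrite hunif // setIidl.
have mid : measurable_fun setT (fun x : measurableTypeR R => (x : R)) by [].
exact: (law_I (hXmeas i j) mid M1 mf law iV).
Qed.

Lemma eps_law i (f : R -> R) : measurable_fun setT f -> intP (fun w => f (eps 0%N w)) ->
  intP (fun w => f (eps i w)) /\ IP (fun w => f (eps i w)) = IP (fun w => f (eps 0%N w)).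
Proof.
move=> mf i0.
have law (A : set R) : measurable A -> A `<=` setT -> P (eps 0%N @^-1` A) = P (eps i @^-1` A).
  by move=> mA _; rewrite [RHS]hident.
have i0' : intg P (eps 0%N @^-1` setT) (f \o eps 0%N) by rewrite preimage_setT.
have := law_I (hepsmeas 0) (hepsmeas i) measurableT mf law i0'.
have := law_intg (hepsmeas 0) (hepsmeas i) measurableT mf law i0'.
by rewrite !preimage_setT.
Qed.

(** The second moment is finite by comparison with the fourth, as [y <= 1 + y ^+ 2]. *)
Lemma eps_sq i : [/\ L2P (eps i), IP (eps i) = 0 &
  IP (fun w => eps i w ^+ 2) = IP (fun w => eps 0%N w ^+ 2)].
Proof.
have i2 : intP (fun w => eps 0%N w ^+ 2).
  apply: (le_intg MT _ _ (intgD MT (intg_cst MT PT 1) heps)).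
    by apply: measurable_funX.
  move=> w _; rewrite ger0_norm ?sqr_ge0 //.
  have -> : eps 0%N w ^+ 4 = (eps 0%N w ^+ 2) ^+ 2 by rewrite -exprM.
  have := sqr_ge0 (eps 0%N w ^+ 2 - 1); have := sqr_ge0 (eps 0%N w).
  by move: (eps 0%N w ^+ 2) => y; nra.
have s0 : L2P (eps 0%N) by split.
have i1 := sq_intg MT PT s0.
have [j1 e1] := eps_law i (@measurable_id _ _ setT) i1.
have [j2 e2] := eps_law i (measurable_funX 2 (@measurable_id _ _ setT)) i2.
by split=> //; rewrite -hmean.
Qed.

Lemma prod_option (F : option 'I_d -> R) : \prod_(o : option 'I_d) F o = F None * \prod_(j : 'I_d) F (Some j).
Proof.
rewrite (bigD1 None) //=; congr (_ * _).
rewrite (reindex_omap Some id) /=; last by case.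
by apply: eq_bigl => j; rewrite /= eqxx.
Qed.

Notation k0 := ([::], 0%N).
Implicit Types (s : seq 'I_d) (nu : 'I_d -> seq bool * nat).
Let dpsc s nu (j : 'I_d) (t : R) : R := if j \in s then psc q (nu j) t else 1.

Lemma dpsc_bounded s nu j : measurable_fun setT (dpsc s nu j) /\
  exists M : R, forall t, `|dpsc s nu j t| <= M.
Proof.
rewrite /dpsc; case: (j \in s); first by split; [exact: measurable_psc|exact: psc_bounded].
by split; [exact: measurable_cst|exists 1 => t; rewrite normr1].
Qed.

Lemma prod_dpsc s nu x : uniq s -> \prod_(j : 'I_d) dpsc s nu j (x j) = Psi q s nu x.
Proof. by move=> us; rewrite /Psi prod_mem. Qed.

(** Factors of [eps i * Psi s nu (X i)] over the independent components of one observation: [None]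
    carries the noise, and its zero mean annihilates the whole product. *)
Let gN s nu (o : option 'I_d) : R -> R := if o is Some j then dpsc s nu j else id.
Let eN s nu (o : option 'I_d) : R := if o is Some j then I01 (dpsc s nu j) else 0.
Let qN s nu (o : option 'I_d) : R :=
  if o is Some j then I01 (fun t => dpsc s nu j t ^+ 2) else IP (fun w => eps 0%N w ^+ 2).

Lemma okgN s nu : okg P Z (gN s nu) (eN s nu) (qN s nu).
Proof.
split=> [[j|]|i [j|]|i [j|]|i [j|]] /=; rewrite /gN /eN /qN /Z /=.
- by case: (dpsc_bounded s nu j).
- exact: measurable_id.
- by have [mf [M hM]] := dpsc_bounded s nu j; case: (X_law i j mf hM).
- by case: (eps_sq i).
- by have [mf [M hM]] := dpsc_bounded s nu j; case: (X_law i j mf hM).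
- by case: (eps_sq i).
- have [mf [M hM]] := dpsc_bounded s nu j.
  have mf2 : measurable_fun setT (fun t => dpsc s nu j t ^+ 2) by apply: measurable_funX.
  have hM2 t : `|dpsc s nu j t ^+ 2| <= M ^+ 2.
    by rewrite normrX ler_sqr ?nnegrE // (le_trans _ (hM t)).
  by case: (X_law i j mf2 hM2).
- by case: (eps_sq i).
Qed.

Let gX s s' nu nu' (o : option 'I_d) : R -> R :=
  if o is Some j then fun t => dpsc s nu j t * dpsc s' nu' j t else fun=> 1.
Let eX s s' nu nu' (o : option 'I_d) : R :=
  if o is Some j then I01 (fun t => dpsc s nu j t * dpsc s' nu' j t) else 1.
Let qX s s' nu nu' (o : option 'I_d) : R :=
  if o is Some j then I01 (fun t => (dpsc s nu j t * dpsc s' nu' j t) ^+ 2) else 1.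

Lemma okgX s s' nu nu' : okg P Z (gX s s' nu nu') (eX s s' nu nu') (qX s s' nu nu').
Proof.
have b j : measurable_fun setT (fun t => dpsc s nu j t * dpsc s' nu' j t) /\
    exists M : R, forall t, `|dpsc s nu j t * dpsc s' nu' j t| <= M.
  have [mf [M hM]] := dpsc_bounded s nu j; have [mf' [M' hM']] := dpsc_bounded s' nu' j.
  split; first exact: measurable_funM.
  by exists (M * M') => t; rewrite normrM ler_pM.
split=> [[j|]|i [j|]|i [j|]|i [j|]] /=; rewrite /gX /eX /qX /Z /=.
- by case: (b j).
- exact: measurable_cst.
- by have [mf [M hM]] := b j; case: (X_law i j mf hM).
- exact: (sq_cst MT PT).
- by have [mf [M hM]] := b j; case: (X_law i j mf hM).
- exact: (I_cst MT PT).
- have [mf [M hM]] := b j.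
  have mf2 : measurable_fun setT (fun t => (dpsc s nu j t * dpsc s' nu' j t) ^+ 2) by apply: measurable_funX.
  have hM2 t : `|(dpsc s nu j t * dpsc s' nu' j t) ^+ 2| <= M ^+ 2.
    by rewrite normrX ler_sqr ?nnegrE // (le_trans _ (hM t)).
  by case: (X_law i j mf2 hM2).
- by rewrite (I_cst MT PT) expr1n.
Qed.

Lemma GpN s nu i w : uniq s -> Gp Z (gN s nu) i w = eps i w * Psi q s nu (X i w).
Proof. by move=> us; rewrite /Gp prod_option -prod_dpsc. Qed.

Lemma GpX s s' nu nu' i w : uniq s -> uniq s' ->
  Gp Z (gX s s' nu nu') i w = Psi q s nu (X i w) * Psi q s' nu' (X i w).
Proof.
by move=> us us'; rewrite /Gp prod_option mul1r -!prod_dpsc // -big_split.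
Qed.

Lemma prod_eN s nu : \prod_o eN s nu o = 0.
Proof. by rewrite prod_option mul0r. Qed.

Lemma prod_eX s s' nu nu' : \prod_o eX s s' nu nu' o = ex q s s' nu nu'.
Proof. by rewrite prod_option mul1r. Qed.

(* Squared norms, dual to the weights W, of the noise functional
   h |-> 1/n sum_i eps_i h(X_i) and of the bilinear form
   (h,h') |-> 1/n sum_i h(X_i) h'(X_i) - E h(X) h'(X) in the frame of level N. *)
Definition QN n lam s N w := \sum_(nu <- MI m N s)
  (n%:R^-1 * \sum_(0 <= i < n) eps i w * Psi q s nu (X i w)) ^+ 2 / W m s lam nu.

Definition QX n lam s s' N w := \sum_(nu <- MI m N s) \sum_(nu' <- MI m N s')
  (n%:R^-1 * \sum_(0 <= i < n) (Psi q s nu (X i w) * Psi q s' nu' (X i w) - ex q s s' nu nu')) ^+ 2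
   / (W m s lam nu * W m s' lam nu').

Lemma QN_ge0 n (lam : R) s N w : 0 < lam -> 0 <= QN n lam s N w.
Proof. by move=> l0; apply: sumr_ge0 => nu _; rewrite divr_ge0 ?sqr_ge0 // ltW // W_gt0. Qed.

Lemma QX_ge0 n (lam : R) s s' N w : 0 < lam -> 0 <= QX n lam s s' N w.
Proof.
move=> l0; apply: sumr_ge0 => nu _; apply: sumr_ge0 => nu' _.
by rewrite divr_ge0 ?sqr_ge0 // ltW // mulr_gt0 // W_gt0.
Qed.

(** The kernel bound holds at the random point [X 0], which leaves [K * eps 0 ^+ 2] as the pointwise
    bound. *)
Lemma QN_mean s (K lam : R) n N : uniq s -> 0 < lam -> (0 < n)%N ->
  (forall x, \sum_(nu <- MI m N s) Psi q s nu x ^+ 2 / W m s lam nu <= K) ->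
  intP (QN n lam s N) /\ IP (QN n lam s N) <= n%:R^-1 * (K * IP (fun w => eps 0%N w ^+ 2)).
Proof.
move=> us l0 n0 hK; have [se _ _] := eps_sq 0.
have ie := intgZ MT K (proj2 se).
have c0 nu : 0 <= (W m s lam nu)^-1 by rewrite invr_ge0 ltW // W_gt0.
have hH w : \sum_(nu <- MI m N s) Gp Z (gN s nu) 0 w ^+ 2 * (W m s lam nu)^-1 <= K * eps 0%N w ^+ 2.
  have -> : \sum_(nu <- MI m N s) Gp Z (gN s nu) 0 w ^+ 2 * (W m s lam nu)^-1 =
     (\sum_(nu <- MI m N s) Psi q s nu (X 0%N w) ^+ 2 / W m s lam nu) * eps 0%N w ^+ 2.
    by rewrite mulr_suml; apply: eq_bigr => nu _; rewrite GpN // exprMn; ring.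
  by rewrite ler_wpM2r // sqr_ge0.
have := quad_mean mZs hindep (okgN s) c0 n0 ie hH.
rewrite (I_Z MT _ (proj2 se)).
set Q := (fun w => _); have -> // : Q = QN n lam s N.
apply/funext => w; apply: eq_bigr => nu _; congr (_ ^+ 2 / _); congr (_ * _).
by apply: eq_bigr => i _; rewrite prod_eN subr0 GpN.
Qed.

(** The pointwise bound is a product of two kernel sums at the same point, whence [K * K']. *)
Lemma QX_mean s s' (K K' lam : R) n N : uniq s -> uniq s' -> 0 < lam -> (0 < n)%N ->
  (forall x, \sum_(nu <- MI m N s) Psi q s nu x ^+ 2 / W m s lam nu <= K) ->
  (forall x, \sum_(nu <- MI m N s') Psi q s' nu x ^+ 2 / W m s' lam nu <= K') ->
  intP (QX n lam s s' N) /\ IP (QX n lam s s' N) <= n%:R^-1 * (K * K').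
Proof.
move=> us us' l0 n0 hK hK'.
have ie := intg_cst MT PT (K * K').
have c0 (p : ('I_d -> seq bool * nat) * ('I_d -> seq bool * nat)) :
    0 <= (W m s lam p.1 * W m s' lam p.2)^-1 by rewrite invr_ge0 ltW // mulr_gt0 // W_gt0.
have hH w : \sum_(p <- [seq (nu, nu') | nu <- MI m N s, nu' <- MI m N s'])
    Gp Z (gX s s' p.1 p.2) 0 w ^+ 2 * (W m s lam p.1 * W m s' lam p.2)^-1 <= K * K'.
  rewrite big_allpairs /=.
  have -> : \sum_(nu <- MI m N s) \sum_(nu' <- MI m N s')
      Gp Z (gX s s' nu nu') 0 w ^+ 2 * (W m s lam nu * W m s' lam nu')^-1 =
     (\sum_(nu <- MI m N s) Psi q s nu (X 0%N w) ^+ 2 / W m s lam nu) *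
     (\sum_(nu' <- MI m N s') Psi q s' nu' (X 0%N w) ^+ 2 / W m s' lam nu').
    rewrite mulr_suml; apply: eq_bigr => nu _; rewrite mulr_sumr; apply: eq_bigr => nu' _.
    by rewrite GpX // invfM; move: (Psi q s nu _) (Psi q s' nu' _) (W _ _ _ _)^-1 (W _ _ _ _)^-1 => a b c e; ring.
  have p0 s1 : 0 <= \sum_(nu <- MI m N s1) Psi q s1 nu (X 0%N w) ^+ 2 / W m s1 lam nu.
    by apply: sumr_ge0 => nu _; rewrite divr_ge0 ?sqr_ge0 // ltW // W_gt0.
  by apply: ler_pM.
have := quad_mean mZs hindep (fun p => okgX s s' p.1 p.2) c0 n0 ie hH.
rewrite (I_cst MT PT).
set Q := (fun w => _); have -> // : Q = QX n lam s s' N.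
apply/funext => w; rewrite /Q /QX big_allpairs; apply: eq_bigr => nu _; apply: eq_bigr => nu' _ /=.
congr (_ ^+ 2 / _); congr (_ * _).
by apply: eq_bigr => i _; rewrite prod_eX GpX.
Qed.
End Samples.

Lemma weighted_cauchy (R : realFieldType) (A : Type) (L : seq A) (w a b : A -> R) :
  (forall i, 0 < w i) ->
  (\sum_(i <- L) a i * b i) ^+ 2 <= (\sum_(i <- L) w i * a i ^+ 2) * (\sum_(i <- L) b i ^+ 2 / w i).
Proof.
move=> w0; apply: quad_disc.
  by apply: sumr_ge0 => i _; rewrite divr_ge0 ?sqr_ge0 // ltW.
move=> t; rewrite [2 * t * _]mulr_sumr [t ^+ 2 * _]mulr_sumr -!big_split /=.
apply: sumr_ge0 => i _; have w1 := w0 i.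
have -> : w i * a i ^+ 2 + 2 * t * (a i * b i) + t ^+ 2 * (b i ^+ 2 / w i) =
  w i * (a i + t * b i / w i) ^+ 2 by field; rewrite lt0r_neq0.
by rewrite mulr_ge0 ?sqr_ge0 // ltW.
Qed.

(** What [markov_io] provides, a bound for infinitely many [N], is all that a limit in [N] needs. *)
Lemma freq_le (R : realType) (u : nat -> R) (l b : R) : u @ \oo --> l ->
  (forall N0, exists2 N, (N0 <= N)%N & u N <= b) -> l <= b.
Proof.
move=> hu hb; rewrite leNgt; apply/negP => bl.
have /(cvgr_gt _ hu)[N0 _ hN0] := bl.
have [N N0N] := hb N0; rewrite leNgt => /negP; apply; exact: hN0.
Qed.

Lemma cvg_sum_nat (R : realType) n (u : nat -> nat -> R) (l : nat -> R) :
  (forall i, (i < n)%N -> (fun N => u N i) @ \oo --> l i) ->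
  (fun N => \sum_(0 <= i < n) u N i) @ \oo --> \sum_(0 <= i < n) l i.
Proof.
elim: n => [|n IH] h.
  by rewrite big_geq //; under eq_fun do rewrite big_geq //; exact: cvg_cst.
rewrite big_nat_recr //=; under eq_fun do rewrite big_nat_recr //=.
by apply: cvgD; [apply: IH => i hi; apply: h; exact: ltnW|exact: h].
Qed.

(** * Bounds on the component spaces *)

Section Deterministic.
Context (R : realType) (m d : nat).
Hypothesis hm : (2 <= m)%N.
Variable q : nat -> {poly R}.
Hypothesis qb : orthobasis m.+1 q.
Variable C : R.
Hypothesis C1 : 1 <= C.
Notation fam := ('I_d -> R -> R).
Notation vec := (seq (R * fam)).
Implicit Types (s : seq 'I_d) (v : vec).
Hypothesis hC : forall N s v (lam : R), uniq s -> vval m s v -> 0 <= lam ->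
  \sum_(nu <- MI m N s) W m s lam nu * coef m q s nu v ^+ 2 <=
  C ^+ size s * (tb s (fun=> l2ip) v v + lam * tb s (fun=> ip1 m) v v).
Variables (n : nat) (n0 : (0 < n)%N) (x : nat -> 'I_d -> R) (lam : R).
Hypothesis cx : forall i, (i < n)%N -> cube (x i).
Hypotheses (l0 : 0 < lam) (l1 : lam <= 1).
Notation ev x := (fun j h => h (x j)).
Let Nv s v : R := tb s (fun=> l2ip) v v + lam * tb s (fun=> ip1 m) v v.

Lemma Nv_ge0 s v : vval m s v -> 0 <= Nv s v.
Proof.
move=> hv; apply: addr_ge0; first by apply: (tb_ge0 _ hv) => j _; exact: okform_l2ip.
apply: mulr_ge0; first exact: ltW.
by apply: (tb_ge0 _ hv) => j _; exact: okform_ip1.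
Qed.

(** At level [N] the functional pairs the coefficients of [v] with its values on the frame;
    Cauchy-Schwarz with the weights [W] separates the norm of [v] from the data, and pointwise
    reconstruction removes [N]. *)
Lemma noise_rep s v (c : nat -> R) (K : R) : uniq s -> vval m s v ->
  (forall N0, exists2 N, (N0 <= N)%N &
     \sum_(nu <- MI m N s) (n%:R^-1 * \sum_(0 <= i < n) c i * Psi q s nu (x i)) ^+ 2 / W m s lam nu <= K) ->
  (n%:R^-1 * \sum_(0 <= i < n) c i * te s (ev (x i)) v) ^+ 2 <= C ^+ size s * Nv s v * K.
Proof.
move=> us hv hK.
have E0 : 0 <= C ^+ size s * Nv s v by rewrite mulr_ge0 ?Nv_ge0 // exprn_ge0 // (le_trans ler01).
pose u N := n%:R^-1 * \sum_(0 <= i < n) c i * \sum_(nu <- MI m N s) coef m q s nu v * Psi q s nu (x i).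
have hu : u @ \oo --> n%:R^-1 * \sum_(0 <= i < n) c i * te s (ev (x i)) v.
  apply: cvgMr; apply: cvg_sum_nat => i hi; apply: cvgMr.
  by apply: (coef_Psi_cvg hm qb) => //; exact: cx.
have hu2 : (fun N => u N ^+ 2) @ \oo --> (n%:R^-1 * \sum_(0 <= i < n) c i * te s (ev (x i)) v) ^+ 2.
  by rewrite expr2; under eq_fun do rewrite expr2; exact: cvgM.
apply: (freq_le hu2) => N0; have [N NN hN] := hK N0; exists N => //.
have -> : u N = \sum_(nu <- MI m N s) coef m q s nu v * (n%:R^-1 * \sum_(0 <= i < n) c i * Psi q s nu (x i)).
  rewrite /u.
  under eq_bigr => i _ do rewrite mulr_sumr.
  rewrite exchange_big mulr_sumr; apply: eq_bigr => nu _ /=.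
  rewrite mulrCA [in RHS]mulr_sumr; congr (_ * _); apply: eq_bigr => i _; ring.
apply: le_trans (weighted_cauchy _ _ _ (fun nu => W_gt0 m s nu l0)) _.
apply: ler_pM => //; first by apply: sumr_ge0 => nu _; rewrite mulr_ge0 ?sqr_ge0 // ltW // W_gt0.
  by apply: sumr_ge0 => nu _; rewrite divr_ge0 ?sqr_ge0 // ltW // W_gt0.
by apply: hC => //; exact: ltW.
Qed.

(** The same duality for pairs of multi-indices with product weights; the population term [l] is the
    limit of its frame version. *)
Lemma cross_rep s s' v v' (l K : R) : uniq s -> uniq s' -> vval m s v -> vval m s' v' ->
  (fun N => \sum_(nu <- MI m N s) \sum_(nu' <- MI m N s') coef m q s nu v * coef m q s' nu' v' * ex q s s' nu nu')
    @ \oo --> l ->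
  (forall N0, exists2 N, (N0 <= N)%N & \sum_(nu <- MI m N s) \sum_(nu' <- MI m N s')
     (n%:R^-1 * \sum_(0 <= i < n) (Psi q s nu (x i) * Psi q s' nu' (x i) - ex q s s' nu nu')) ^+ 2
       / (W m s lam nu * W m s' lam nu') <= K) ->
  (n%:R^-1 * \sum_(0 <= i < n) te s (ev (x i)) v * te s' (ev (x i)) v' - l) ^+ 2 <=
  (C ^+ size s * Nv s v) * (C ^+ size s' * Nv s' v') * K.
Proof.
move=> us us' hv hv' hl hK.
have C0 : 0 <= C by apply: le_trans C1.
have E0 : 0 <= C ^+ size s * Nv s v by rewrite mulr_ge0 ?Nv_ge0 // exprn_ge0.
have E0' : 0 <= C ^+ size s' * Nv s' v' by rewrite mulr_ge0 ?Nv_ge0 // exprn_ge0.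
have nR : (n%:R : R) != 0 by rewrite pnatr_eq0 -lt0n.
pose S1 N i := \sum_(nu <- MI m N s) coef m q s nu v * Psi q s nu (x i).
pose S2 N i := \sum_(nu <- MI m N s') coef m q s' nu v' * Psi q s' nu (x i).
pose S3 N := \sum_(nu <- MI m N s) \sum_(nu' <- MI m N s') coef m q s nu v * coef m q s' nu' v' * ex q s s' nu nu'.
pose u N := n%:R^-1 * \sum_(0 <= i < n) S1 N i * S2 N i - S3 N.
have hu : u @ \oo --> n%:R^-1 * \sum_(0 <= i < n) te s (ev (x i)) v * te s' (ev (x i)) v' - l.
  apply: cvgB => //; apply: cvgMr; apply: cvg_sum_nat => i hi.
  by apply: cvgM; apply: (coef_Psi_cvg hm qb) => //; exact: cx.
have hu2 : (fun N => u N ^+ 2) @ \oo -->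
   (n%:R^-1 * \sum_(0 <= i < n) te s (ev (x i)) v * te s' (ev (x i)) v' - l) ^+ 2.
  by rewrite expr2; under eq_fun do rewrite expr2; exact: cvgM.
apply: (freq_le hu2) => N0; have [N NN hN] := hK N0; exists N => //.
pose L := [seq (nu, nu') | nu <- MI m N s, nu' <- MI m N s'].
pose a p := coef m q s p.1 v * coef m q s' p.2 v'.
pose w p := W m s lam p.1 * W m s' lam p.2.
pose b p := n%:R^-1 * \sum_(0 <= i < n) (Psi q s p.1 (x i) * Psi q s' p.2 (x i) - ex q s s' p.1 p.2).
have w0 p : 0 < w p by rewrite mulr_gt0 // W_gt0.
have -> : u N = \sum_(p <- L) a p * b p.
  have bE p : b p = n%:R^-1 * (\sum_(0 <= i < n) Psi q s p.1 (x i) * Psi q s' p.2 (x i)) - ex q s s' p.1 p.2.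
    rewrite /b sumrB mulrBr; congr (_ - _).
    by rewrite sumr_const_nat subn0 -[X in _ * X]mulr_natl mulrA mulVf // mul1r.
  under [RHS]eq_bigr => p _ do rewrite bE mulrBr.
  rewrite sumrB /u; congr (_ - _); last by rewrite big_allpairs.
  rewrite /L big_allpairs /a /=.
  under eq_bigr => i _ do rewrite /S1 /S2 mulr_suml.
  rewrite exchange_big mulr_sumr; apply: eq_bigr => nu _ /=.
  under eq_bigr => i _ do rewrite mulr_sumr.
  rewrite exchange_big mulr_sumr; apply: eq_bigr => nu' _ /=.
  rewrite mulrCA [in RHS]mulr_sumr; congr (_ * _); apply: eq_bigr => i _; ring.
apply: le_trans (weighted_cauchy L a b w0) _.
have -> : \sum_(p <- L) w p * a p ^+ 2 = (\sum_(nu <- MI m N s) W m s lam nu * coef m q s nu v ^+ 2) *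
   (\sum_(nu <- MI m N s') W m s' lam nu * coef m q s' nu v' ^+ 2).
  rewrite big_allpairs mulr_suml; apply: eq_bigr => nu _; rewrite mulr_sumr; apply: eq_bigr => nu' _.
  by rewrite /w /a /=; ring.
have p0 s1 v1 : 0 <= \sum_(nu <- MI m N s1) W m s1 lam nu * coef m q s1 nu v1 ^+ 2.
  by apply: sumr_ge0 => nu _; rewrite mulr_ge0 ?sqr_ge0 // ltW // W_gt0.
apply: ler_pM.
- by rewrite mulr_ge0.
- by apply: sumr_ge0 => p _; rewrite divr_ge0 ?sqr_ge0 // ltW.
- by apply: ler_pM => //; apply: hC => //; exact: ltW.
- by rewrite /L big_allpairs.
Qed.

Implicit Types (S : {set 'I_d}) (F : ('I_d -> R) -> R).
Let en S : seq 'I_d := enum (mem S).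
Let uS S : uniq (en S) := enum_uniq (mem S).

Definition NS S F : R := VS m S F + lam * JS m S F.

Lemma NS_ge0 S F : HS m S F -> 0 <= NS S F.
Proof. by move=> h; rewrite addr_ge0 ?(VS_ge0 hm) // mulr_ge0 ?(JS_ge0 hm) // ltW. Qed.

Lemma HS_rep S F : HS m S F -> exists (g : nat -> vec) (L : R),
  [/\ forall k, vval m (en S) (g k),
      forall y, cube y -> (fun k => te (en S) (ev y) (g k)) @ \oo --> F y,
      (fun k => Nv (en S) (g k)) @ \oo --> L,
      (fun k => tb (en S) (fun=> l2ip) (g k) (g k)) @ \oo --> VS m S F & L <= 2 * NS S F].
Proof.
have [->|S0] := eqVneq S finset.set0.
  rewrite /HS eqxx => -[c hc]; exists (fun=> [:: (c, fun _ _ => 0)]), (c ^+ 2 + lam * c ^+ 2).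
  have e0 : en finset.set0 = [::] by rewrite /en enum_set0.
  have eb B : tb [::] (fun=> B) [:: (c, (fun _ _ => 0) : fam)] [:: (c, fun _ _ => 0)] = c ^+ 2.
    by rewrite /tb !big_seq1 big_nil mulr1 expr2.
  rewrite e0; split.
  - by move=> k p _ j.
  - by move=> y _; rewrite /te hc; under eq_fun do rewrite big_seq1 big_nil mulr1; exact: cvg_cst.
  - by rewrite /Nv; under eq_fun do rewrite !eb; exact: cvg_cst.
  - by rewrite /VS eqxx hc; under eq_fun do rewrite eb; exact: cvg_cst.
  - rewrite /NS /VS /JS eqxx hc mulr0 addr0; have := sqr_ge0 c; have := l1; have := l0.
    by move: (c ^+ 2) => z; nra.
move=> hF; have [g hg] := HS_wapprox S0 hF; exists g, (NS S F); have [hv _ hx] := hg.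
split=> //.
- by apply: cvgD; [exact: VS_lim|apply: cvgMr; exact: JS_lim].
- exact: VS_lim.
- by have := NS_ge0 hF; lra.
Qed.

Lemma size_en S : (size (en S) <= d)%N.
Proof. by rewrite /en -cardE -[X in (_ <= X)%N]card_ord max_card. Qed.

Lemma Cpow S (z : R) : 0 <= z -> C ^+ size (en S) * z <= C ^+ d * z.
Proof. by move=> z0; rewrite ler_wpM2r // ler_weXn2l // size_en. Qed.

(** The power bounds the frame constant for every set of coordinates, and 2 is the loss in
    [HS_rep]. *)
Definition Dc : R := C ^+ d * 2.

Lemma noise_HS S F (c : nat -> R) (K : R) : HS m S F -> 0 <= K ->
  (forall N0, exists2 N, (N0 <= N)%N &
     \sum_(nu <- MI m N (en S)) (n%:R^-1 * \sum_(0 <= i < n) c i * Psi q (en S) nu (x i)) ^+ 2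
       / W m (en S) lam nu <= K) ->
  (n%:R^-1 * \sum_(0 <= i < n) c i * F (x i)) ^+ 2 <= Dc * NS S F * K.
Proof.
move=> hF K0 hK; have [g [L [hv hx hN _ hL]]] := HS_rep hF.
have l0' : 0 <= L by apply: (cvgr_to_ge hN); apply: nearW => k; exact: Nv_ge0.
apply: (@le_trans _ _ (C ^+ size (en S) * L * K)); last first.
  rewrite ler_wpM2r // /Dc -mulrA; apply: le_trans (Cpow S l0') _.
  by rewrite ler_wpM2l // exprn_ge0 // (le_trans ler01).
have h1 : (fun k => (n%:R^-1 * \sum_(0 <= i < n) c i * te (en S) (ev (x i)) (g k)) ^+ 2) @ \oo -->
    (n%:R^-1 * \sum_(0 <= i < n) c i * F (x i)) ^+ 2.
  have h : (fun k => n%:R^-1 * \sum_(0 <= i < n) c i * te (en S) (ev (x i)) (g k)) @ \oo -->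
    n%:R^-1 * \sum_(0 <= i < n) c i * F (x i).
    by apply: cvgMr; apply: cvg_sum_nat => i hi; apply: cvgMr; apply: hx; exact: cx.
  by rewrite expr2; under eq_fun do rewrite expr2; exact: cvgM.
have h2 : (fun k => C ^+ size (en S) * Nv (en S) (g k) * K) @ \oo --> C ^+ size (en S) * L * K.
  by apply: cvgMl; apply: cvgMr.
apply: (ler_cvg_to h1 h2); apply: nearW => k.
by apply: noise_rep.
Qed.

Lemma cross_HS S S' F F' g g' L L' (l : nat -> R) (l' K : R) :
  (forall k, vval m (en S) (g k)) -> (forall k, vval m (en S') (g' k)) ->
  (forall y, cube y -> (fun k => te (en S) (ev y) (g k)) @ \oo --> F y) ->
  (forall y, cube y -> (fun k => te (en S') (ev y) (g' k)) @ \oo --> F' y) ->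
  (fun k => Nv (en S) (g k)) @ \oo --> L -> (fun k => Nv (en S') (g' k)) @ \oo --> L' ->
  L <= 2 * NS S F -> L' <= 2 * NS S' F' ->
  (forall k, (fun N => \sum_(nu <- MI m N (en S)) \sum_(nu' <- MI m N (en S'))
     coef m q (en S) nu (g k) * coef m q (en S') nu' (g' k) * ex q (en S) (en S') nu nu') @ \oo --> l k) ->
  l @ \oo --> l' -> 0 <= K ->
  (forall N0, exists2 N, (N0 <= N)%N & \sum_(nu <- MI m N (en S)) \sum_(nu' <- MI m N (en S'))
     (n%:R^-1 * \sum_(0 <= i < n) (Psi q (en S) nu (x i) * Psi q (en S') nu' (x i)
        - ex q (en S) (en S') nu nu')) ^+ 2 / (W m (en S) lam nu * W m (en S') lam nu') <= K) ->
  (n%:R^-1 * \sum_(0 <= i < n) F (x i) * F' (x i) - l') ^+ 2 <= (Dc * NS S F) * (Dc * NS S' F') * K.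
Proof.
move=> hv hv' hx hx' hN hN' hL hL' hl hl' K0 hK.
have p0 S1 (g1 : nat -> vec) (L1 : R) : (forall k, vval m (en S1) (g1 k)) ->
   (fun k => Nv (en S1) (g1 k)) @ \oo --> L1 -> 0 <= L1.
  by move=> h1 h2; apply: (cvgr_to_ge h2); apply: nearW => k; exact: Nv_ge0.
have L0 := p0 _ _ _ hv hN; have L0' := p0 _ _ _ hv' hN'.
have C0 k : 0 <= C ^+ k by rewrite exprn_ge0 // (le_trans ler01).
have bd S1 F1 (L1 : R) : 0 <= L1 -> L1 <= 2 * NS S1 F1 -> C ^+ size (en S1) * L1 <= Dc * NS S1 F1.
  by move=> h1 h2; rewrite /Dc -mulrA; apply: le_trans (Cpow S1 h1) _; rewrite ler_wpM2l.
apply: (@le_trans _ _ ((C ^+ size (en S) * L) * (C ^+ size (en S') * L') * K)); last first.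
  by rewrite ler_wpM2r // ler_pM ?bd // mulr_ge0.
have h1 : (fun k => (n%:R^-1 * \sum_(0 <= i < n) te (en S) (ev (x i)) (g k) * te (en S') (ev (x i)) (g' k) - l k) ^+ 2)
    @ \oo --> (n%:R^-1 * \sum_(0 <= i < n) F (x i) * F' (x i) - l') ^+ 2.
  have h : (fun k => n%:R^-1 * \sum_(0 <= i < n) te (en S) (ev (x i)) (g k) * te (en S') (ev (x i)) (g' k) - l k)
    @ \oo --> n%:R^-1 * \sum_(0 <= i < n) F (x i) * F' (x i) - l'.
    apply: cvgB => //; apply: cvgMr; apply: cvg_sum_nat => i hi.
    by apply: cvgM; [apply: hx|apply: hx']; exact: cx.
  by rewrite expr2; under eq_fun do rewrite expr2; exact: cvgM.
have h2 : (fun k => (C ^+ size (en S) * Nv (en S) (g k)) * (C ^+ size (en S') * Nv (en S') (g' k)) * K) @ \oo -->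
    (C ^+ size (en S) * L) * (C ^+ size (en S') * L') * K.
  by apply: cvgMl; apply: cvgM; apply: cvgMr.
apply: (ler_cvg_to h1 h2); apply: nearW => k.
by apply: cross_rep => //.
Qed.

Lemma diff_HS S S' F F' (K : R) : S != S' -> HS m S F -> HS m S' F' -> 0 <= K ->
  (forall N0, exists2 N, (N0 <= N)%N & \sum_(nu <- MI m N (en S)) \sum_(nu' <- MI m N (en S'))
     (n%:R^-1 * \sum_(0 <= i < n) (Psi q (en S) nu (x i) * Psi q (en S') nu' (x i)
        - ex q (en S) (en S') nu nu')) ^+ 2 / (W m (en S) lam nu * W m (en S') lam nu') <= K) ->
  (n%:R^-1 * \sum_(0 <= i < n) F (x i) * F' (x i)) ^+ 2 <= (Dc * NS S F) * (Dc * NS S' F') * K.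
Proof.
move=> SS hF hF' K0 hK.
have [g [L [hv hx hN _ hL]]] := HS_rep hF; have [g' [L' [hv' hx' hN' _ hL']]] := HS_rep hF'.
(* Such a coordinate makes the population term vanish by [ex_cvg_diff]. *)
have [j hj] : exists j, (j \in en S) != (j \in en S').
  apply/existsP; apply: contraNT SS; rewrite negb_exists => /forallP h.
  apply/eqP/finset.setP => j; have := h j.
  by rewrite negbK /en !mem_enum => /eqP.
rewrite -[X in X ^+ 2]subr0.
apply: (cross_HS hv hv' hx hx' hN hN' hL hL' _ (@cvg_cst _ _ _ _ _)) => // k.
exact: (ex_cvg_diff hm qb (uS S) (uS S') (hv k) (hv' k) hj).
Qed.

Lemma same_HS S F (K : R) : HS m S F -> 0 <= K ->
  (forall N0, exists2 N, (N0 <= N)%N & \sum_(nu <- MI m N (en S)) \sum_(nu' <- MI m N (en S))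
     (n%:R^-1 * \sum_(0 <= i < n) (Psi q (en S) nu (x i) * Psi q (en S) nu' (x i)
        - ex q (en S) (en S) nu nu')) ^+ 2 / (W m (en S) lam nu * W m (en S) lam nu') <= K) ->
  (n%:R^-1 * \sum_(0 <= i < n) F (x i) * F (x i) - VS m S F) ^+ 2 <= (Dc * NS S F) * (Dc * NS S F) * K.
Proof.
move=> hF K0 hK; have [g [L [hv hx hN hV hL]]] := HS_rep hF.
apply: (cross_HS hv hv hx hx hN hN hL hL _ hV) => // k.
exact: (ex_cvg_same hm qb (uS S) (hv k) (hv k)).
Qed.

End Deterministic.

Lemma score_algebra (R : realFieldType) (N lam r2 a b j0 j1 j2 j3 t : R) : N != 0 ->
  ((2 * N)^-1 * (r2 + 2 * t * a + t ^+ 2 * b) +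
     lam / 2 * (j1 + 2 * (1 - t) * j2 + (1 - t) ^+ 2 * j3 + j0)) -
  ((2 * N)^-1 * (r2 + 2 * 0 * a + 0 ^+ 2 * b) +
     lam / 2 * (j1 + 2 * (1 - 0) * j2 + (1 - 0) ^+ 2 * j3 + j0)) =
  0 + 2 * t * ((N^-1 * a - lam * (j2 + j3)) / 2) + t ^+ 2 * ((N^-1 * b + lam * j3) / 2).
Proof. by move=> N0; field. Qed.

Lemma score_norm (R : realFieldType) (a s l j1 j2 v : R) : a - s = l * (j1 + j2) ->
  v + l * j2 = a - l * j1 - (s - v).
Proof. by move=> h; have -> : a = l * (j1 + j2) + s; [rewrite -h; ring|ring]. Qed.

Lemma sqrt_swap (R : rcfType) (l u v : R) : 0 <= l ->
  l * (u * v) = (Num.sqrt l * v) * (Num.sqrt l * u).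
Proof. by move=> /sqr_sqrtr {1}<-; ring. Qed.

Lemma sqrt_prod4 (R : rcfType) (D N N' K : R) : 0 <= D -> 0 <= N -> 0 <= N' ->
  Num.sqrt ((D * N) * (D * N') * K) = Num.sqrt N * (D * Num.sqrt K * Num.sqrt N').
Proof.
move=> D0 N0 N0'.
have -> : (D * N) * (D * N') * K = D ^+ 2 * (N * (N' * K)) by ring.
rewrite sqrtrM ?sqr_ge0 // sqrtr_sqr ger0_norm // sqrtrM // sqrtrM //; ring.
Qed.

(** * First-order condition of the penalised least squares problem *)

Section Optimality.
Context (R : realType) (m d : nat).
Hypothesis hm : (2 <= m)%N.
Variables (SS : {set {set 'I_d}}) (fs fh : {set 'I_d} -> ('I_d -> R) -> R).
Variables (x : nat -> 'I_d -> R) (e : nat -> R) (n : nat) (lam : R).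
Hypotheses (n0 : (0 < n)%N) (l0 : 0 < lam) (hfs : Hfam m SS fs) (hfh : Hfam m SS fh).
Hypothesis hopt : forall F, Hfam m SS F ->
  plsobj m SS x (fun i => evalH SS fs (x i) + e i) n lam fh <=
  plsobj m SS x (fun i => evalH SS fs (x i) + e i) n lam F.

Definition err S (y : 'I_d -> R) := fh S y - fs S y.

Lemma err_HS S : S \in SS -> HS m S (err S).
Proof.
move=> hS; have := HS_comb hm 1 (-1) (hfh hS) (hfs hS).
rewrite (_ : (fun y => _) = err S) //; apply/funext => y; rewrite /err; ring.
Qed.

(* First-order condition along fh - t * err S, which moves the component S only. *)
Lemma score_eq S : S \in SS ->
  n%:R^-1 * \sum_(0 <= i < n) (e i - \sum_(S' in SS) err S' (x i)) * err S (x i) =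
  lam * (JB m S (fs S) (err S) + JS m S (err S)).
Proof.
move=> hS; set h := err S; have hh := err_HS hS; have hf := hfs hS.
pose r i := e i - \sum_(S' in SS) err S' (x i).
pose F t S' y := if S' == S then 1 * fs S y + (1 - t) * h y else fh S' y.
have HF t : Hfam m SS (F t).
  move=> S' hS'; rewrite /F; case: (eqVneq S' S) => [->|_]; last exact: hfh.
  exact: (HS_comb hm).
have F0 : F 0 = fh.
  apply/funext => S'; apply/funext => y; rewrite /F; case: eqP => // ->.
  by rewrite /h /err; ring.
have JF t : Jtot m SS (F t) = (JS m S (fs S) + 2 * (1 - t) * JB m S (fs S) h + (1 - t) ^+ 2 * JS m S h)
    + \sum_(S' in SS | S' != S) JS m S' (fh S').
  have e1 : JS m S (F t S) = JS m S (fs S) + 2 * (1 - t) * JB m S (fs S) h + (1 - t) ^+ 2 * JS m S h.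
    have -> : F t S = (fun y => 1 * fs S y + (1 - t) * h y) by apply/funext => y; rewrite /F eqxx.
    by rewrite (JS_comb hm 1 (1 - t) hf hh) expr1n mul1r mulr1.
  have e2 S' : S' != S -> JS m S' (F t S') = JS m S' (fh S').
    by move=> /negbTE nS; congr (JS _ _ _); apply/funext => y; rewrite /F nS.
  have e3 : \sum_(S' in SS | S' != S) JS m S' (F t S') = \sum_(S' in SS | S' != S) JS m S' (fh S').
    by apply: eq_bigr => S' /andP[_ /e2].
  by rewrite -e1 -e3; exact: (bigD1 S hS).
have RF t i : (evalH SS fs (x i) + e i - evalH SS (F t) (x i)) = r i + t * h (x i).
  have -> : evalH SS (F t) (x i) = evalH SS fh (x i) - t * h (x i).
    have e1 : evalH SS (F t) (x i) = F t S (x i) + \sum_(S' in SS | S' != S) F t S' (x i) := bigD1 S hS.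
    have e2 : evalH SS fh (x i) = fh S (x i) + \sum_(S' in SS | S' != S) fh S' (x i) := bigD1 S hS.
    have e3 : \sum_(S' in SS | S' != S) F t S' (x i) = \sum_(S' in SS | S' != S) fh S' (x i).
      by apply: eq_bigr => S' /andP[_ /negbTE nS]; rewrite /F nS.
    rewrite e1 e2 e3 /F eqxx /h /err; move: (\sum_(S' in SS | S' != S) _) => z; ring.
  have -> : r i = e i - (evalH SS fh (x i) - evalH SS fs (x i)) by rewrite /r /err sumrB.
  ring.
set a := \sum_(0 <= i < n) r i * h (x i).
pose b := \sum_(0 <= i < n) h (x i) ^+ 2.
have SF t : \sum_(i < n) (evalH SS fs (x i) + e i - evalH SS (F t) (x i)) ^+ 2 =
    \sum_(0 <= i < n) r i ^+ 2 + 2 * t * a + t ^+ 2 * b.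
  rewrite -(big_mkord xpredT (fun i => (evalH SS fs (x i) + e i - evalH SS (F t) (x i)) ^+ 2)).
  rewrite /a /b !mulr_sumr -!big_split /=; apply: eq_bigr => i _; rewrite RF; ring.
have nR : 0 < n%:R :> R by rewrite ltr0n.
have b0 : 0 <= b by apply: sumr_ge0 => i _; exact: sqr_ge0.
pose D := n%:R^-1 * a - lam * (JB m S (fs S) h + JS m S h).
suff /eqP : D = 0 by rewrite subr_eq0 => /eqP.
(* The objective along the path minus its value at [t = 0] is a nonnegative quadratic without
   constant term, so the discriminant inequality forces its linear coefficient to vanish. *)
have key : (D / 2) ^+ 2 <= 0 * ((n%:R^-1 * b + lam * JS m S h) / 2).
  apply: quad_disc.
    rewrite divr_ge0 // addr_ge0 // mulr_ge0 ?invr_ge0 ?(ltW nR) ?(ltW l0) //; exact: (JS_ge0 hm).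
  move=> t; have := hopt (HF t); rewrite -{1}F0 /plsobj !SF !JF -subr_ge0.
  by rewrite score_algebra // lt0r_neq0.
by apply/eqP; move: key; rewrite mul0r real_exprn_even_le0 ?num_real //= mulf_eq0 invr_eq0 pnatr_eq0 orbF.
Qed.

Let xs S := Num.sqrt (NS m lam S (err S)).

Lemma norm_le_sqrt (a b : R) : a ^+ 2 <= b -> `|a| <= Num.sqrt b.
Proof. by move=> h; rewrite -sqrtr_sqr ler_wsqrtr. Qed.

(** Every term of the score equation is linear in the error of [S], hence at most its norm times
    something; one factor of the norm then cancels. *)
Lemma norm_ineq (D : R) (KA : {set 'I_d} -> R) (KB : {set 'I_d} -> {set 'I_d} -> R) S :
  S \in SS -> 0 <= D ->
  (n%:R^-1 * \sum_(0 <= i < n) e i * err S (x i)) ^+ 2 <= D * NS m lam S (err S) * KA S ->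
  (forall S', S' \in SS ->
    (n%:R^-1 * \sum_(0 <= i < n) err S (x i) * err S' (x i) - (if S == S' then VS m S (err S) else 0)) ^+ 2
    <= (D * NS m lam S (err S)) * (D * NS m lam S' (err S')) * KB S S') ->
  xs S <= Num.sqrt (D * KA S) + Num.sqrt lam * Num.sqrt (JS m S (fs S)) +
     \sum_(S' in SS) D * Num.sqrt (KB S S') * xs S'.
Proof.
move=> hS D0 hA hB; set h := err S; have hh := err_HS hS; have hf := hfs hS.
set N := NS m lam S h; have N0 : 0 <= N := NS_ge0 hm l0 hh.
have JS0 := JS_ge0 hm hh; have VS0 := VS_ge0 hm hh; have JF0 := JS_ge0 hm hf.
have NE : N = VS m S h + lam * JS m S h by [].
pose a := n%:R^-1 * \sum_(0 <= i < n) e i * h (x i).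
pose b S' := n%:R^-1 * \sum_(0 <= i < n) h (x i) * err S' (x i) - (if S == S' then VS m S h else 0).
have eqN : N = a - lam * JB m S (fs S) h - \sum_(S' in SS) b S'.
  have := score_eq hS; rewrite -/h.
  have -> : n%:R^-1 * \sum_(0 <= i < n) (e i - \sum_(S' in SS) err S' (x i)) * h (x i) =
     a - \sum_(S' in SS) n%:R^-1 * \sum_(0 <= i < n) h (x i) * err S' (x i).
    rewrite /a -mulr_sumr -mulrBr; congr (_ * _); rewrite exchange_big -sumrB.
    apply: eq_bigr => i _ /=; rewrite mulrBl mulr_suml; congr (_ - _).
    by apply: eq_bigr => S' _; rewrite mulrC.
  have -> : \sum_(S' in SS) b S' =
     \sum_(S' in SS) n%:R^-1 * (\sum_(0 <= i < n) h (x i) * err S' (x i)) - VS m S h.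
    rewrite /b sumrB; congr (_ - _); rewrite -big_mkcondr /= (bigD1 S) /= ?hS ?eqxx //.
    by rewrite big1 ?addr0 // => S' /andP[/andP[_ /eqP ->]]; rewrite eqxx.
  by rewrite NE; exact: score_norm.
have x0 : 0 <= xs S := sqrtr_ge0 _.
have xx : xs S * xs S = N by rewrite -expr2 sqr_sqrtr.
have ha : `|a| <= xs S * Num.sqrt (D * KA S).
  apply: le_trans (norm_le_sqrt hA) _; rewrite -/h -/N [D * N]mulrC -mulrA sqrtrM //.
have hb S' : S' \in SS -> `|b S'| <= xs S * (D * Num.sqrt (KB S S') * xs S').
  move=> hS'; apply: le_trans (norm_le_sqrt (hB S' hS')) _; rewrite -/h -/N.
  have N'0 : 0 <= NS m lam S' (err S') := NS_ge0 hm l0 (err_HS hS').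
  by rewrite sqrt_prod4 //; exact: lexx.
have hj : `|lam * JB m S (fs S) h| <= xs S * (Num.sqrt lam * Num.sqrt (JS m S (fs S))).
  have j1 := norm_le_sqrt (JB_sqr_le hm hf hh).
  rewrite normrM (gtr0_norm l0).
  apply: (@le_trans _ _ (lam * (Num.sqrt (JS m S (fs S)) * Num.sqrt (JS m S h)))).
    by rewrite ler_pM2l // -sqrtrM.
  have j2 : Num.sqrt lam * Num.sqrt (JS m S h) <= xs S.
    rewrite -sqrtrM ?(ltW l0) //; apply: ler_wsqrtr; rewrite -/h -/N NE lerDr //.
  rewrite (sqrt_swap _ _ (ltW l0)).
  by rewrite ler_wpM2r // mulr_ge0 // sqrtr_ge0.
have key : xs S * xs S <= xs S * (Num.sqrt (D * KA S) + Num.sqrt lam * Num.sqrt (JS m S (fs S)) +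
     \sum_(S' in SS) D * Num.sqrt (KB S S') * xs S').
  have hs : `|\sum_(S' in SS) b S'| <= xs S * \sum_(S' in SS) D * Num.sqrt (KB S S') * xs S'.
    by apply: le_trans (ler_norm_sum _ _ _) _; rewrite mulr_sumr; apply: ler_sum => S' /hb.
  rewrite xx eqN !mulrDr.
  apply: le_trans (ler_norm _) _; apply: le_trans (ler_normB _ _) _; apply: lerD => //.
  by apply: le_trans (ler_normB _ _) _; apply: lerD.
(* A zero norm cannot be cancelled, but then the claim only says that the right side is
   nonnegative. *)
move: x0; rewrite le_eqVlt => /orP[/eqP <-|xp]; last by rewrite ler_pM2l in key.
rewrite !addr_ge0 ?mulr_ge0 ?sqrtr_ge0 //; apply: sumr_ge0 => S' _.
by rewrite !mulr_ge0 // sqrtr_ge0.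
Qed.

End Optimality.

(* First sum over i and absorb the cross terms, then reinsert the bound on the sum. *)
Lemma absorb (R : realFieldType) (I : finType) (SS : {set I}) (x al ks : I -> R) (a b k r Lam : R) :
  (forall i, i \in SS -> 0 <= x i) -> 0 <= a -> 0 <= b -> 0 <= r -> 0 <= Lam ->
  (forall i, i \in SS -> 0 <= ks i <= k) -> (forall i, i \in SS -> 0 <= al i /\ k * al i <= Lam) ->
  (forall i, i \in SS -> x i <= a * (ks i * r) + al i + \sum_(j in SS) b * (ks i * ks j * r) * x j) ->
  0 <= k -> b * #|SS|%:R * (k * k * r) <= 1 / 2 -> k * k * r <= 1 ->
  forall i, i \in SS -> x i <= (a + 2 * b * #|SS|%:R * (a + Lam)) * (ks i * r) + al i.
Proof.
move=> x0 a0 b0 r0 L0 hk hal hx k0 h1 h2 i hi.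
pose y := \sum_(j in SS) x j; set p : R := #|SS|%:R.
have y0 : 0 <= y by apply: sumr_ge0.
have p0 : 0 <= p by rewrite ler0n.
have step j : j \in SS -> x j <= a * (ks j * r) + al j + b * (ks j * k * r) * y.
  move=> hj; apply: le_trans (hx j hj) _; rewrite lerD2l /y mulr_sumr; apply: ler_sum => l hl.
  have /andP[kl0 kl] := hk l hl; have /andP[kj0 kj] := hk j hj.
  by rewrite ler_wpM2r ?x0 // ler_wpM2l // ler_wpM2r // ler_wpM2l.
have hy : y <= p * (a * (k * r)) + \sum_(j in SS) al j + p * (b * (k * k * r)) * y.
  apply: (@le_trans _ _ (\sum_(j in SS) (a * (k * r) + al j + b * (k * k * r) * y))).
    apply: ler_sum => j hj; apply: le_trans (step j hj) _.
    have /andP[kj0 kj] := hk j hj.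
    apply: lerD; first by rewrite lerD2r ler_wpM2l // ler_wpM2r.
    by rewrite ler_wpM2r // ler_wpM2l // ler_wpM2r // ler_wpM2r.
  have sc c : \sum_(j in SS) c = p * c by rewrite sumr_const /p mulr_natl.
  by rewrite !big_split /= !sc -[p * _ * y]mulrA.
have hs : k * (\sum_(j in SS) al j) <= p * Lam.
  rewrite mulr_sumr /p mulr_natl -sumr_const; apply: ler_sum => j hj; by case: (hal j hj).
(* The smallness of [b p (k k r)] moves half of the total error [y] to the left. Only [k * y] needs
   to be bounded, because reinserting it multiplies the noise rate [ks i * r] of the component
   itself. *)
have hky : k * y <= 2 * p * (a + Lam).
  have y2 : y <= 2 * (p * (a * (k * r)) + \sum_(j in SS) al j).
    have : p * (b * (k * k * r)) * y <= 1 / 2 * y.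
      by apply: ler_wpM2r => //; rewrite mulrA [p * b]mulrC.
    by lra.
  apply: le_trans (ler_wpM2l k0 y2) _.
  have : k * (p * (a * (k * r))) <= p * a.
    have -> : k * (p * (a * (k * r))) = (p * a) * (k * k * r) by ring.
    by rewrite ler_piMr // mulr_ge0.
  by lra.
have /andP[ki0 ki] := hk i hi.
apply: le_trans (step i hi) _.
have : b * (ks i * k * r) * y <= 2 * b * p * (a + Lam) * (ks i * r).
  have -> : b * (ks i * k * r) * y = (b * (ks i * r)) * (k * y) by ring.
  have -> : 2 * b * p * (a + Lam) * (ks i * r) = (b * (ks i * r)) * (2 * p * (a + Lam)) by ring.
  by rewrite ler_wpM2l // mulr_ge0 // mulr_ge0.
by rewrite mulrDl; lra.
Qed.

Section UnionBound.
Context (R : realType) (d0 : measure_display) (T : measurableType d0) (P : probability T R).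

Lemma union_bound (A : eqType) (s : seq A) (F : A -> set T) (r : A -> R) :
  (forall a, a \in s -> measurable (F a) /\ (P (F a) <= (r a)%:E)%E) ->
  exists U : set T, [/\ measurable U, (P U <= (\sum_(a <- s) r a)%:E)%E &
    forall w, ~ U w -> forall a, a \in s -> ~ F a w].
Proof.
elim: s => [|a s IH] h.
  by exists set0; split=> //; rewrite measure0 big_nil.
have [|U [mU PU hU]] := IH; first by move=> a' ha; apply: h; rewrite inE ha orbT.
have [mF PF] := h a (mem_head _ _).
exists (F a `|` U); split.
- exact: measurableU.
- apply: le_trans (measureU2 P mF mU) _.
  by rewrite big_cons EFinD; exact: leeD.
- by move=> w /not_orP[w1 w2] a'; rewrite inE => /orP[/eqP ->|ha] //; exact: hU ha.
Qed.

End UnionBound.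

(** * An event of high probability for all components *)

Section GoodEvent.
Context (R : realType) (d m : nat) (hm : (2 <= m)%N) (q : nat -> {poly R}).
Context (d0 : measure_display) (T : measurableType d0) (P : probability T R).
Context (X : nat -> T -> 'I_d -> R) (eps : nat -> T -> R).
Hypothesis hXmeas : forall i j, measurable_fun setT (fun w => X i w j).
Hypothesis hepsmeas : forall i, measurable_fun setT (eps i).
Hypothesis hindep : mutual_indep P (fun p : nat * option 'I_d =>
  match p.2 with Some j => fun w => X p.1 w j | None => eps p.1 end).
Hypothesis hunif : forall i j (B : set R), measurable B ->
  P ((fun w => X i w j) @^-1` B) = lebesgue_measure (B `&` `[0%R, 1%R]).
Hypothesis hident : forall i (B : set R), measurable B ->
  P (eps i @^-1` B) = P (eps 0%N @^-1` B).
Hypothesis heps : intg P setT (fun w => eps 0%N w ^+ 4).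
Hypothesis hmean : I P setT (eps 0%N) = 0.
Let s2 := I P setT (fun w => eps 0%N w ^+ 2).
Let en (S : {set 'I_d}) : seq 'I_d := enum (mem S).
Let kap (S : {set 'I_d}) (l : R) : R := kappa m #|S| l.

Definition often (u : nat -> R) (c : R) := forall N0, exists2 N, (N0 <= N)%N & u N <= c.

Lemma kap_gt0 S l : 0 < l -> 1 <= - ln l -> 0 < kap S l.
Proof.
move=> l0 L1; rewrite /kap /kappa; case: #|_| => // k.
by rewrite mulr_gt0 ?powR_gt0 // exprn_gt0 // (lt_le_trans ltr01).
Qed.

(** The constants depend on [e] but neither on [n] nor on [lam]. Off the event, all frame bounds
    hold simultaneously for the finitely many sets and pairs, and the design points lie in the cube
    almost surely. *)
Lemma good_event (e : R) : 0 < e -> exists a b : R, [/\ 0 <= a, 0 <= b &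
  forall n (lam : R), (0 < n)%N -> 0 < lam -> 1 <= - ln lam ->
  exists A : set T, [/\ measurable A, (P A <= e%:E)%E & forall w, ~ A w ->
    [/\ forall i, (i < n)%N -> cube (X i w),
        forall S, often (fun N => QN m q X eps n lam (en S) N w) (n%:R^-1 * kap S lam * a) &
        forall S S', often (fun N => QX m q X n lam (en S) (en S') N w) (n%:R^-1 * (kap S lam * kap S' lam) * b)]]].
Proof.
move=> e0.
have [C C0 hC] : exists2 C : R, 0 < C & forall S N x (lam : R), 0 < lam -> 1 <= - ln lam ->
    \sum_(nu <- MI m N (en S)) Psi q (en S) nu x ^+ 2 / W m (en S) lam nu <= C * kap S lam.
  pose Q (S : {set 'I_d}) (C : R) := 0 < C /\ forall N s (x : 'I_d -> R) (lam : R), uniq s -> size s = #|S| ->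
    0 < lam -> 1 <= - ln lam ->
    \sum_(nu <- MI m N s) Psi q s nu x ^+ 2 / W m s lam nu <= C * kappa m #|S| lam.
  have hQ S : exists C, Q S C.
    by have [C c0 hC] := kernel_bound hm d q #|S|; exists C.
  have [C hC] := choice hQ.
  exists (1 + \sum_(S : {set 'I_d}) C S).
    by rewrite ltr_pwDl // sumr_ge0 // => S _; exact: ltW (proj1 (hC S)).
  move=> S N x lam l0 L1; have [CS hS] := hC S.
  apply: le_trans (hS N (en S) x lam (enum_uniq _) _ l0 L1) _; first by rewrite -cardE.
  apply: ler_wpM2r; first exact: ltW (kap_gt0 S l0 L1).
  rewrite (bigD1 S) //= addrCA lerDl addr_ge0 // sumr_ge0 // => S' _; exact: ltW (proj1 (hC S')).
have s20 : 0 <= s2 by apply: I_ge0 => w _; exact: sqr_ge0.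
pose p : R := #|{: {set 'I_d}}|%:R.
have p0 : 0 < p by rewrite ltr0n; apply/card_gt0P; exists finset.set0.
(* Thresholds for Markov: with [p] subsets, each noise event gets probability [e / (2 p)] and each
   pair [e / (2 p^2)], in total [e]. Adding 1 to [s2] keeps [a] positive for degenerate noise. *)
pose a := C * (s2 + 1) * (2 * p) / e; pose b := C ^+ 2 * (2 * p ^+ 2) / e.
have a0 : 0 < a by rewrite /a !divr_gt0 ?mulr_gt0 // ltr_wpDl.
have b0 : 0 < b by rewrite /b !divr_gt0 ?mulr_gt0 // exprn_gt0.
exists a, b; split; [exact: ltW|exact: ltW|].
move=> n lam n0 l0 L1.
have nR : 0 < n%:R^-1 :> R by rewrite invr_gt0 ltr0n.
have k0 S := kap_gt0 S l0 L1.
have us S : uniq (en S) := enum_uniq (mem S).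
have evN S : exists A : set T, [/\ measurable A, (P A <= (e / (2 * p))%:E)%E & forall w, ~ A w ->
     often (fun N => QN m q X eps n lam (en S) N w) (n%:R^-1 * kap S lam * a)].
  have mn N := QN_mean hXmeas hepsmeas hindep hunif hident heps hmean (us S) l0 n0
     (fun x => hC S N x lam l0 L1).
  have kS := k0 S; have c0 : 0 < n%:R^-1 * kap S lam * a by do 2 apply: mulr_gt0 => //.
  have [A [mA PA hA]] := markov_io (fun N => proj1 (mn N)) (fun N w => QN_ge0 m q X eps n (en S) N w l0) c0 (fun N => proj2 (mn N)).
  exists A; split=> //; apply: le_trans PA _; rewrite lee_fin.
  rewrite ler_pdivrMr //.
  have -> : e / (2 * p) * (n%:R^-1 * kap S lam * a) = n%:R^-1 * (C * kap S lam * (s2 + 1)).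
    rewrite /a; field; by rewrite !lt0r_neq0 // ltr0n.
  rewrite ler_pM2l // ler_pM2l ?mulr_gt0 // -/s2; lra.
have evX (pr : {set 'I_d} * {set 'I_d}) : exists A : set T, [/\ measurable A, (P A <= (e / (2 * p ^+ 2))%:E)%E & forall w, ~ A w ->
     often (fun N => QX m q X n lam (en pr.1) (en pr.2) N w) (n%:R^-1 * (kap pr.1 lam * kap pr.2 lam) * b)].
  have mn N := QX_mean hXmeas hepsmeas hindep hunif (us pr.1) (us pr.2) l0 n0
     (fun x => hC pr.1 N x lam l0 L1) (fun x => hC pr.2 N x lam l0 L1).
  have k1 := k0 pr.1; have k2 := k0 pr.2.
  have c0 : 0 < n%:R^-1 * (kap pr.1 lam * kap pr.2 lam) * b.
    by apply: mulr_gt0 => //; apply: mulr_gt0 => //; apply: mulr_gt0.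
  have [A [mA PA hA]] := markov_io (fun N => proj1 (mn N)) (fun N w => QX_ge0 m q X n (en pr.1) (en pr.2) N w l0) c0 (fun N => proj2 (mn N)).
  exists A; split=> //; apply: le_trans PA _; rewrite lee_fin.
  rewrite ler_pdivrMr // le_eqVlt; apply/orP; left; apply/eqP.
  by rewrite /b; field; rewrite !lt0r_neq0 // ltr0n.
have [FN hFN] := choice evN; have [FX hFX] := choice evX.
have [|UN [mUN PUN hUN]] := @union_bound _ _ _ P _ (index_enum {set 'I_d}) FN (fun=> e / (2 * p)).
  by move=> S _; have [] := hFN S.
have [|UX [mUX PUX hUX]] := @union_bound _ _ _ P _ (index_enum ({set 'I_d} * {set 'I_d})%type) FX (fun=> e / (2 * p ^+ 2)).
  by move=> S _; have [] := hFX S.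
have [|UC [mUC PUC hUC]] := @union_bound _ _ _ P _ [seq (i, j) | i <- iota 0 n, j <- enum 'I_d]
   (fun ij => [set w | ~ (`[0%R, 1%R]%classic : set R) (X ij.1 w ij.2)]) (fun=> 0).
  by move=> [i j] _; have [h1 h2] := X_out_null hXmeas hunif i j; rewrite h2.
exists (UN `|` (UX `|` UC)); split.
- by apply: measurableU => //; exact: measurableU.
- apply: le_trans (measureU2 P mUN (measurableU _ _ mUX mUC)) _.
  apply: le_trans (leeD (lexx _) (measureU2 P mUX mUC)) _.
  apply: le_trans (leeD PUN (leeD PUX PUC)) _.
  have sc (A : finType) (c : R) : \sum_(i <- index_enum A) c = #|A|%:R * c.
    by rewrite sumr_const mulr_natl.
  have -> : (\sum_(i <- [seq (i, j) | i <- iota 0 n, j <- enum 'I_d]) (0 : R)) = 0 by rewrite big1.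
  rewrite -!EFinD lee_fin addr0 !sc card_prod natrM -/p.
  rewrite le_eqVlt; apply/orP; left; apply/eqP; field; exact: lt0r_neq0.
- move=> w /not_orP[w1 /not_orP[w2 w3]]; split.
  + move=> i hi j; have := hUC w w3 (i, j); rewrite allpairs_f ?mem_iota ?mem_enum // => /(_ isT) /contrapT /=.
    by rewrite in_itv.
  + by move=> S; have [_ _] := hFN S; apply; apply: hUN w1 _ _; exact: mem_index_enum.
  + by move=> S S'; have [_ _] := hFX (S, S'); apply; apply: hUX w2 _ _; exact: mem_index_enum.
Qed.

End GoodEvent.

(** * Rates *)

Section Asymptotics.
Context (R : realType) (m : nat).
Hypothesis hm : (2 <= m)%N.

Let m0 : (m%:R : R) != 0.
Proof. by rewrite pnatr_eq0 -lt0n ltnW. Qed.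

Lemma kappa_ge0 s (l : R) : 1 <= - ln l -> 0 <= kappa m s l.
Proof.
by move=> L1; case: s => // s; rewrite /kappa mulr_ge0 ?powR_ge0 // exprn_ge0 // (le_trans ler01).
Qed.

Lemma kappa_mono s s' (l : R) : 0 < l -> l <= 1 -> 1 <= - ln l -> (s <= s')%N ->
  kappa m s l <= kappa m s' l.
Proof.
move=> l0 l1 L1; case: s' => [|s']; first by rewrite leqn0 => /eqP ->.
have p1 : 1 <= l `^ (- (1 / (2 * m%:R))).
  rewrite powRN invr_ge1 ?unitfE ?lt0r_neq0 ?powR_gt0 //.
  apply: (@le_trans _ _ (1 `^ (1 / (2 * m%:R)))); last by rewrite powR1.
  by apply: ge0_ler_powR; rewrite ?nnegrE ?(ltW l0) // divr_ge0 // mulr_ge0.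
case: s => [_|s]; rewrite /kappa.
  by rewrite -[leLHS]mulr1 ler_pM // exprn_ege1.
by rewrite ltnS => ss; rewrite ler_wpM2l ?powR_ge0 // ler_weXn2l.
Qed.

Lemma sqrt_powR (a : R) : 0 <= a -> a `^ (1 / 2) = Num.sqrt a.
Proof. by move=> a0; rewrite div1r powR12_sqrt. Qed.

Lemma sqrt_inv_nat n : n%:R `^ (- (1 / 2)) = Num.sqrt (n%:R^-1 : R).
Proof. by rewrite powRN sqrt_powR ?ler0n // sqrtrV ?ler0n. Qed.

(** The real powers of the stated rate are square roots of the factors of [kappa]; for [s = 0] the
    formulas differ, and the intercept is handled separately. *)
Lemma rateS_kappa s n (l j : R) : (0 < s)%N -> 0 < l -> 1 <= - ln l -> 0 <= j ->
  rateS m%:R s%:R n%:R l j =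
  Num.sqrt (kappa m s l) * Num.sqrt n%:R^-1 + Num.sqrt l * Num.sqrt j.
Proof.
case: s => // s _ l0 L1 j0; have L0 : 0 <= - ln l by apply: le_trans L1.
rewrite /rateS !sqrt_powR ?(ltW l0) // sqrt_inv_nat; congr (_ + _).
have e1 : l `^ (- (1 / (4 * m%:R))) = Num.sqrt (l `^ (- (1 / (2 * m%:R)))).
  by rewrite -sqrt_powR ?powR_ge0 // -powRrM; congr (_ `^ _); field; rewrite m0.
have e2 : (- ln l) `^ ((s.+1%:R - 1) / 2) = Num.sqrt ((- ln l) ^+ s).
  rewrite -sqrt_powR ?exprn_ge0 // -powR_mulrn // -powRrM; congr (_ `^ _).
  by rewrite -natr1 addrK mulrA mulr1.
by rewrite e1 e2 /kappa sqrtrM ?powR_ge0 // [RHS]mulrC mulrA.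
Qed.

(** Collects what the deterministic argument asks for large [n]: a small interaction
    [kappa / sqrt n] and a bounded bias factor [lam * kappa]. *)
Lemma regime (lam : nat -> R) s (dl : R) : (forall n, 0 < lam n) -> 0 < dl ->
  (fun n => Num.sqrt n%:R * lam n) @ \oo --> 0 ->
  (fun n => n%:R^-1 * lam n `^ (- (1 / m%:R)) * (- ln (lam n)) `^ (2 * s%:R - 2)) @ \oo --> 0 ->
  exists N : nat, forall n, (N <= n)%N ->
    [/\ (0 < n)%N, lam n <= 1, 1 <= - ln (lam n),
       kappa m s (lam n) * Num.sqrt n%:R^-1 <= dl & lam n * kappa m s (lam n) <= 1].
Proof.
move=> l0 dl0 h1 h2.
(* Since [lam n <= sqrt n * lam n], being below exp(-1) gives [- ln (lam n) >= 1]. *)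
pose c : R := Num.min (expR (-1)) 1.
have c0 : 0 < c by rewrite /c lt_min expR_gt0 ltr01.
pose c2 : R := Num.min dl 1; have c20 : 0 < c2 by rewrite /c2 lt_min dl0 ltr01.
have [N1 _ H1] := cvgr_lt _ h1 _ c0.
have [N2 _ H2] : \forall n \near \oo, n%:R^-1 * lam n `^ (- (1 / m%:R)) * (- ln (lam n)) `^ (2 * s%:R - 2) < c2 ^+ 2.
  by apply: (cvgr_lt _ h2); rewrite exprn_gt0.
have [N3 _ H3] : \forall n \near \oo, (n%:R^-1 : R) < c2 ^+ 2.
  have h3 : (fun n => (n.+1%:R^-1 : R)) @ \oo --> 0 by exact: cvg_harmonic.
  have [N3 _ H3] : \forall n \near \oo, (n.+1%:R^-1 : R) < c2 ^+ 2.
    by apply: (cvgr_lt _ h3); rewrite exprn_gt0.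
  by exists N3.+1 => // -[//|n] /= hn; apply: H3.
exists (maxn 1 (maxn N1 (maxn N2 N3))) => n; rewrite !geq_max => /and4P[n0 n1 n2 n3].
have nR : 0 < n%:R :> R by rewrite ltr0n.
have s1 : 1 <= Num.sqrt (n%:R : R) by rewrite -[leLHS]sqrtr1 ler_wsqrtr // ler1n.
have hl := H1 n n1.
have ll : lam n <= Num.sqrt n%:R * lam n by rewrite ler_peMl // ltW.
have [lt1 lt2] : lam n < expR (-1) /\ lam n < 1.
  by have := le_lt_trans ll hl; rewrite /c lt_min => /andP[].
have L1 : 1 <= - ln (lam n).
  by rewrite lerNr -(expRK (-1)) ler_ln ?posrE ?expR_gt0 // ltW.
have L0 : 0 <= - ln (lam n) by apply: le_trans L1.
have k0 := kappa_ge0 s L1.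
have key : kappa m s (lam n) * Num.sqrt n%:R^-1 <= c2.
  have kk : (kappa m s (lam n) * Num.sqrt n%:R^-1) ^+ 2 < c2 ^+ 2.
    rewrite exprMn sqr_sqrtr ?invr_ge0 //.
    (* For [s = 0], [kappa] is 1 and the decay of [1 / n] alone is used; otherwise the second rate
       condition is exactly [kappa ^+ 2 / n]. *)
    case: (s) H2 => [|s'] H2; first by rewrite /kappa expr1n mul1r; exact: H3.
    apply: le_lt_trans (H2 n n2); rewrite le_eqVlt; apply/orP; left; apply/eqP.
    have e1 : lam n `^ (- (1 / m%:R)) = (lam n `^ (- (1 / (2 * m%:R)))) ^+ 2.
      by rewrite -powR_mulrn ?powR_ge0 // -powRrM; congr (_ `^ _); field; rewrite m0.
    have e2 : (- ln (lam n)) `^ (2 * s'.+1%:R - 2) = ((- ln (lam n)) ^+ s') ^+ 2.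
      rewrite -exprM -powR_mulrn //; congr (_ `^ _).
      by rewrite -natr1 natrM; ring.
    by rewrite e1 e2 /kappa exprMn; ring.
  by rewrite ltW // -(ltr_pXn2r (n := 2)) // nnegrE ?mulr_ge0 ?sqrtr_ge0 // ltW.
split=> //; first exact: ltW.
- by apply: le_trans key _; rewrite /c2 ge_min lexx.
- have -> : lam n * kappa m s (lam n) = (Num.sqrt n%:R * lam n) * (kappa m s (lam n) * Num.sqrt n%:R^-1).
    rewrite sqrtrV // mulrACA [_ * (_ / _)]mulrC; field.
    by rewrite lt0r_neq0 // sqrtr_gt0.
  rewrite -[leRHS]mulr1; apply: ler_pM => //.
  + by rewrite mulr_ge0 ?sqrtr_ge0 // ltW.
  + by rewrite mulr_ge0 ?sqrtr_ge0.
  + by apply: le_trans (ltW hl) _; rewrite /c ge_min lexx orbT.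
  + by apply: le_trans key _; rewrite /c2 ge_min lexx orbT.
Qed.

End Asymptotics.

Theorem theorem2 (R : realType) (d m : nat) (hd : (1 <= d)%N) (hm : (2 <= m)%N)
  (SS : {set {set 'I_d}}) (hSS0 : finset.set0 \in SS)
  (fstar : {set 'I_d} -> ('I_d -> R) -> R) (hfstar : Hfam m SS fstar)
  (CJ : {set 'I_d} -> R)
  (hCJ : forall S, S \in SS -> S != finset.set0 ->
           0 < CJ S /\ JS m S (fstar S) <= CJ S)
  (d0 : measure_display) (T : measurableType d0) (P : probability T R)
  (X : nat -> T -> 'I_d -> R) (eps : nat -> T -> R) (sigma : R)
  (hXmeas : forall i j, measurable_fun setT (fun w => X i w j))
  (hepsmeas : forall i, measurable_fun setT (eps i))
  (hindep : mutual_indep P (fun p : nat * option 'I_d =>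
              match p.2 with Some j => fun w => X p.1 w j | None => eps p.1 end))
  (hunif : forall i j (B : set R), measurable B ->
     P ((fun w => X i w j) @^-1` B) = lebesgue_measure (B `&` `[0%R, 1%R]))
  (hident : forall i (B : set R), measurable B ->
     P (eps i @^-1` B) = P (eps 0%N @^-1` B))
  (heps4 : P.-integrable setT (fun w => ((eps 0%N w) ^+ 4)%:E))
  (hmean : ('E_P[eps 0%N] = 0)%E)
  (hvar : ('V_P[eps 0%N] = (sigma ^+ 2)%:E)%E)
  (lam : nat -> R) (hlam : forall n, 0 < lam n)
  (tau : R)
  (htau : if (ssup SS <= 1)%N then tau = 0 else 0 < tau < 2 * m%:R - 2)
  (hlam1 : (fun n => Num.sqrt n%:R * lam n) @ \oo --> 0)
  (hlam2 : (fun n => n%:R^-1 * lam n `^ (- (1 / m%:R))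
                     * (- ln (lam n)) `^ (2 * (ssup SS)%:R - 2)) @ \oo --> 0)
  (hlam3 : (fun n => Num.sqrt n%:R *
              rate_alpha m%:R (ssup SS)%:R tau n%:R (lam n) (Jtot m SS fstar))
           @ \oo --> 0)
  (fhat : nat -> T -> {set 'I_d} -> ('I_d -> R) -> R)
  (hfhat : forall n w, (forall i, (i < n)%N -> cube (X i w)) ->
     Hfam m SS (fhat n w) /\
     forall F, Hfam m SS F ->
       plsobj m SS (fun i => X i w) (fun i => evalH SS fstar (X i w) + eps i w)
         n (lam n) (fhat n w)
       <= plsobj m SS (fun i => X i w) (fun i => evalH SS fstar (X i w) + eps i w)
         n (lam n) F) :
  (forall S, S \in SS -> S != finset.set0 ->
     OP P (fun n w => normS m S (lam n) (fun x => fhat n w S x - fstar S x))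
          (fun n => rateS m%:R #|S|%:R n%:R (lam n) (JS m S (fstar S)))) /\
  OP P (fun n w => `|fhat n w finset.set0 (@origin R d) - fstar finset.set0 (@origin R d)|)
       (fun n => n%:R `^ (- (1/2))).
Proof.
have [q qb] := orthobasis_exists R m.+1.
have [C C1 hC] := coef_energy d hm qb.
have hmean' : I P setT (eps 0%N) = 0.
  by move: hmean; rewrite unlock /I /Rintegral => ->.
pose er n w S y := fhat n w S y - fstar S y.
have main (e : R) : 0 < e -> exists2 M : R, 0 < M & exists N : nat, forall n, (N <= n)%N ->
    [/\ 0 < lam n, lam n <= 1, 1 <= - ln (lam n) & exists A : set T, [/\ measurable A, (P A <= e%:E)%E &
    forall w, ~ A w -> forall S, S \in SS -> HS m S (er n w S) /\ normS m S (lam n) (er n w S) <=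
      M * (Num.sqrt (kappa m #|S| (lam n)) * Num.sqrt n%:R^-1 + Num.sqrt (lam n) * Num.sqrt (JS m S (fstar S)))]].
  move=> e0.
  have [a [b [a0 b0 hab]]] := good_event hm q hXmeas hepsmeas hindep hunif hident heps4 hmean' e0.
  pose D : R := Dc d C; have D0 : 0 <= D by rewrite /D /Dc mulr_ge0 // exprn_ge0 // (le_trans ler01).
  pose al := Num.sqrt (D * a); pose be := D * Num.sqrt b.
  have al0 : 0 <= al by exact: sqrtr_ge0.
  have be0 : 0 <= be by rewrite mulr_ge0 // sqrtr_ge0.
  (* The smoothness of the true function is fixed in [n], so it may enter the constant multiplying
     the noise rate. *)
  pose Lam := \sum_(S in SS) Num.sqrt (JS m S (fstar S)).
  have Lam0 : 0 <= Lam by apply: sumr_ge0 => S _; exact: sqrtr_ge0.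
  pose p : R := #|SS|%:R; have p0 : 0 <= p by rewrite ler0n.
  have q0 : 0 < be * p + 1 by rewrite ltr_wpDl // mulr_ge0.
  (* Chosen to meet both smallness conditions of [absorb], where [k * k * r] is [kappa / sqrt n] at
     the largest set. *)
  pose dl : R := Num.min 1 (1 / 2 / (be * p + 1)).
  have dl0 : 0 < dl by rewrite /dl lt_min ltr01 divr_gt0.
  have [N hN] := regime hm hlam dl0 hlam1 hlam2.
  pose M0 := al + 2 * be * p * (al + Lam).
  have M00 : 0 <= M0.
    have h1 := addr_ge0 al0 Lam0.
    by rewrite /M0 addr_ge0 // mulr_ge0 // mulr_ge0 // mulr_ge0.
  exists (1 + M0); first by rewrite ltr_pwDl.
  exists N => n nN; have [n0 l1 L1 hk1 hk2] := hN n nN; have l0 := hlam n; split=> //.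
  have [A [mA PA hA]] := hab n (lam n) n0 l0 L1; exists A; split=> // w Aw.
  have [cX hQN hQX] := hA w Aw.
  (* From here on the sample is fixed off [A] and the argument is deterministic. *)
  have [hfh hopt] := hfhat n w cX.
  have hE S : S \in SS -> HS m S (er n w S) := err_HS hm hfstar hfh (S := S).
  pose r : R := Num.sqrt n%:R^-1.
  have r0 : 0 <= r by exact: sqrtr_ge0.
  have rr : n%:R^-1 = r * r by rewrite /r -expr2 sqr_sqrtr // invr_ge0.
  pose ks (S : {set 'I_d}) := Num.sqrt (kappa m #|S| (lam n)).
  have kk (S : {set 'I_d}) : kappa m #|S| (lam n) = ks S * ks S.
    by rewrite /ks -expr2 sqr_sqrtr // kappa_ge0.
  have ks0 S : 0 <= ks S by exact: sqrtr_ge0.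
  have ni : 0 <= n%:R^-1 :> R by rewrite invr_ge0.
  pose k := Num.sqrt (kappa m (ssup SS) (lam n)).
  have kkb : kappa m (ssup SS) (lam n) = k * k by rewrite /k -expr2 sqr_sqrtr // kappa_ge0.
  have bound S : S \in SS -> normS m S (lam n) (er n w S) <= M0 * (ks S * r) + Num.sqrt (lam n) * Num.sqrt (JS m S (fstar S)).
    apply: (@absorb _ _ SS (fun S => normS m S (lam n) (er n w S))
      (fun S => Num.sqrt (lam n) * Num.sqrt (JS m S (fstar S))) ks al be k r Lam) => //.
    - by move=> S' _; exact: sqrtr_ge0.
    - move=> S' hS'; rewrite ks0 /= /ks /k ler_wsqrtr // kappa_mono //.
      by rewrite /ssup (bigD1 S' hS') leq_maxl.
    - move=> S' hS'; split; first by rewrite mulr_ge0 ?sqrtr_ge0.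
      (* The bias of one component, amplified by the kernel of the largest set, stays bounded
         because [lam * kappa <= 1]. *)
      have kl : k * Num.sqrt (lam n) <= 1.
        by rewrite -sqrtrM ?kappa_ge0 // -[leRHS]sqrtr1 ler_wsqrtr // mulrC.
      apply: (@le_trans _ _ (Num.sqrt (JS m S' (fstar S')))).
        by rewrite mulrA ler_piMl ?sqrtr_ge0.
      rewrite /Lam (bigD1 S') //= lerDl; apply: sumr_ge0 => S1 _; exact: sqrtr_ge0.
    - move=> S' hS'.
      have K0 : 0 <= n%:R^-1 * kappa m #|S'| (lam n) * a by rewrite !mulr_ge0 ?kappa_ge0.
      have hA1 := noise_HS hm qb C1 hC cX l0 l1 (hE S' hS') K0 (hQN S').
      have K1 (S1 : {set 'I_d}) : 0 <= n%:R^-1 * (kappa m #|S'| (lam n) * kappa m #|S1| (lam n)) * b.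
        by rewrite !mulr_ge0 ?kappa_ge0.
      have hB1 S1 : S1 \in SS ->
        (n%:R^-1 * \sum_(0 <= i < n) er n w S' (X i w) * er n w S1 (X i w)
           - (if S' == S1 then VS m S' (er n w S') else 0)) ^+ 2 <=
        (D * NS m (lam n) S' (er n w S')) * (D * NS m (lam n) S1 (er n w S1)) *
           (n%:R^-1 * (kappa m #|S'| (lam n) * kappa m #|S1| (lam n)) * b).
        move=> hS1; case: (eqVneq S' S1) => [e1|ne].
          have hQ := hQX S' S'; rewrite -e1.
          exact: (same_HS hm qb C1 hC n0 cX l0 l1 (hE S' hS') (K1 S') hQ).
        rewrite subr0.
        exact: (diff_HS hm qb C1 hC n0 cX l0 l1 ne (hE S' hS') (hE S1 hS1) (K1 S1) (hQX S' S1)).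
      pose KA (S : {set 'I_d}) := n%:R^-1 * kappa m #|S| (lam n) * a.
      pose KB (S1 S2 : {set 'I_d}) := n%:R^-1 * (kappa m #|S1| (lam n) * kappa m #|S2| (lam n)) * b.
      have := @norm_ineq R m d hm SS fstar (fhat n w) (fun i => X i w) (fun i => eps i w) n (lam n)
        n0 l0 hfstar hfh hopt D KA KB S' hS' D0 hA1 hB1.
      have -> : Num.sqrt (D * KA S') = al * (ks S' * r).
        have -> : D * KA S' = (ks S' * r) ^+ 2 * (D * a) by rewrite /KA kk rr; ring.
        rewrite sqrtrM ?sqr_ge0 // sqrtr_sqr ger0_norm ?mulr_ge0 //; exact: mulrC.
      rewrite (eq_bigr (fun S1 => be * (ks S' * ks S1 * r) * normS m S1 (lam n) (er n w S1))) // => S1 _.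
      have -> : KB S' S1 = (ks S' * ks S1 * r) ^+ 2 * b by rewrite /KB !kk rr; ring.
      rewrite sqrtrM ?sqr_ge0 // sqrtr_sqr ger0_norm ?mulr_ge0 //.
      by rewrite /be -[D * Num.sqrt b * _]mulrA [Num.sqrt b * _]mulrC.
    - by rewrite /k sqrtr_ge0.
    - rewrite -kkb; apply: (@le_trans _ _ ((be * p + 1) * dl)).
        apply: ler_pM => //; [by rewrite mulr_ge0|by rewrite mulr_ge0 ?kappa_ge0|by rewrite lerDl].
      apply: (@le_trans _ _ ((be * p + 1) * (1 / 2 / (be * p + 1)))).
        by rewrite ler_pM2l // /dl ge_min lexx orbT.
      by rewrite mulrC divfK // lt0r_neq0.
    - by rewrite -kkb; apply: le_trans hk1 _; rewrite /dl ge_min lexx.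
  move=> S hS; split; first exact: hE.
  apply: le_trans (bound S hS) _; rewrite [leRHS]mulrDr; apply: lerD.
    by rewrite ler_wpM2r ?mulr_ge0 // lerDr.
  by rewrite ler_peMl ?mulr_ge0 ?sqrtr_ge0 // lerDl.
split=> [S hS S0 e e0|e e0].
  have [M M0 [N hN]] := main e e0; exists M; split=> //; exists N => n nN.
  have [l0 l1 L1 [A [mA PA hA]]] := hN n nN; exists A; split=> //; split=> // w /= hw.
  apply: contrapT => Aw; have [_ hb] := hA w Aw S hS.
  move: hw; rewrite ger0_norm ?sqrtr_ge0 // rateS_kappa ?card_gt0 //; last exact: (JS_ge0 hm (hfstar S hS)).
  by rewrite ltNge hb.
(* For the empty set the penalty is 0 and [kappa] is 1, so the common bound reads [M] times
   n^(-1/2). *)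
have [M M0 [N hN]] := main e e0; exists M; split=> //; exists N => n nN.
have [l0 l1 L1 [A [mA PA hA]]] := hN n nN; exists A; split=> //; split=> // w /= hw.
apply: contrapT => Aw; have [_ hb] := hA w Aw finset.set0 hSS0.
move: hb hw; rewrite /normS /VS /JS eqxx mulr0 addr0 sqrtr_sqr sqrtr0 mulr0 addr0.
by rewrite sqrt_inv_nat cards0 /kappa sqrtr1 mul1r normr_id ltNge => ->.
Qed.
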